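(* Let $\phi\colon A\to L[\tau]$ be a Drinfeld module with generic characteristic, where $L$ is a finitely generated field. Then the centralizer of $\rho_\infty(W_L)$ in $D_\phi$ is $\mathrm{End}_L(\phi)\otimes_AF_\infty$ (viewed as the $F_\infty$-subalgebra of $D_\phi$ which is the image of the natural map $\mathrm{End}_L(\phi)\otimes_AF_\infty\to D_\phi$).
   Context: Let $F$ be a global function field with constant field $k$, $q=|k|$; fix a place $\infty$, let $A$ be the ring of functions regular away from $\infty$, $F_\infty$ the completion, $\mathrm{ord}_\infty$ its valuation, $d_\infty=[\mathbb F_\infty:k]$. For a field $L\supseteq k$: $\bar L$, $L^{\mathrm{sep}}$, $\bar k$ (algebraic closure of $k$ in $\bar L$), $\mathrm{Gal}_L$, $L^{\mathrm{perf}}$ as usual; $W_L\subseteq\mathrm{Gal}_L$ is the set of $\sigma$ acting on $\bar k$ as $x\mapsto x^{q^{\deg\sigma}}$, $\deg\sigma\in\mathbb Z$. $L[\tau]$: twisted polynomials, $\tau a=a^q\tau$; for perfect $M\supseteq k$, $M(\!(\tau^{-1})\!)$ is the skew field of twisted Laurent series in $\tau^{-1}$ (with $\tau^{-1}a=a^{1/q}\tau^{-1}$) and valuation $\mathrm{ord}_{\tau^{-1}}$. A Drinfeld module is a ring homomorphism $\phi\colon A\to L[\tau]$ with image not in $L$; generic characteristic: $a\mapsto$(constant term of $\phi_a$) injective; rank $n$: $\deg_\tau\phi_a=-nd_\infty\mathrm{ord}_\infty(a)$. $\phi$ extends uniquely to $\phi\colon F_\infty\to L^{\mathrm{perf}}(\!(\tau^{-1})\!)$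 with $\mathrm{ord}_{\tau^{-1}}(\phi_x)=nd_\infty\mathrm{ord}_\infty(x)$. $D_\phi$ is the centralizer of $\phi(A)$ in $\bar L(\!(\tau^{-1})\!)$, an $F_\infty$-algebra via $\phi$. $\mathrm{End}_{L}(\phi)$ is the centralizer of $\phi(A)$ in $L[\tau]$; it lies in $D_\phi$. $\rho_\infty\colon W_L\to D_\phi^\times$ is $\sigma\mapsto\sigma(u)\tau^{\deg\sigma}u^{-1}$ for any $u\in\bar L(\!(\tau^{-1})\!)^\times$ with coefficients in $L^{\mathrm{sep}}$ and $u^{-1}\phi(A)u\subseteq\bar k(\!(\tau^{-1})\!)$ (a well-defined homomorphism independent of $u$). Finitely generated field = finitely generated over its prime field. *)

(* Defs.v *)
From HB Require Import structures.
From mathcomp Require Import all_boot all_order all_algebra all_field.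
From mathcomp Require Import mathcomp_extra boolp classical_sets functions.
From mathcomp Require Import cardinality fsbigop constructive_ereal.
From mathcomp Require Import zify.

Set Implicit Arguments.
Unset Strict Implicit.
Unset Printing Implicit Defensive.

Import Order.TTheory GRing.Theory Num.Theory.
Local Open Scope classical_set_scope.
Local Open Scope ring_scope.

(* x ^ (q ^ i) for q = #|k| and i : int; for i < 0 it is the unique q ^ -i-th   *)
(* root of x. The embedding kM ensures that x |-> x ^ q is a ring morphism.     *)
Definition frobz (k : finFieldType) (M : closedFieldType)
    (kM : {rmorphism k -> M}) (i : int) (x : M) : M :=
  match i with
  | Posz n => x ^+ (#|k| ^ n)
  | Negz n => xget 0 [set y | y ^+ (#|k| ^ n.+1) = x]
  end.

Section Frobenius.
Variables (k : finFieldType) (M : closedFieldType) (kM : {rmorphism k -> M}).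

Local Notation q := #|k|.
Local Notation frobz := (frobz kM).

Lemma pchar_nat_card (n : nat) : [pchar M].-nat (q ^ n)%N.
Proof.
have [p p_pr pk] := finPcharP k.
have pM : p \in [pchar M] by rewrite (fmorph_pchar kM).
rewrite pnatX; apply/orP; left.
rewrite (card_pprimeChar pk) (eq_pnat _ (pcharf_eq pM)) pnatX.
by rewrite pnat_id.
Qed.

Lemma qexp_gt0 (n : nat) : (0 < q ^ n)%N.
Proof. by have /andP[] := pchar_nat_card n. Qed.

Lemma qexpD (n : nat) (x y : M) :
  (x + y) ^+ (q ^ n) = x ^+ (q ^ n) + y ^+ (q ^ n).
Proof. exact/exprDn_pchar/pchar_nat_card. Qed.

Lemma qexpB (n : nat) (x y : M) :
  (x - y) ^+ (q ^ n) = x ^+ (q ^ n) - y ^+ (q ^ n).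
Proof. by apply/eqP; rewrite eq_sym subr_eq -qexpD subrK. Qed.

Lemma qexp_inj (n : nat) : injective (fun x : M => x ^+ (q ^ n)).
Proof.
move=> x y /= /eqP; rewrite -subr_eq0 -qexpB expf_eq0 qexp_gt0 /= subr_eq0.
by move/eqP.
Qed.

Lemma frobz_negK (n : nat) (x : M) : frobz (Negz n) x ^+ (q ^ n.+1) = x.
Proof.
rewrite /frobz; apply: (@xgetPex _ _ [set y | y ^+ (q ^ n.+1) = x]).
have [] := closed_rootP ('X^(q ^ n.+1) - x%:P) _.
  by rewrite size_XnsubC ?qexp_gt0 // eqSS -lt0n qexp_gt0.
by move=> y; rewrite rootE !hornerE subr_eq0 => /eqP; exists y.
Qed.

Lemma frobzE (a b : nat) (x y : M) :
  y ^+ (q ^ b) = x ^+ (q ^ a) -> y = frobz (a%:Z - b%:Z) x.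
Proof.
case e : (a%:Z - b%:Z) => [n|n] h; apply: (@qexp_inj b); rewrite /= h.
  by rewrite /= -exprM -expnD; congr (_ ^+ (_ ^ _)); lia.
have -> : b = (n.+1 + a)%N by lia.
by rewrite expnD exprM frobz_negK.
Qed.

Lemma frobzK (a b : nat) (x : M) :
  frobz (a%:Z - b%:Z) x ^+ (q ^ b) = x ^+ (q ^ a).
Proof.
case e : (a%:Z - b%:Z) => [n|n].
  by rewrite /= -exprM -expnD; congr (_ ^+ (_ ^ _)); lia.
have -> : b = (n.+1 + a)%N by lia.
by rewrite expnD exprM frobz_negK.
Qed.

Lemma int_nat2 (i : int) : exists a b : nat, i = a%:Z - b%:Z.
Proof.
case: i => n; first by exists n, 0%N; rewrite subr0.
by exists 0%N, n.+1; rewrite sub0r.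
Qed.

Lemma frobz0 (x : M) : frobz 0 x = x.
Proof. by rewrite /= expn0 expr1. Qed.

Lemma frobzD (i j : int) (x : M) : frobz (i + j) x = frobz i (frobz j x).
Proof.
have [a [b ->]] := int_nat2 i; have [c [d ->]] := int_nat2 j.
have -> : a%:Z - b%:Z + (c%:Z - d%:Z) = (a + c)%N%:Z - (b + d)%N%:Z by lia.
symmetry; apply: frobzE.
rewrite expnD exprM frobzK -exprM mulnC exprM frobzK -exprM mulnC.
by rewrite -expnD.
Qed.

Lemma frobz_is_zmod_morphism (i : int) : zmod_morphism (frobz i).
Proof.
move=> x y; have [a [b ->]] := int_nat2 i.
by symmetry; apply: frobzE; rewrite !qexpB !frobzK.
Qed.

Lemma frobz_is_monoid_morphism (i : int) : monoid_morphism (frobz i).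
Proof.
have [a [b ->]] := int_nat2 i; split=> [|x y].
  by symmetry; apply: frobzE; rewrite !expr1n.
by symmetry; apply: frobzE; rewrite !exprMn !frobzK.
Qed.

HB.instance Definition _ (i : int) :=
  GRing.isZmodMorphism.Build M M (frobz i) (frobz_is_zmod_morphism i).
HB.instance Definition _ (i : int) :=
  GRing.isMonoidMorphism.Build M M (frobz i) (frobz_is_monoid_morphism i).

End Frobenius.

(* The twisted Laurent series sum_i f_i tau^i with f_i = 0 for i large, tau a = *)
(* a ^ q tau, q = #|k|. The field of coefficients is restricted to the          *)
(* algebraically closed case: smaller perfect fields give subrings.             *)
Record laurent (k : finFieldType) (M : closedFieldType)
    (kM : {rmorphism k -> M}) := Laurent {
  lcoef :> int -> M;
  lcoefP : exists N : int, forall i, N < i -> lcoef i = 0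
}.

Section LaurentRing.
Variables (k : finFieldType) (M : closedFieldType) (kM : {rmorphism k -> M}).

Local Notation lau := (laurent kM).
Local Notation Fr := (frobz kM).

Lemma lauP (f g : lau) : (forall i, f i = g i) -> f = g.
Proof.
case: f g => [f hf] [g hg] /= /funext e; move: hf hg; rewrite e => hf hg.
by congr Laurent; exact: Prop_irrelevance.
Qed.

HB.instance Definition _ := gen_eqMixin lau.
HB.instance Definition _ := gen_choiceMixin lau.

Fact lau_monomial_subproof (c : M) (n : int) :
  exists N : int, forall i, N < i -> (if i == n then c else 0) = 0.
Proof. by exists n => i ni; case: eqP => // ein; move: ni; rewrite ein ltxx. Qed.
(* c tau^n *)
Definition lmonomial (c : M) (n : int) : lau :=
  Laurent kM (lau_monomial_subproof c n).

Fact lau_zero_subproof : exists N : int, forall i, N < i -> (0 : M) = 0.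
Proof. by exists 0. Qed.
Definition lau_zero : lau := Laurent kM lau_zero_subproof.

Fact lau_opp_subproof (f : lau) :
  exists N : int, forall i, N < i -> - f i = 0.
Proof. by have [N h] := lcoefP f; exists N => i /h ->; rewrite oppr0. Qed.
Definition lau_opp (f : lau) : lau := Laurent kM (lau_opp_subproof f).

Lemma lau_bound2 (f g : lau) :
  exists N : nat, forall i : int, N%:Z < i -> f i = 0 /\ g i = 0.
Proof.
have [N h] := lcoefP f; have [N' h'] := lcoefP g.
by exists (`|N| + `|N'|)%N => i hi; split; [apply: h|apply: h']; lia.
Qed.

Fact lau_add_subproof (f g : lau) :
  exists N : int, forall i, N < i -> f i + g i = 0.
Proof.
by have [N h] := lau_bound2 f g; exists N%:Z => i /h[-> ->]; rewrite addr0.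
Qed.
Definition lau_add (f g : lau) : lau := Laurent kM (lau_add_subproof f g).

Fact lau_addA : associative lau_add.
Proof. by move=> f g h; apply: lauP => i; rewrite /= addrA. Qed.
Fact lau_addC : commutative lau_add.
Proof. by move=> f g; apply: lauP => i; rewrite /= addrC. Qed.
Fact lau_add0 : left_id lau_zero lau_add.
Proof. by move=> f; apply: lauP => i; rewrite /= add0r. Qed.
Fact lau_addN : left_inverse lau_zero lau_opp lau_add.
Proof. by move=> f; apply: lauP => i; rewrite /= addNr. Qed.

HB.instance Definition _ :=
  GRing.isZmodule.Build lau lau_addA lau_addC lau_add0 lau_addN.

Definition lau_mul_coef (f g : lau) (n : int) : M :=
  \sum_(i \in [set: int]) f i * Fr i (g (n - i)).

Definition zseg (K : nat) : seq int := [seq i%:Z - K%:Z | i <- iota 0 (K + K).+1].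

Lemma zseg_uniq (K : nat) : uniq (zseg K).
Proof. by rewrite map_inj_uniq ?iota_uniq // => i j /= ?; lia. Qed.

Lemma mem_zseg (K : nat) (i : int) : (`|i| <= K)%N -> i \in zseg K.
Proof.
move=> h; apply/mapP; exists `|(i + K%:Z)%R|%N; last by lia.
by rewrite mem_iota; lia.
Qed.

Lemma zsumE (K : nat) (G : int -> M) :
  (forall i : int, G i != 0 -> (`|i| <= K)%N) ->
  \sum_(i \in [set: int]) G i = \sum_(i <- zseg K) G i.
Proof.
move=> h; rewrite (fsbigE (zseg K)) ?zseg_uniq //.
  by apply: eq_bigl => i; rewrite in_setT.
move=> i _; apply: contraNeq => /h; exact: mem_zseg.
Qed.

Lemma lmul_neq0 (f g : lau) (n i : int) :
  f i * Fr i (g (n - i)) != 0 -> f i != 0 /\ g (n - i) != 0.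
Proof.
by move=> h; split; apply: contraNneq h => ->; rewrite ?mul0r ?rmorph0 ?mulr0.
Qed.

Lemma lau_boundP (f : lau) : exists N : nat, forall i : int, f i != 0 -> i <= N%:Z.
Proof.
have [N h] := lau_bound2 f f; exists N => i; apply: contraR.
by rewrite -ltNge => /h[-> _].
Qed.

Lemma lau_mul_coefE (Nf Ng : nat) (f g : lau) (n : int) (K : nat) :
  (forall i : int, f i != 0 -> i <= Nf%:Z) ->
  (forall i : int, g i != 0 -> i <= Ng%:Z) ->
  (`|n| + Nf + Ng <= K)%N ->
  lau_mul_coef f g n = \sum_(i <- zseg K) f i * Fr i (g (n - i)).
Proof.
move=> hf hg hK; apply: zsumE => i /lmul_neq0[/hf h1 /hg h2]; lia.
Qed.

Lemma lau_mul_coef_bound (Nf Ng : nat) (f g : lau) (n : int) :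
  (forall i : int, f i != 0 -> i <= Nf%:Z) ->
  (forall i : int, g i != 0 -> i <= Ng%:Z) ->
  (Nf + Ng)%N%:Z < n -> lau_mul_coef f g n = 0.
Proof.
move=> hf hg hn; apply: fsbig1 => i _; apply/eqP; apply: contraTT hn.
by move=> /lmul_neq0[/hf h1 /hg h2]; lia.
Qed.

Fact lau_mul_subproof (f g : lau) :
  exists N : int, forall n, N < n -> lau_mul_coef f g n = 0.
Proof.
have [Nf hf] := lau_boundP f; have [Ng hg] := lau_boundP g.
exists (Nf + Ng)%N%:Z => n; exact: lau_mul_coef_bound.
Qed.
Definition lau_mul (f g : lau) : lau := Laurent kM (lau_mul_subproof f g).

Lemma lau_mul_boundP (Nf Ng : nat) (f g : lau) :
  (forall i : int, f i != 0 -> i <= Nf%:Z) ->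
  (forall i : int, g i != 0 -> i <= Ng%:Z) ->
  forall i : int, lau_mul f g i != 0 -> i <= (Nf + Ng)%N%:Z.
Proof.
move=> hf hg i; apply: contraR; rewrite -ltNge => h.
by apply/eqP; apply: (lau_mul_coef_bound hf hg).
Qed.

Fact lau_mulA : associative lau_mul.
Proof.
move=> f g h; apply: lauP => n.
have [Nf hf] := lau_boundP f; have [Ng hg] := lau_boundP g.
have [Nh hh] := lau_boundP h.
have hfg := lau_mul_boundP hf hg; have hgh := lau_mul_boundP hg hh.
pose K := (`|n| + Nf + Ng + Nh)%N.
change (lau_mul_coef f (lau_mul g h) n = lau_mul_coef (lau_mul f g) h n).
rewrite (@lau_mul_coefE _ _ f (lau_mul g h) n K hf hgh); last by rewrite /K; lia.
rewrite (@lau_mul_coefE _ _ (lau_mul f g) h n K hfg hh); last by rewrite /K; lia.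
transitivity (\sum_(i <- zseg K) \sum_(j <- zseg K)
    f j * Fr j (g (i - j)) * Fr i (h (n - i))); last first.
  rewrite !big_seq; apply: eq_bigr => i _.
  have [->|hi] := eqVneq (h (n - i)) 0.
    by rewrite rmorph0 mulr0 big1 // => j _; rewrite ?rmorph0 mulr0.
  have := hh _ hi => hi'.
  have [le|gt] := leP i (Nf + Ng)%N%:Z; last first.
    rewrite [lau_mul f g i](lau_mul_coef_bound hf hg gt) mul0r big1 // => j _.
    have [->|/lmul_neq0[/hf a /hg b]] := eqVneq (f j * Fr j (g (i - j))) 0.
      by rewrite mul0r.
    lia.
  rewrite -mulr_suml; congr (_ * _).
  symmetry; apply: zsumE => j /lmul_neq0[/hf a /hg b]; rewrite /K; lia.
rewrite exchange_big /=; apply: eq_bigr => j _.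
have [->|hj] := eqVneq (f j) 0.
  by rewrite mul0r big1 // => i _; rewrite !mul0r.
have := hf _ hj => hj'.
under eq_bigr do rewrite -mulrA.
rewrite -mulr_sumr; congr (_ * _).
transitivity (\sum_(i \in [set: int]) Fr j (g (i - j) * Fr (i - j) (h (n - i)))).
  rewrite (reindex_fsbigT (fun l : int => l + j)); last first.
    by exists (fun l : int => l - j) => l; rewrite ?addrK ?subrK.
  have [Kj hKj] : exists Kj : nat, (`|n| + `|j| + Ng + Nh <= Kj)%N by eexists.
  have e1 : lau_mul_coef g h (n - j) =
      \sum_(l <- zseg Kj) g l * Fr l (h (n - j - l)).
    by apply: (lau_mul_coefE hg hh); lia.
  rewrite e1 raddf_sum /= (@zsumE Kj).
    by apply: eq_bigr => l _; rewrite !addrK opprD addrA addrAC.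
  move=> l; rewrite addrK opprD addrA addrAC => nz.
  have nz' : g l * Fr l (h (n - j - l)) != 0.
    by apply: contraNneq nz => ->; rewrite rmorph0.
  have [/hg a /hh b] := lmul_neq0 nz'; lia.
rewrite (@zsumE K); last first.
  move=> i nz.
  have {}nz : g (i - j) * Fr (i - j) (h (n - i)) != 0.
    by apply: contraNneq nz => ->; rewrite rmorph0.
  have a : g (i - j) != 0 by apply: contraNneq nz => ->; rewrite mul0r.
  have b : h (n - i) != 0 by apply: contraNneq nz => ->; rewrite rmorph0 mulr0.
  have := hg _ a; have := hh _ b; rewrite /K; lia.
by apply: eq_bigr => i _; rewrite rmorphM /= -frobzD [j + _]addrC subrK.
Qed.

Fact lau_mul1 : left_id (lmonomial 1 0) lau_mul.
Proof.
move=> f; apply: lauP => n; rewrite /= /lau_mul_coef.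
rewrite (fsbigE [:: 0]) //=; last first.
  by move=> i _; rewrite inE => /negbTE ->; rewrite mul0r.
by rewrite big_cons in_setT big_nil addr0 eqxx mul1r subr0 frobz0.
Qed.

Fact lau_mulr1 : right_id (lmonomial 1 0) lau_mul.
Proof.
move=> f; apply: lauP => n; rewrite /= /lau_mul_coef.
rewrite (fsbigE [:: n]) //=; last first.
  move=> i _; rewrite inE subr_eq0 eq_sym => /negbTE ->.
  by rewrite rmorph0 mulr0.
by rewrite big_cons in_setT big_nil addr0 subrr eqxx rmorph1 mulr1.
Qed.

Fact lau_mulDl : left_distributive lau_mul +%R.
Proof.
move=> f g h; apply: lauP => n.
have [Nf hf] := lau_boundP f; have [Ng hg] := lau_boundP g.
have [Nh hh] := lau_boundP h; have [Ns hs] := lau_boundP (f + g).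
pose K := (`|n| + Nf + Ng + Nh + Ns)%N.
change (lau_mul_coef (f + g) h n = lau_mul_coef f h n + lau_mul_coef g h n).
rewrite (lau_mul_coefE (K := K) hs hh); last by rewrite /K; lia.
rewrite (lau_mul_coefE (K := K) hf hh); last by rewrite /K; lia.
rewrite (lau_mul_coefE (K := K) hg hh); last by rewrite /K; lia.
by rewrite -big_split /=; apply: eq_bigr => i _; rewrite -mulrDl.
Qed.

Fact lau_mulDr : right_distributive lau_mul +%R.
Proof.
move=> f g h; apply: lauP => n.
have [Nf hf] := lau_boundP f; have [Ng hg] := lau_boundP g.
have [Nh hh] := lau_boundP h; have [Ns hs] := lau_boundP (g + h).
pose K := (`|n| + Nf + Ng + Nh + Ns)%N.
change (lau_mul_coef f (g + h) n = lau_mul_coef f g n + lau_mul_coef f h n).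
rewrite (lau_mul_coefE (K := K) hf hs); last by rewrite /K; lia.
rewrite (lau_mul_coefE (K := K) hf hg); last by rewrite /K; lia.
rewrite (lau_mul_coefE (K := K) hf hh); last by rewrite /K; lia.
by rewrite -big_split /=; apply: eq_bigr => i _; rewrite -mulrDr -rmorphD.
Qed.

Fact lau_1neq0 : lmonomial 1 0 != 0 :> lau.
Proof.
apply/eqP => /(congr1 (fun f : lau => f 0)) /= /eqP.
by rewrite oner_eq0.
Qed.

HB.instance Definition _ := GRing.Zmodule_isNzRing.Build lau
  lau_mulA lau_mul1 lau_mulr1 lau_mulDl lau_mulDr lau_1neq0.

Definition lau_unit : pred lau :=
  fun f => `[< exists g : lau, g * f = 1 /\ f * g = 1 >].
Definition lau_inv (f : lau) : lau :=
  xget f [set g : lau | g * f = 1 /\ f * g = 1].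

Fact lau_mulVf : {in lau_unit, left_inverse 1 lau_inv *%R}.
Proof.
move=> f /asboolP ex.
by case: (xgetPex f (P := [set g : lau | g * f = 1 /\ f * g = 1]) ex).
Qed.
Fact lau_divff : {in lau_unit, right_inverse 1 lau_inv *%R}.
Proof.
move=> f /asboolP ex.
by case: (xgetPex f (P := [set g : lau | g * f = 1 /\ f * g = 1]) ex).
Qed.
Fact lau_unitP (f g : lau) : g * f = 1 /\ f * g = 1 -> lau_unit f.
Proof. by move=> ?; apply/asboolP; exists g. Qed.
Fact lau_inv_out : {in [predC lau_unit], lau_inv =1 id}.
Proof.
move=> f; rewrite !inE => /asboolP nex; apply: xgetPN => g hg.
by apply: nex; exists g.
Qed.

HB.instance Definition _ := GRing.NzRing_hasMulInverse.Build lau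
  lau_mulVf lau_divff lau_unitP lau_inv_out.

Definition tau : lau := lmonomial 1 1.

Lemma lmonomialM (a b : M) (i j : int) :
  lmonomial a i * lmonomial b j = lmonomial (a * Fr i b) (i + j).
Proof.
apply: lauP => n.
change (lau_mul_coef (lmonomial a i) (lmonomial b j) n =
  if n == i + j then a * Fr i b else 0).
rewrite /lau_mul_coef (fsbigE [:: i]) //=; last first.
  by move=> l _; rewrite inE => /negbTE ->; rewrite mul0r.
rewrite big_cons in_setT big_nil addr0 eqxx subr_eq [j + i]addrC.
by case: ifP => _ //; rewrite rmorph0 mulr0.
Qed.

Lemma tau_unit : tau \is a GRing.unit.
Proof.
apply/unitrP; exists (lmonomial 1 (-1)).
by rewrite !lmonomialM !rmorph1 mulr1 addNr subrr.
Qed.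

(* junk value 0 when f = 0 *)
Definition ldeg (f : lau) : int :=
  xget 0 [set d | f d != 0 /\ forall i, d < i -> f i = 0].

Definition ord_tauV (f : lau) : \bar int :=
  if f == 0 then +oo%E else (- ldeg f)%:E.

Fact lmap_subproof (s : {rmorphism M -> M}) (f : lau) :
  exists N : int, forall i, N < i -> s (f i) = 0.
Proof. by have [N h] := lcoefP f; exists N => i /h ->; rewrite rmorph0. Qed.
Definition lmap (s : {rmorphism M -> M}) (f : lau) : lau :=
  Laurent kM (lmap_subproof s f).

End LaurentRing.

Section Valuations.
Variable K : fieldType.

(* Normalized (i.e. surjective onto Z) discrete valuations. *)
Definition discrete_valuation (v : K -> \bar int) : Prop :=
  [/\ forall x, v x = +oo%E <-> x = 0,
      forall x y, v (x * y) = (v x + v y)%E,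
      forall x y, (Order.min (v x) (v y) <= v (x + y)%R)%E
    & exists x, v x = 1%:E].

Definition val_cvg (v : K -> \bar int) (u : nat -> K) (l : K) : Prop :=
  forall N : int, exists n0, forall n, (n0 <= n)%N -> (N%:E <= v (u n - l)%R)%E.

Definition val_cauchy (v : K -> \bar int) (u : nat -> K) : Prop :=
  forall N : int, exists n0, forall m n,
    (n0 <= m)%N -> (n0 <= n)%N -> (N%:E <= v (u m - u n)%R)%E.

Lemma dval1 (v : K -> \bar int) : discrete_valuation v -> v 1 = 0%E.
Proof.
case=> _ vM _ [x vx]; have := vM x 1; rewrite mulr1 vx.
case: (v 1) => [r||] //= [] e; congr EFin; lia.
Qed.

Lemma dvalN (v : K -> \bar int) x : discrete_valuation v -> v (- x) = v x.
Proof.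
move=> hv; have v1 := dval1 hv; case: (hv) => _ vM _ _.
have := vM (-1) (-1); rewrite mulrNN mulr1 v1 -(mulN1r x) vM.
case: (v (-1)) => [r||] //= [] e.
have -> : r = 0 by lia.
by rewrite add0e.
Qed.

End Valuations.

(* A place is a normalized discrete valuation, so distinct places are distinct  *)
(* functions; triviality on the finite constant field is automatic.             *)
Definition regular_away (F : fieldType) (ord : F -> \bar int) : {pred F} :=
  fun x => `[< forall v, discrete_valuation v -> v <> ord -> (0 <= v x)%E >].

Section RegularAway.
Variables (F : fieldType) (ord : F -> \bar int).

Fact regular_away_subring : subring_closed (regular_away ord).
Proof.
split.
- by apply/asboolP => v hv _; rewrite (dval1 hv).
- move=> x y /asboolP hx /asboolP hy; apply/asboolP => v hv nv.
  case: (hv) => _ _ vD _; apply: le_trans (vD x (- y)).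
  by rewrite le_min (dvalN _ hv) (hx v hv nv) (hy v hv nv).
- move=> x y /asboolP hx /asboolP hy; apply/asboolP => v hv nv.
  by case: (hv) => _ vM _ _; rewrite vM adde_ge0 ?(hx v hv nv) ?(hy v hv nv).
Qed.

HB.instance Definition _ :=
  GRing.isSubringClosed.Build F (regular_away ord) regular_away_subring.

Record ringA := RingA { ringA_val :> F; _ : ringA_val \in regular_away ord }.

HB.instance Definition _ := [isSub for ringA_val].
HB.instance Definition _ := [Choice of ringA by <:].
HB.instance Definition _ := [SubChoice_isSubComNzRing of ringA by <:].

End RegularAway.

Section FunctionField.
Variables (k : finFieldType).

Definition in_rational_subfield (F : fieldType) (kF : {rmorphism k -> F})
    (t x : F) : Prop :=
  exists p r : {poly k},
    (map_poly kF r).[t] != 0 /\ x = (map_poly kF p).[t] / (map_poly kF r).[t].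

(* F is finite over k(t) for some t transcendental over k, and k is             *)
(* algebraically closed in F.                                                   *)
Definition global_function_field (F : fieldType) (kF : {rmorphism k -> F}) : Prop :=
  (exists2 t : F, ~ algebraicOver kF t &
     exists (m : nat) (b : 'I_m -> F), forall x : F, exists c : 'I_m -> F,
       (forall i, in_rational_subfield kF t (c i)) /\ x = \sum_i c i * b i)
  /\ (forall x : F, algebraicOver kF x -> exists c : k, x = kF c).

Definition is_completion (F : fieldType) (ord : F -> \bar int)
    (E : fieldType) (FE : {rmorphism F -> E}) (ordE : E -> \bar int) : Prop :=
  [/\ discrete_valuation ordE,
      forall x, ordE (FE x) = ord x,
      forall y (N : int), exists x, (N%:E <= ordE (y - FE x)%R)%E
    & forall u, val_cauchy ordE u -> exists l, val_cvg ordE u l].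

(* b induces a k-basis of the residue field of the valuation v. *)
Definition residue_basis (K : fieldType) (kK : {rmorphism k -> K})
    (v : K -> \bar int) (d : nat) (b : 'I_d -> K) : Prop :=
  (forall i, 0 <= v (b i))%E /\
  forall x, (0 <= v x)%E ->
    exists! c : {ffun 'I_d -> k}, (0 < v (x - \sum_i kK (c i) * b i)%R)%E.

Definition residue_degree (K : fieldType) (kK : {rmorphism k -> K})
    (v : K -> \bar int) : nat :=
  xget 0%N [set d | exists b : 'I_d -> K, residue_basis kK v b].

End FunctionField.

(* The smallest subfield containing some finite sequence is everything. *)
Definition finitely_generated_field (L : fieldType) : Prop :=
  exists s : seq L, forall S : {pred L},
    divring_closed S -> {subset s <= S} -> forall x, x \in S.

Definition is_algebraic_closure (L : fieldType) (M : closedFieldType)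
  (LM : {rmorphism L -> M}) : Prop := forall x : M, algebraicOver LM x.

Section Subfields.
Variables (L : fieldType) (M : closedFieldType) (LM : {rmorphism L -> M}).

Definition in_sep (x : M) : Prop :=
  exists2 p : {poly L}, separable_poly p & root (map_poly LM p) x.

Definition in_perf (x : M) : Prop :=
  exists p m : nat, p \in [pchar L] /\ exists y : L, x ^+ (p ^ m) = LM y.

(* Restriction to the separable closure identifies Aut(M / L) with Gal_L when M *)
(* is an algebraic closure of L.                                                *)
Definition Gal : set {rmorphism M -> M} :=
  [set s : {rmorphism M -> M} | bijective s /\ forall x, s (LM x) = LM x].

End Subfields.

Section DrinfeldModule.
Variables (k : finFieldType).
Variables (F : fieldType) (kF : {rmorphism k -> F}) (ord : F -> \bar int).
Variables (Finf : fieldType) (FFinf : {rmorphism F -> Finf}).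
Variable (ordinf : Finf -> \bar int).
Variables (L : fieldType) (kL : {rmorphism k -> L}).
Variables (Lbar : closedFieldType) (LLbar : {rmorphism L -> Lbar}).

Local Notation kLbar := (LLbar \o kL : {rmorphism k -> Lbar}).
Local Notation A := (ringA ord).
Local Notation lau := (laurent kLbar).

Definition in_kbar (x : Lbar) : Prop := algebraicOver kLbar x.

Definition acts_with_degree (s : {rmorphism Lbar -> Lbar}) (d : int) : Prop :=
  forall x, in_kbar x -> s x = frobz kLbar d x.

Definition Weil : set {rmorphism Lbar -> Lbar} :=
  [set s : {rmorphism Lbar -> Lbar} | Gal LLbar s /\ exists d, acts_with_degree s d].

Definition Weil_deg (s : {rmorphism Lbar -> Lbar}) : int :=
  xget 0 [set d | acts_with_degree s d].

(* L[tau], as a subring of Lbar((tau^-1)) *)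
Definition twisted_poly : set lau :=
  [set f | (forall i : int, i < 0 -> f i = 0) /\
           (forall i : int, exists c : L, f i = LLbar c)].

Definition drinfeld_module (phi : {rmorphism A -> lau}) : Prop :=
  (forall a, twisted_poly (phi a)) /\
  ~ (forall a, exists c : L, phi a = lmonomial kLbar (LLbar c) 0).

Definition generic_characteristic (phi : {rmorphism A -> lau}) : Prop :=
  injective (fun a : A => phi a 0).

Variable phi : {rmorphism A -> lau}.

Definition d_inf : nat := residue_degree (FFinf \o kF : {rmorphism k -> Finf}) ordinf.

Definition has_rank (n : nat) : Prop :=
  forall a : A, a != 0 ->
    (ldeg (phi a))%:E = (- ((n%:Z * d_inf%:Z)%R%:E * ord a))%E.

Definition rank : nat := xget 0%N [set n | has_rank n].

(* The codomain is L^perf((tau^-1)); such an extension exists and is unique. *)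
Definition is_extension (Phi : Finf -> lau) : Prop :=
  [/\ zmod_morphism Phi, monoid_morphism Phi,
      forall x i, in_perf LLbar (Phi x i),
      forall a : A, Phi (FFinf (ringA_val a)) = phi a
    & forall x, ord_tauV (Phi x) = ((rank%:Z * d_inf%:Z)%R%:E * ordinf x)%E].

Definition phi_inf (x : Finf) : lau :=
  xget 0 [set y | exists2 Phi, is_extension Phi & y = Phi x].

Definition D_phi : set lau := [set f | forall a, f * phi a = phi a * f].

Definition End_phi : set lau := twisted_poly `&` D_phi.

(* The image of End_phi (x)_A F_inf -> D_phi, e (x) x |-> e phi_x. *)
Definition End_phi_tensor_image : set lau :=
  [set f | exists (m : nat) (e : 'I_m -> lau) (x : 'I_m -> Finf),
     (forall i, End_phi (e i)) /\ f = \sum_i e i * phi_inf (x i)].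

Definition rho_admissible (u : lau) : Prop :=
  [/\ u \is a GRing.unit, forall i, in_sep LLbar (u i)
    & forall a i, in_kbar ((u^-1 * phi a * u) i)].

(* Independent of the choice of u. *)
Definition rho_inf (s : {rmorphism Lbar -> Lbar}) : lau :=
  let u := xget 1 rho_admissible in lmap s u * tau kLbar ^ Weil_deg s * u^-1.

Definition centralizer_in (D S : set lau) : set lau :=
  [set f | D f /\ forall g, S g -> f * g = g * f].

End DrinfeldModule.

(* Main.v *)
(** An element B of D_phi commutes with rho(sigma) if and only if sigma fixes the
    coefficients of B: u^-1 B u has coefficients in kbar, where sigma acts as
    conjugation by a power of tau.  By Galois theory the centralizer of rho(W_L) thus
    consists of the elements of D_phi with coefficients in L^perf, and it remains to
    approximate such an f by elements of End_L(phi) (x) F_inf.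

    Fix a non-constant t in A and write theta for the constant term of phi_t.
    Comparing the polynomial parts of f phi_t^i and of their commutators with phi_t
    gives a family of elements of L satisfying a triangular system of equations
    z'^q - T z^q = (combination of later terms), where theta = T^(q^m) and T is not a
    q-th power; such T exists since theta is transcendental over k and L is finitely
    generated.  A Cartier operator psi with psi(1) = 1 and psi(T) = 0 removes the
    q-th power and roughly halves degrees and pole orders with respect to a fixed set
    of generators of L, so all these elements lie in one finite set.  By the
    pigeonhole principle f (phi_t^j - phi_t^i) is arbitrarily close to an element of
    L[tau] commuting with phi_t for some i < j; closeness to D_phi forces it to
    commute with phi(A).  Hence End_L(phi) phi(F_inf) is dense in the centralizer.
    Finitely many of its elements represent the centralizer modulo large negative
    degrees, and expanding f in powers of phi_t^-1 with these digits, whose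
    coefficients converge in F_inf, gives equality. *)

From HB Require Import structures.
From mathcomp Require Import all_boot all_order all_algebra all_field.
From mathcomp Require Import boolp classical_sets fsbigop constructive_ereal.
From mathcomp Require Import cyclic zify ring.
Require Import Defs.

Set Implicit Arguments.
Unset Strict Implicit.
Unset Printing Implicit Defensive.

Import Order.TTheory GRing.Theory Num.Theory.
Local Open Scope classical_set_scope.
Local Open Scope ring_scope.

(** * Twisted Laurent series *)

(** The delicate point is the coefficient T of the system. Let t act by right multiplication by
    phi_t. Working with tau f directly would give equations z'^q - theta z^q, and no Cartier
    operator with psi(1) = 1 kills theta when theta is a nonzero q-th power. So f is first
    multiplied by W = (t - T)(t - T^q)...(t - T^(q^(m-1))): since tau (t - a) = (t - a^q) tau, one
    has (t - T) tau W f = (t - theta) W tau f, and T takes the place of theta in front of the q-th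
    power. The price is a division by W at the end, possible over L because T^(q^j) - theta is
    nonzero for j < m, theta not being periodic under Frobenius.

    The system has its unknowns in L, although f only has coefficients in L^perf, because the
    coefficients of nonnegative degree of an f commuting with phi_t lie in L.

    A single integer N bounds both the power of a fixed denominator and, up to a fixed factor, the
    degree of the numerator; sets bounded in this way are finite since k is. Elements of the Weil
    group are produced by extending the graph of a partial isomorphism inside Lbar x Lbar. *)

Section LaurentTheory.
Variables (k : finFieldType) (M : closedFieldType) (kM : {rmorphism k -> M}).

Local Notation lau := (laurent kM).
Local Notation Fr := (frobz kM).
Local Notation q := #|k|.

Lemma lcoefD (f g : lau) i : (f + g) i = f i + g i. Proof. by []. Qed.
Lemma lcoefN (f : lau) i : (- f) i = - f i. Proof. by []. Qed.
Lemma lcoefB (f g : lau) i : (f - g) i = f i - g i. Proof. by []. Qed.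
Lemma lcoef0 i : (0 : lau) i = 0. Proof. by []. Qed.
Lemma lcoef1 i : (1 : lau) i = if i == 0 then 1 else 0. Proof. by []. Qed.
Lemma lcoef_sum I (r : seq I) (P : pred I) (F : I -> lau) i :
  (\sum_(x <- r | P x) F x) i = \sum_(x <- r | P x) F x i.
Proof. by apply: (big_morph (fun f : lau => f i)). Qed.

Lemma lcoefM (f g : lau) n :
  (f * g) n = \sum_(i \in [set: int]) f i * Fr i (g (n - i)).
Proof. by []. Qed.

Lemma zsum1 (G : int -> M) (n : int) : (forall i, i != n -> G i = 0) ->
  \sum_(i \in [set: int]) G i = G n.
Proof.
move=> h; rewrite (fsbigE [:: n]) //=; last by move=> i _; rewrite inE => /h.
by rewrite big_cons in_setT big_nil addr0.
Qed.

(** Unlike [ldeg], which has a junk value at 0, this also measures closeness: [ldle (f - g) (- K)]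
    says that f and g agree in all degrees above -K. *)
Definition ldle (f : lau) (N : int) := forall i : int, N < i -> f i = 0.

Lemma ldle_ex (f : lau) : exists N, ldle f N.
Proof. exact: lcoefP. Qed.

Lemma ldle_trans (f : lau) a b : ldle f a -> a <= b -> ldle f b.
Proof. by move=> h ab i bi; apply: h; apply: le_lt_trans bi. Qed.

Lemma ldle0 a : ldle 0 a. Proof. by []. Qed.

Lemma ldleD (f g : lau) a : ldle f a -> ldle g a -> ldle (f + g) a.
Proof. by move=> hf hg i ai; rewrite lcoefD hf ?hg ?addr0. Qed.

Lemma ldleN (f : lau) a : ldle f a -> ldle (- f) a.
Proof. by move=> hf i ai; rewrite lcoefN hf ?oppr0. Qed.

Lemma ldleB (f g : lau) a : ldle f a -> ldle g a -> ldle (f - g) a.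
Proof. by move=> hf hg; apply/ldleD/ldleN. Qed.

Lemma ldle_sum I (r : seq I) (P : pred I) (F : I -> lau) a :
  (forall x, P x -> ldle (F x) a) -> ldle (\sum_(x <- r | P x) F x) a.
Proof. by move=> h i ai; rewrite lcoef_sum big1 // => x /h; apply. Qed.

Lemma ldleM (f g : lau) a b : ldle f a -> ldle g b -> ldle (f * g) (a + b).
Proof.
move=> hf hg n hn; rewrite lcoefM; apply: fsbig1 => i _.
have [ai|ia] := ltP a i; first by rewrite hf ?mul0r.
by rewrite hg ?rmorph0 ?mulr0 //; lia.
Qed.

Lemma lcoefM_top (f g : lau) a b : ldle f a -> ldle g b ->
  (f * g) (a + b) = f a * Fr a (g b).
Proof.
move=> hf hg; rewrite lcoefM (@zsum1 _ a).
  by congr (_ * Fr _ (g _)); lia.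
move=> i ia; have [ai|] := ltP a i; first by rewrite hf ?mul0r.
by move=> ?; rewrite hg ?rmorph0 ?mulr0 //; lia.
Qed.

Lemma lcoefM_monl c n (f : lau) i :
  (lmonomial kM c n * f) i = c * Fr n (f (i - n)).
Proof.
rewrite lcoefM (@zsum1 _ n) /= ?eqxx // => j jn.
by rewrite (negbTE jn) mul0r.
Qed.

Lemma lcoefM_monr c n (f : lau) i :
  (f * lmonomial kM c n) i = f (i - n) * Fr (i - n) c.
Proof.
rewrite lcoefM (@zsum1 _ (i - n)) /=.
  by have -> : i - (i - n) = n; [lia | rewrite eqxx].
move=> j jn; have -> : (i - j == n) = false by apply/eqP; lia.
by rewrite rmorph0 mulr0.
Qed.

Lemma ldle_mon c n a : n <= a -> ldle (lmonomial kM c n) a.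
Proof. by move=> na i ai /=; case: eqP => // ein; lia. Qed.

Definition lpoly (f : lau) (N : nat) := forall i : int, i < 0 \/ N%:Z < i -> f i = 0.

Lemma lpoly_ldle f N : lpoly f N -> ldle f N%:Z.
Proof. by move=> h i hi; apply: h; right. Qed.

Lemma zsum_poly (G : int -> M) N : (forall i : int, i < 0 \/ N%:Z < i -> G i = 0) ->
  \sum_(i \in [set: int]) G i = \sum_(m < N.+1) G m%:Z.
Proof.
move=> h; rewrite (fsbigE [seq m%:Z | m <- iota 0 N.+1]).
- rewrite (eq_bigl xpredT); last by move=> i; rewrite in_setT.
  by rewrite big_map -(big_mkord xpredT (fun m : nat => G m%:Z)) /index_iota subn0.
- by rewrite map_inj_uniq ?iota_uniq // => a b [].
- by [].
- move=> i _ /mapP ni; apply: h; have [|i0] := ltP i 0; first by left.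
  right; rewrite ltNge; apply/negP => iN; apply: ni.
  by exists `|i|%N; rewrite ?mem_iota; lia.
Qed.

Lemma lcoefM_polyl (f g : lau) N n : lpoly f N ->
  (f * g) n = \sum_(m < N.+1) f m%:Z * g (n - m%:Z) ^+ (q ^ m).
Proof. by move=> h; rewrite lcoefM (@zsum_poly _ N) // => i /h ->; rewrite mul0r. Qed.

Lemma lcoefM_polyr (f g : lau) N n : lpoly g N ->
  (f * g) n = \sum_(m < N.+1) f (n - m%:Z) * Fr (n - m%:Z) (g m%:Z).
Proof.
move=> h; rewrite lcoefM (reindex_fsbigT (fun i : int => n - i)); last first.
  by exists (fun i : int => n - i) => i; lia.
rewrite (@zsum_poly _ N) => [|i /h e].
  by apply: eq_bigr => m _; congr (_ * Fr _ (g _)); lia.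
by have -> : n - (n - i) = i; [lia | rewrite e rmorph0 mulr0].
Qed.

Fact ltrunc_subproof (a : int) (f : lau) :
  exists N : int, forall i, N < i -> (if a < i then f i else 0) = 0.
Proof. by have [N h] := lcoefP f; exists N => i /h ->; case: ifP. Qed.
(** The inequality is strict, so [ltrunc (-1)] is the polynomial part. *)
Definition ltrunc a f : lau := Laurent kM (ltrunc_subproof a f).

Lemma ltruncE a f i : ltrunc a f i = if a < i then f i else 0.
Proof. by []. Qed.

Lemma ltrunc_rest a f : ldle (f - ltrunc a f) a.
Proof. by move=> i ai; rewrite lcoefB ltruncE ai subrr. Qed.

Lemma ltrunc_rest_top a f : (f - ltrunc a f) a = f a.
Proof. by rewrite lcoefB ltruncE ltxx subr0. Qed.

Lemma ltruncD a f g : ltrunc a (f + g) = ltrunc a f + ltrunc a g.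
Proof. by apply: lauP => i; rewrite lcoefD !ltruncE; case: ifP; rewrite ?addr0. Qed.

Lemma ltruncN a f : ltrunc a (- f) = - ltrunc a f.
Proof. by apply: lauP => i; rewrite lcoefN !ltruncE; case: ifP; rewrite ?oppr0. Qed.

Lemma ltruncB a f g : ltrunc a (f - g) = ltrunc a f - ltrunc a g.
Proof. by rewrite ltruncD ltruncN. Qed.

Lemma ltrunc_monl a c f :
  ltrunc a (lmonomial kM c 0 * f) = lmonomial kM c 0 * ltrunc a f.
Proof.
apply: lauP => i; rewrite lcoefM_monl !ltruncE lcoefM_monl subr0.
by case: ifP => // _; rewrite rmorph0 mulr0.
Qed.

Lemma ltrunc_sum a I (r : seq I) (P : pred I) (F : I -> lau) :
  ltrunc a (\sum_(x <- r | P x) F x) = \sum_(x <- r | P x) ltrunc a (F x).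
Proof.
by apply: (big_morph (ltrunc a)); [exact: ltruncD|apply: lauP => i; rewrite ltruncE; case: ifP].
Qed.

Lemma ltrunc_small a f : ldle f a -> ltrunc a f = 0.
Proof. by move=> h; apply: lauP => i; rewrite ltruncE; case: ifP => // /h. Qed.

(** Downward induction on the degree; it starts because all coefficients of large degree vanish,
    where the first hypothesis applies. *)
Lemma lcoef_ind (f : lau) (P : int -> Prop) : (forall i : int, f i = 0 -> P i) ->
  (forall i : int, (forall j : int, i < j -> P j) -> P i) -> forall i, P i.
Proof.
move=> P0 Ps; have [N hN] := ldle_ex f.
suff H (m : nat) i : N - m%:Z < i -> P i.
  by move=> i; apply: (H `|N - i|.+1); lia.
elim: m i => [|m IH] i hi; first by apply/P0/hN; lia.
by apply: Ps => j ij; apply: IH; lia.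
Qed.

Lemma ldeg_ex (f : lau) : f != 0 -> exists d, f d != 0 /\ ldle f d.
Proof.
move=> f0; apply: contrapT => nd; move/eqP: f0; apply; apply: lauP => i.
elim/(@lcoef_ind f): i => // i IH; apply/eqP; rewrite lcoef0.
by apply: contraPT (nd) => fi; apply; exists i.
Qed.

Lemma ldegP (f : lau) : f != 0 -> f (ldeg f) != 0 /\ ldle f (ldeg f).
Proof.
by move=> /ldeg_ex ex; rewrite /ldeg; apply: (xgetPex 0 ex).
Qed.

Lemma ldeg_uniq (f : lau) d : f d != 0 -> ldle f d -> ldeg f = d.
Proof.
move=> fd hd; have f0 : f != 0 by apply: contraNneq fd => ->; rewrite lcoef0.
have [f1 h1] := ldegP f0; apply/eqP; rewrite eq_le; apply/andP; split.
  by rewrite leNgt; apply/negP => /hd e; rewrite e eqxx in f1.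
by rewrite leNgt; apply/negP => /h1 e; rewrite e eqxx in fd.
Qed.

Lemma ldegM (f g : lau) : f != 0 -> g != 0 ->
  f * g != 0 /\ ldeg (f * g) = ldeg f + ldeg g.
Proof.
move=> /ldegP[f1 hf] /ldegP[g1 hg].
have e := lcoefM_top hf hg.
have nz : (f * g) (ldeg f + ldeg g) != 0 by rewrite e mulf_neq0 ?fmorph_eq0.
split; first by apply: contraNneq nz => ->; rewrite lcoef0.
exact/ldeg_uniq/ldleM.
Qed.

Lemma ldeg_mon c n : c != 0 -> ldeg (lmonomial kM c n) = n.
Proof. by move=> c0; apply: ldeg_uniq; rewrite /= ?eqxx //; apply: ldle_mon. Qed.

Lemma ldle_ltdeg (f : lau) a : f != 0 -> ldle f a -> ldeg f <= a.
Proof.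
move=> /ldegP[f1 _] h; rewrite leNgt; apply/negP => /h e.
by rewrite e eqxx in f1.
Qed.

(** * Inversion of series *)

Section Geometric.
Variables (h : lau) (hh : ldle h (-1)).

Lemma ldleX m : ldle ((- h) ^+ m) (- m%:Z).
Proof.
elim: m => [|m IH]; first by rewrite expr0 oppr0; apply: ldle_mon.
rewrite exprS; have -> : - m.+1%:Z = -1 + - m%:Z by lia.
by apply/ldleM/IH/ldleN.
Qed.

Let S K : lau := \sum_(m < K) (- h) ^+ m.

(** [(- h) ^+ m] has degree at most -m, so the coefficient of degree i in the partial sums [S K] is
    stationary from K = |i| + 1 on, and the geometric series is read off at that index. *)
Fact geom_subproof : exists N : int, forall i, N < i -> S (`|i|.+1)%N i * (i <= 0)%R%:R = 0.
Proof. by exists 0 => i i0; rewrite leNgt i0 mulr0. Qed.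
Let G : lau := Laurent kM geom_subproof.

Let GS K : ldle (G - S K) (- K%:Z).
Proof.
move=> i Ki; rewrite lcoefB /=.
have Sstab (a b : nat) : (a <= b)%N -> - a%:Z < i -> S b i = S a i.
  move=> ab ai; rewrite /S !lcoef_sum -(subnKC ab) big_split_ord /=.
  rewrite [X in _ + X]big1 ?addr0 // => j _.
  by apply: ldleX; rewrite /=; lia.
have [i0|i0] := leP i 0; last first.
  rewrite mulr0 sub0r; apply/eqP; rewrite oppr_eq0; apply/eqP.
  by rewrite (Sstab 0%N) /S ?big_ord0 //; lia.
rewrite mulr1; case: (leqP K (`|i|.+1)%N) => c; last first.
  by rewrite (Sstab _ _ (ltnW c)) ?subrr //; lia.
by rewrite (Sstab _ _ c) ?subrr.
Qed.

Lemma geom_rinv : exists g : lau, (1 + h) * g = 1.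
Proof.
exists G; apply: lauP => i.
pose K := (`|i|.+1)%N.
have eS : (1 + h) * S K = 1 - (- h) ^+ K.
  have -> : 1 + h = - (- h - 1) by rewrite opprB opprK.
  by rewrite mulNr -subrX1 opprB.
have -> : G = S K + (G - S K) by rewrite addrC subrK.
rewrite mulrDr eS lcoefD lcoefB (ldleX (m := K)) ?subr0; last by lia.
rewrite (_ : ((1 + h) * (G - S K)) i = 0) ?addr0 //.
apply: (ldleM (a := 0) (b := - K%:Z)); last by lia.
  by apply: ldleD; [apply: ldle_mon|apply: ldle_trans hh _].
exact: GS.
Qed.

End Geometric.

(** f is its leading monomial times 1 + h with h of negative degree. *)
Lemma lau_rinv (f : lau) : f != 0 -> exists g, f * g = 1.
Proof.
move=> /ldegP[f1 hf]; set d := ldeg f in f1 hf.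
pose c := lmonomial kM (f d) d.
pose c' := lmonomial kM (Fr (- d) (f d)^-1) (- d).
have cc' : c * c' = 1.
  by rewrite lmonomialM -frobzD addrN frobz0 mulfV // ?subrr.
have c'c : c' * c = 1.
  by rewrite lmonomialM -rmorphM mulVf // rmorph1 addNr.
pose h := c' * f - 1.
have hh : ldle h (-1).
  move=> i hi; rewrite lcoefB lcoef1 lcoefM_monl.
  have [i0|] := eqVneq i 0.
    by rewrite i0 opprK add0r -rmorphM mulVf // rmorph1 subrr.
  by move=> i0; rewrite [f (i - _)]hf ?rmorph0 ?mulr0 ?subr0 //; lia.
have [g hg] := geom_rinv hh; exists (g * c').
rewrite mulrA; have -> : f = c * (1 + h) by rewrite /h addrC subrK mulrA cc' mul1r.
by rewrite -[c * _ * g]mulrA hg mulr1.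
Qed.

(** A right inverse of a right inverse of f equals f, so right inverses are two-sided. *)
Lemma lau_unitE (f : lau) : (f \is a GRing.unit) = (f != 0).
Proof.
apply/idP/idP => [|f0]; first by apply: contraTneq => ->; rewrite unitr0.
have [g fg] := lau_rinv f0.
have g0 : g != 0.
  by apply: contra_eq_neq fg => ->; rewrite mulr0 eq_sym oner_neq0.
have [g' gg'] := lau_rinv g0.
apply/unitrP; exists g; split => //.
have -> : f = g' by rewrite -[g']mul1r -fg -mulrA gg' mulr1.
exact: gg'.
Qed.

Lemma ldegV (f : lau) : f != 0 -> ldeg f^-1 = - ldeg f.
Proof.
move=> f0; have f0' : f^-1 != 0 by rewrite -lau_unitE unitrV lau_unitE.
have [_] := ldegM f0 f0'; rewrite divrr ?lau_unitE // ldeg_mon ?oner_neq0 //; lia.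
Qed.

Lemma lau_commV (f g : lau) : f * g = g * f -> f * g^-1 = g^-1 * f.
Proof. exact: commrV. Qed.

(** * Series with coefficients in a subfield stable under Frobenius and its inverse *)

Section Coefs.
Variable S : set M.
Hypotheses (S1 : S 1) (SB : forall x y, S x -> S y -> S (x - y))
  (SM : forall x y, S x -> S y -> S (x * y)) (SV : forall x, S x -> S x^-1)
  (SF : forall i x, S x -> S (Fr i x)).

Definition lcoefs_in (f : lau) := forall i : int, S (f i).

Lemma subset_zero : S 0. Proof. by rewrite -(subrr 1); apply: SB. Qed.
Lemma subset_opp x : S x -> S (- x).
Proof. by rewrite -[- x]sub0r; apply/SB/subset_zero. Qed.
Lemma subset_add x y : S x -> S y -> S (x + y).
Proof. by move=> hx hy; rewrite -[y]opprK; apply/SB/subset_opp. Qed.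
Lemma subset_sum I (r : seq I) (P : pred I) (F : I -> M) :
  (forall x, P x -> S (F x)) -> S (\sum_(x <- r | P x) F x).
Proof. by move=> h; apply: big_ind => //; [exact: subset_zero|exact: subset_add]. Qed.

Lemma lcoefs_in0 : lcoefs_in 0. Proof. by move=> i; apply: subset_zero. Qed.
Lemma lcoefs_inB f g : lcoefs_in f -> lcoefs_in g -> lcoefs_in (f - g).
Proof. by move=> hf hg i; apply: SB. Qed.
Lemma lcoefs_inM f g : lcoefs_in f -> lcoefs_in g -> lcoefs_in (f * g).
Proof.
move=> hf hg n; have [Nf bf] := lau_boundP f; have [Ng bg] := lau_boundP g.
rewrite [_ n](lau_mul_coefE (K := (`|n| + Nf + Ng)%N) bf bg) //.
by apply: subset_sum => i _; apply/SM/SF.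
Qed.
Lemma lcoefs_in_mon c n : S c -> lcoefs_in (lmonomial kM c n).
Proof. by move=> hc i /=; case: ifP => // _; apply: subset_zero. Qed.
Lemma lcoefs_in1 : lcoefs_in 1. Proof. exact: lcoefs_in_mon. Qed.
Lemma lcoefs_in_trunc (f : lau) (a : int) : (forall i, a < i -> S (f i)) -> lcoefs_in (ltrunc a f).
Proof. by move=> h i; rewrite ltruncE; case: ifP => [/h|_] //; apply: subset_zero. Qed.

(** By descending degree: in f f^-1 = 1 the coefficient of degree d + i expresses the i-th
    coefficient of f^-1 through the higher ones. *)
Lemma lcoefs_inV f : lcoefs_in f -> lcoefs_in f^-1.
Proof.
move=> hf; have [->|f0] := eqVneq f 0; first by rewrite invr0; apply: lcoefs_in0.
have [f1 bf] := ldegP f0; set d := ldeg f in f1 bf.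
move=> i; elim/(@lcoef_ind f^-1): i => [i ->|i IH]; first exact: subset_zero.
set g := f^-1 in IH *; set T := ltrunc i g.
have fT : lcoefs_in (f * T) by apply: lcoefs_inM => //; apply: lcoefs_in_trunc.
have e : f * (g - T) = 1 - f * T by rewrite mulrBr divrr ?lau_unitE.
have := lcoefM_top bf (ltrunc_rest (a := i) g); rewrite -/T e ltrunc_rest_top => e2.
have -> : g i = Fr (- d) ((f d)^-1 * (1 - f * T : lau) (d + i)).
  by rewrite e2 mulrA mulVf // mul1r -frobzD addNr frobz0.
by apply/SF/SM; [exact: SV|apply: lcoefs_inB => //; apply: lcoefs_in1].
Qed.

End Coefs.

(** This is the coefficient of degree i + N in f b = b f. For N > 0 and b_N nonzero it is a
    polynomial equation for f_i whose constant term depends only on the higher coefficients of f;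
    both the algebraicity and the finiteness of the coefficients come from it. *)
Lemma comm_top (f b : lau) N i : f * b = b * f -> ldle b N ->
  f i * Fr i (b N) - b N * Fr N (f i) =
  (b * ltrunc i f - ltrunc i f * b) (i + N).
Proof.
move=> fb hb; set T := ltrunc i f.
have h := ltrunc_rest (a := i) f; rewrite -/T in h.
have e1 := lcoefM_top h hb; have e2 := lcoefM_top hb h.
rewrite ltrunc_rest_top in e1 e2.
rewrite -e1 -e2 [N + i]addrC -lcoefB.
have -> // : (f - T) * b - b * (f - T) = b * T - T * b.
by rewrite mulrBl mulrBr fb opprB addrC addrA subrK.
Qed.

Section Lmap.
Variable s : {rmorphism M -> M}.

Lemma frobz_rmorph i x : s (Fr i x) = Fr i (s x).
Proof.
have [a [b ->]] := int_nat2 i.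
by apply: frobzE; rewrite -rmorphXn /= frobzK rmorphXn.
Qed.

Lemma lmapE (f : lau) i : lmap s f i = s (f i). Proof. by []. Qed.

Lemma lmapM (f g : lau) : lmap s (f * g) = lmap s f * lmap s g.
Proof.
apply: lauP => n; have [Nf hf] := lau_boundP f; have [Ng hg] := lau_boundP g.
have hf' i : lmap s f i != 0 -> i <= Nf%:Z by rewrite lmapE fmorph_eq0; apply: hf.
have hg' i : lmap s g i != 0 -> i <= Ng%:Z by rewrite lmapE fmorph_eq0; apply: hg.
rewrite lmapE [(f * g) n](lau_mul_coefE (K := (`|n| + Nf + Ng)%N) hf hg) //.
rewrite [RHS](lau_mul_coefE (K := (`|n| + Nf + Ng)%N) hf' hg') //.
by rewrite rmorph_sum; apply: eq_bigr => i _; rewrite rmorphM frobz_rmorph.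
Qed.

Lemma lmap1 : lmap s (1 : lau) = 1.
Proof. by apply: lauP => i; rewrite lmapE !lcoef1; case: ifP; rewrite ?rmorph1 ?rmorph0. Qed.

Lemma lmap_neq0 (f : lau) : f != 0 -> lmap s f != 0.
Proof.
move=> /ldegP[h _]; apply: contraNneq h => /(congr1 (fun g : lau => g (ldeg f))).
by rewrite lmapE lcoef0 => /eqP; rewrite fmorph_eq0.
Qed.

Lemma lmapV (f : lau) : f != 0 -> lmap s f^-1 = (lmap s f)^-1.
Proof.
move=> f0; have u := lmap_neq0 f0; rewrite -lau_unitE in u.
by apply: (mulrI u); rewrite mulrV // -lmapM mulrV ?lau_unitE // lmap1.
Qed.

End Lmap.

Lemma tau_exp (d : int) : tau kM ^ d = lmonomial kM 1 d.
Proof.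
have p (n : nat) : tau kM ^+ n = lmonomial kM 1 n%:Z.
  elim: n => [|n IH] //.
  by rewrite exprS IH lmonomialM rmorph1 mulr1 intS.
case: d => n; first by rewrite -exprnP p.
rewrite NegzE -exprnN p; apply: (@mulrI _ (lmonomial kM 1 n.+1%:Z)).
  by rewrite -p unitrX ?tau_unit.
rewrite mulrV -?p ?unitrX ?tau_unit // p lmonomialM rmorph1 mulr1.
by rewrite addrN.
Qed.

Lemma tau_conj (d : int) (f : lau) i :
  (tau kM ^ d * f * (tau kM ^ d)^-1) i = Fr d (f i).
Proof.
have e : (tau kM ^ d)^-1 = tau kM ^ (- d) by rewrite -invr_expz.
rewrite e !tau_exp lcoefM_monr rmorph1 mulr1 lcoefM_monl mul1r.
by congr (Fr _ (f _)); lia.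
Qed.

End LaurentTheory.

(** * Cartier operators on finitely generated fields *)

Section Spans.
Variables (k : finFieldType) (L : fieldType) (kL : {rmorphism k -> L}).
Local Notation q := #|k|.

Lemma card_gt1 : (1 < q)%N. Proof. exact: finNzRing_gt1. Qed.

Lemma field_pchar_nat_card n : [pchar L].-nat (q ^ n)%N.
Proof.
have [p p_pr pk] := finPcharP k.
have pL : p \in [pchar L] by rewrite (fmorph_pchar kL).
rewrite pnatX; apply/orP; left.
by rewrite (card_pprimeChar pk) (eq_pnat _ (pcharf_eq pL)) pnatX pnat_id.
Qed.

Lemma frobD n (x y : L) : (x + y) ^+ (q ^ n) = x ^+ (q ^ n) + y ^+ (q ^ n).
Proof. exact/exprDn_pchar/field_pchar_nat_card. Qed.

Lemma card_exp_gt0 n : (0 < q ^ n)%N.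
Proof. by rewrite expn_gt0 (ltnW card_gt1). Qed.

Lemma frobB n (x y : L) : (x - y) ^+ (q ^ n) = x ^+ (q ^ n) - y ^+ (q ^ n).
Proof. by apply/eqP; rewrite eq_sym subr_eq -frobD subrK. Qed.

Lemma frob_inj n : injective (fun x : L => x ^+ (q ^ n)).
Proof.
move=> x y /= /eqP; rewrite -subr_eq0 -frobB expf_eq0 card_exp_gt0 /= subr_eq0.
by move/eqP.
Qed.

Lemma frob1D (x y : L) : (x + y) ^+ q = x ^+ q + y ^+ q.
Proof. by have := frobD 1 x y; rewrite expn1. Qed.
Lemma frob1B (x y : L) : (x - y) ^+ q = x ^+ q - y ^+ q.
Proof. by have := frobB 1 x y; rewrite expn1. Qed.
Lemma frob1_inj : injective (fun x : L => x ^+ q).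
Proof. by have := @frob_inj 1; rewrite expn1. Qed.

Lemma card_scalar_exp (c : k) : kL c ^+ q = kL c.
Proof. by rewrite -rmorphXn /= expf_card. Qed.

(** The span is an explicit list: over the finite field k, bounded means finite. *)
Fixpoint kspan (s : seq L) : seq L :=
  if s is x :: s' then [seq kL c * x + z | c <- enum k, z <- kspan s'] else [:: 0].

Lemma kspan_ind (P : L -> Prop) s : P 0 ->
  (forall c x z, x \in s -> P z -> P (kL c * x + z)) ->
  forall z, z \in kspan s -> P z.
Proof.
move=> P0; elim: s => [|x s IH] Ps z /=; first by rewrite inE => /eqP ->.
move=> /allpairsP[[c y]] /= [_ hy ->].
apply: (Ps); rewrite ?mem_head //; apply: IH hy => c' x' z' hx'.
by apply: Ps; rewrite inE hx' orbT.
Qed.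

Lemma kspan_cons x s z :
  (z \in kspan (x :: s)) <-> exists c y, y \in kspan s /\ z = kL c * x + y.
Proof.
split=> [/allpairsP[[c y]] /= [_ hy ->]|[c [y [hy ->]]]]; first by exists c, y.
by apply/allpairsP; exists (c, y); rewrite /= mem_enum.
Qed.

Lemma kspan0 s : 0 \in kspan s.
Proof.
elim: s => [|x s IH]; first by rewrite inE.
by apply/kspan_cons; exists 0, 0; rewrite rmorph0 mul0r addr0.
Qed.

Lemma kspanD s y z : y \in kspan s -> z \in kspan s -> y + z \in kspan s.
Proof.
elim: s y z => [|x s IH] y z; first by rewrite !inE => /eqP -> /eqP ->; rewrite addr0.
move=> /kspan_cons[c [y' [hy ->]]] /kspan_cons[d [z' [hz ->]]].
apply/kspan_cons; exists (c + d), (y' + z'); split; first exact: IH.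
by rewrite rmorphD mulrDl addrACA.
Qed.

Lemma kspanZ s c z : z \in kspan s -> kL c * z \in kspan s.
Proof.
elim: s z => [|x s IH] z; first by rewrite !inE => /eqP ->; rewrite mulr0.
move=> /kspan_cons[d [y [hy ->]]]; apply/kspan_cons.
by exists (c * d), (kL c * y); rewrite IH // rmorphM mulrDr mulrA.
Qed.

Lemma kspan_mem s x : x \in s -> x \in kspan s.
Proof.
elim: s => // y s IH; rewrite inE => /predU1P[->|/IH hx]; apply/kspan_cons.
  by exists 1, 0; rewrite kspan0 rmorph1 mul1r addr0.
by exists 0, x; rewrite rmorph0 mul0r add0r.
Qed.

Lemma kspan_morph (f : L -> L) s s' : f 0 = 0 ->
  (forall c x y, f (kL c * x + y) = kL c * f x + f y) ->
  (forall x, x \in s -> f x \in kspan s') ->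
  forall z, z \in kspan s -> f z \in kspan s'.
Proof.
move=> f0 fD fs; apply: kspan_ind; first by rewrite f0 kspan0.
by move=> c x z hx hz; rewrite fD; apply/kspanD/hz/kspanZ/fs.
Qed.

Lemma kspan_sub s s' : {subset s <= kspan s'} -> {subset kspan s <= kspan s'}.
Proof. by move=> h; apply: (@kspan_morph id). Qed.

(** Degrees are bounded in each variable separately, so that Euclidean division of exponents by q
    ([mons_frob]) leaves remainders in [mons X q.-1]. *)
Fixpoint mons (X : seq L) (d : nat) : seq L :=
  if X is x :: X' then [seq x ^+ i * m | i <- iota 0 d.+1, m <- mons X' d]
  else [:: 1].

Lemma mons_cons x X d m : (m \in mons (x :: X) d) <->
  exists i m', [/\ (i <= d)%N, m' \in mons X d & m = x ^+ i * m'].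
Proof.
split=> [/allpairsP[[i m'] [hi hm ->]]|[i [m' [hi hm ->]]]].
  by exists i, m'; split=> //; rewrite mem_iota in hi.
by apply/allpairsP; exists (i, m'); split; rewrite ?mem_iota.
Qed.

Lemma mons1 X d : 1 \in mons X d.
Proof.
elim: X => [|x X IH]; first by rewrite inE.
by apply/mons_cons; exists 0%N, 1; rewrite mulr1.
Qed.

Lemma monsM X d e a b : a \in mons X d -> b \in mons X e -> a * b \in mons X (d + e).
Proof.
elim: X a b => [|x X IH] a b; first by rewrite !inE => /eqP -> /eqP ->; rewrite mulr1.
move=> /mons_cons[i [a' [hi ha ->]]] /mons_cons[j [b' [hj hb ->]]].
apply/mons_cons; exists (i + j)%N, (a' * b'); rewrite IH //; split=> //.
  exact: leq_add.
by rewrite exprD mulrACA.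
Qed.

Lemma mons_le X d e : (d <= e)%N -> {subset mons X d <= mons X e}.
Proof. by move=> /subnKC <- a ha; rewrite -[a]mulr1 monsM ?mons1. Qed.

Lemma mons_gen X x d : x \in X -> (0 < d)%N -> x \in mons X d.
Proof.
move=> + d0; elim: X => // y X IH; rewrite inE => /predU1P[->|/IH hx].
  by apply/mons_cons; exists 1%N, 1; rewrite mons1 expr1 mulr1.
by apply/mons_cons; exists 0%N, x; rewrite mul1r.
Qed.

Lemma mons_frob X d m : m \in mons X d ->
  exists a b, [/\ a \in mons X (d %/ q), b \in mons X q.-1 & m = a ^+ q * b].
Proof.
have q0 := ltnW card_gt1.
elim: X m => [|x X IH] m; first by rewrite inE => /eqP ->; exists 1, 1; rewrite !inE expr1n mulr1.
move=> /mons_cons[i [m' [hi /IH[a [b [ha hb ->]]] ->]]].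
exists (x ^+ (i %/ q) * a), (x ^+ (i %% q) * b); split.
- by apply/mons_cons; exists (i %/ q)%N, a; rewrite leq_div2r.
- apply/mons_cons; exists (i %% q)%N, b; split=> //.
  by rewrite -ltnS prednK // ltn_mod.
- by rewrite {1}(divn_eq i q) exprD exprM exprMn mulrACA.
Qed.

Lemma roots_bound (s : seq L) r : (0 < r)%N -> uniq s ->
  (forall x, x \in s -> x ^+ (q ^ r) = x) -> (size s <= q ^ r)%N.
Proof.
move=> r0 us hs; have q1 : (1 < q ^ r)%N.
  by rewrite -(exp1n r) ltn_exp2r // card_gt1.
have sz : size ('X^(q ^ r) - 'X : {poly L}) = (q ^ r).+1.
  by rewrite size_polyDl size_polyXn // size_polyN size_polyX.
rewrite -ltnS -sz; apply: max_poly_roots => //.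
  by rewrite -size_poly_eq0 sz.
by apply/allP => x /hs hx; rewrite rootE !hornerE /= hx subrr.
Qed.

(** Multiplication by a nonzero y permutes the nonzero elements of s, whose product can be
    cancelled. *)
Lemma fermat_seq (s : seq L) y : uniq s -> 0 \in s ->
  (forall a b, a \in s -> b \in s -> a * b \in s) -> y \in s -> y ^+ size s = y.
Proof.
move=> us s0 sM ys; pose s' := [seq y <- s | y != 0].
have ss' : size s = (size s').+1.
  rewrite size_filter -(count_predC (pred1 0) s) count_uniq_mem // s0 add1n.
  by congr _.+1; apply: eq_count => z.
have [->|y0] := eqVneq y 0; first by rewrite ss' expr0n.
have pe : perm_eq [seq y * z | z <- s'] s'.
  have us' : uniq [seq y * z | z <- s'].
    by rewrite map_inj_uniq ?filter_uniq //; apply: mulfI.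
  apply: uniq_perm => //; first exact: filter_uniq.
  apply: (uniq_min_size us' _ _).2; last by rewrite size_map.
  move=> _ /mapP[z + ->]; rewrite !mem_filter => /andP[z0 zs].
  by rewrite mulf_neq0 // sM.
have P0 : \prod_(z <- s') z != 0.
  by rewrite prodf_seq_neq0; apply/allP => z; rewrite mem_filter => /andP[].
have : y ^+ size s' * \prod_(z <- s') z = \prod_(z <- s') z.
  rewrite -[RHS](perm_big _ pe) big_map big_split /= big_const_seq count_predT.
  by rewrite iter_mulr_1.
move/eqP; rewrite -[X in _ == X]mul1r (inj_eq (mulIf P0)) => /eqP h.
by rewrite ss' exprS h mulr1.
Qed.

Lemma size_kspan s : size (kspan s) = (q ^ size s)%N.
Proof.
by elim: s => //= x s IH; rewrite size_allpairs IH -cardE expnS.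
Qed.

(** Extraction of a basis: [kspan s'] has no repetition exactly when s' is free over k, and then
    [size_kspan] counts the elements of the span. *)
Lemma kspan_free s : exists s', uniq (kspan s') /\ kspan s =i kspan s'.
Proof.
elim: s => [|x s [s' [us' es]]]; first by exists [::].
have [xs|xs] := boolP (x \in kspan s').
  exists s'; split=> // z; apply/idP/idP => [/kspan_cons[c [y [hy ->]]]|hz].
    by apply: kspanD; [exact: kspanZ|rewrite -es].
  by apply/kspan_cons; exists 0, z; rewrite es rmorph0 mul0r add0r.
exists (x :: s'); split=> [|z]; last first.
  by apply/idP/idP => /kspan_cons[c [y [hy ->]]]; apply/kspan_cons; exists c, y;
    [rewrite -es|rewrite es].
apply: allpairs_uniq => //; first exact: enum_uniq.
move=> [c z] [c' z'] /allpairsPdep[c1 [z1 [_ hz1 [-> ->]]]].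
move=> /allpairsPdep[c2 [z2 [_ hz2 [-> ->]]]] /= e.
have [cc|cc] := eqVneq c1 c2; first by move: e; rewrite cc => /addrI ->.
case/negP: xs.
have -> : x = kL (c1 - c2)^-1 * (z2 + kL (-1) * z1).
  have n0 : kL (c1 - c2) != 0 by rewrite fmorph_eq0 subr_eq0.
  rewrite fmorphV; apply: (mulfI n0); rewrite mulVKf // rmorphN1 mulN1r rmorphB mulrBl.
  by apply/eqP; rewrite subr_eq addrAC -subr_eq opprK e addrC.
by apply: kspanZ; apply: kspanD => //; apply: kspanZ.
Qed.

End Spans.

Lemma pigeonhole (T : eqType) (V : seq T) (y : nat -> T) :
  (forall i, y i \in V) -> exists a b, (a < b)%N /\ y a = y b.
Proof.
move=> hy; apply: contrapT => nab.
have inj : injective (fun i : 'I_(size V).+1 => y i).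
  move=> i j /= e; have [ij|ij|/val_inj //] := ltngtP i j; case: nab.
    by exists i, j.
  by exists j, i.
have := uniq_leq_size (s1 := map (fun i : 'I_(size V).+1 => y i)
  (enum 'I_(size V).+1)) (s2 := V).
rewrite map_inj_uniq ?enum_uniq // size_map -cardE card_ord ltnn.
have sub : {subset map (fun i : 'I_(size V).+1 => y i) (enum 'I_(size V).+1) <= V}.
  by move=> z /mapP[i _ ->].
by move=> /(_ isT sub).
Qed.

Section Cartier.
Variables (k : finFieldType) (L : fieldType) (kL : {rmorphism k -> L}).
Variable (X : seq L).
Local Notation q := #|k|.
Hypothesis hX : forall S : {pred L}, divring_closed S -> {subset X <= S} ->
  forall x, x \in S.

Local Notation Rd := (fun d => kspan kL (mons X d)).

Lemma RdM d e a b : a \in Rd d -> b \in Rd e -> a * b \in Rd (d + e)%N.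
Proof.
move=> ha; move: b; apply: kspan_morph => [|c x y|x hx]; first by rewrite mulr0.
  by rewrite mulrDr mulrCA.
move: a ha; apply: (@kspan_morph _ _ _ (fun a => a * x)) => [|c a y|a hy].
- by rewrite mul0r.
- by rewrite mulrDl mulrA.
- exact/kspan_mem/monsM.
Qed.

Lemma Rd_le d e : (d <= e)%N -> {subset Rd d <= Rd e}.
Proof. by move=> de; apply: kspan_sub => x hx; apply/kspan_mem/(mons_le de). Qed.

Lemma Rd1 d : 1 \in Rd d. Proof. exact/kspan_mem/mons1. Qed.

Lemma RdX c D N : D \in Rd c -> D ^+ N \in Rd (c * N)%N.
Proof.
move=> hD; elim: N => [|N IH]; first by rewrite expr0 Rd1.
by rewrite exprS mulnS RdM.
Qed.

Lemma RdN d a : a \in Rd d -> - a \in Rd d.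
Proof. by move=> ha; rewrite -mulN1r -(rmorphN1 kL) kspanZ. Qed.

Lemma Rd_frac (z : L) : exists d a b, [/\ a \in Rd d, b \in Rd d, b != 0 & z = a / b].
Proof.
pose S : {pred L} := fun z => `[< exists d a b,
  [/\ a \in Rd d, b \in Rd d, b != 0 & z = a / b] >].
suff /asboolP : z \in S by [].
apply: hX => [|x hx]; last first.
  apply/asboolP; exists 1%N, x, 1; rewrite Rd1 oner_neq0 divr1; split=> //.
  exact/kspan_mem/mons_gen.
split=> [|x y /asboolP[d [a [b [ha hb b0 ->]]]] /asboolP[d' [a' [b' [ha' hb' b0' ->]]]]
        |x y /asboolP[d [a [b [ha hb b0 ->]]]] /asboolP[d' [a' [b' [ha' hb' b0' ->]]]]].
- by apply/asboolP; exists 0%N, 1, 1; rewrite Rd1 oner_neq0 divr1.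
- apply/asboolP; exists (d + d')%N, (a * b' - a' * b), (b * b').
  rewrite mulf_neq0 // !RdM //; split=> //; last by field; rewrite b0 b0'.
  by apply: kspanD; [exact: RdM|apply: RdN; rewrite addnC RdM].
- apply/asboolP; have [a0|a0] := eqVneq a' 0.
    by exists 0%N, 0, 1; rewrite Rd1 kspan0 oner_neq0 a0 mul0r invr0 mulr0 mul0r.
  exists (d + d')%N, (a * b'), (b * a'); rewrite !RdM ?mulf_neq0 //; split=> //.
  by field; rewrite a0 b0 b0'.
Qed.

Lemma common_denom (Z : seq L) : exists c D, [/\ D != 0, D \in Rd c &
  forall z, z \in Z -> D * z \in Rd c].
Proof.
elim: Z => [|z Z [c [D [D0 hD hZ]]]]; first by exists 0%N, 1; rewrite oner_neq0 Rd1.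
have [d [a [b [ha hb b0 ez]]]] := Rd_frac z.
exists (c + d)%N, (D * b); rewrite mulf_neq0 // RdM //; split=> // y.
rewrite inE => /predU1P[->|/hZ hy].
  have -> : D * b * z = D * a by rewrite ez; field.
  exact: RdM.
by rewrite mulrAC RdM.
Qed.

(** L is spanned over L^q by [mons X q.-1]: write a / b as (1 / b)^q (a b^(q-1)) and split the
    monomials of the second factor. *)
Lemma frob_span (z : L) : exists (r : seq (L * L)),
  all (fun t => t.2 \in mons X q.-1) r /\ z = \sum_(t <- r) t.1 ^+ q * t.2.
Proof.
have [d [a [b [ha hb b0 ->]]]] := Rd_frac z.
have {ha hb} [e hab] : exists e, a * b ^+ q.-1 \in Rd e.
  by exists (d + d * q.-1)%N; rewrite RdM // RdX.
have -> : a / b = (b^-1) ^+ q * (a * b ^+ q.-1).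
  have q0 : (0 < q)%N by apply: ltnW (card_gt1 k).
  have bu : b ^+ q = b * b ^+ q.-1 by rewrite -exprS prednK.
  by rewrite exprVn bu; field; rewrite b0 expf_neq0.
move: (a * b ^+ q.-1) hab; apply: kspan_ind => [|c m y hm [r [hr hy]]].
  by exists [::]; rewrite mulr0 big_nil.
have [a' [b' [ha' hb' ->]]] := mons_frob k hm.
exists ((b^-1 * kL c * a', b') :: r); rewrite /= hb' hr; split=> //.
rewrite big_cons -hy mulrDr /= !exprMn card_scalar_exp; congr (_ + _).
by rewrite !mulrA.
Qed.

(** A linear form over the field of q-th powers, composed with the q-th root. *)
Definition cartier (psi : L -> L) :=
  (forall x y, psi (x + y) = psi x + psi y) /\
  (forall a x, psi (a ^+ q * x) = a * psi x).

(* psi is read off a hyperplane W over the field of q-th powers, containing T but *)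
(* not 1: L is spanned over that field by the finitely many elements mons X q.-1. *)
Lemma cartier_exists (T : L) : (forall a, T != a ^+ q) \/ T = 0 ->
  exists2 psi, cartier psi & psi 1 = 1 /\ psi T = 0.
Proof.
move=> hT; pose closed (W : set L) :=
  (forall x y, W x -> W y -> W (x + y)) /\ (forall a x, W x -> W (a ^+ q * x)).
have q0 : (0 < q)%N by apply: ltnW (card_gt1 k).
have z0 : (0 : L) ^+ q = 0 by rewrite expr0n -(prednK q0).
have N1 : (-1 : L) ^+ q = -1 by rewrite -(rmorphN1 kL) card_scalar_exp.
(* W0 grows through l: an m outside W + L^q is adjoined to W. This keeps 1 out, since 1 = w + a^q m
   with a nonzero would put m in W + L^q. *)
have step (l : seq L) W0 : closed W0 -> ~ W0 1 -> W0 0 -> exists W,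
    [/\ closed W, ~ W 1, forall x, W0 x -> W x &
        forall m, m \in l -> exists c, W (m - c ^+ q)].
  move=> cW0 n1 W00; elim: l => [|m l [W [[WD WZ] W1 W0W hl]]]; first by exists W0.
  have [[c hc]|nc] := pselect (exists c, W (m - c ^+ q)).
    exists W; split=> // m'; rewrite inE => /predU1P[->|/hl //]; by exists c.
  exists [set z | exists w a, W w /\ z = w + a ^+ q * m]; split.
  - split=> [x y [w [a [hw ->]]] [w' [a' [hw' ->]]]|a x [w [b [hw ->]]]].
      by exists (w + w'), (a + a'); split; [exact: WD|rewrite (frob1D kL); ring].
    by exists (a ^+ q * w), (a * b); split; [exact: WZ|rewrite exprMn; ring].
  - move=> [w [a [hw e]]]; have [a0|a0] := eqVneq a 0.
      by apply: W1; rewrite e a0 z0 mul0r addr0.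
    apply: nc; exists a^-1.
    have -> : m - a^-1 ^+ q = (-1) ^+ q * (a^-1 ^+ q * w); last exact/WZ/WZ.
    rewrite N1 exprVn; have -> : w = 1 - a ^+ q * m by rewrite e addrK.
    by field; rewrite expf_neq0.
  - move=> x /W0W hx; exists x, 0; split=> //.
    by rewrite z0 mul0r addr0.
  - move=> m'; rewrite inE => /predU1P[->|/hl[c hc]].
      exists 0, 0, 1; split; first exact: W0W.
      by rewrite expr1n mul1r add0r z0 subr0.
    exists c, (m' - c ^+ q), 0; split=> //.
    by rewrite z0 mul0r addr0.
have [|||W [[WD WZ] W1 W0W hl]] := @step (mons X q.-1) [set z | exists a, z = a ^+ q * T].
- split=> [x y [a ->] [b ->]|a x [b ->]].
    by exists (a + b); rewrite (frob1D kL) mulrDl.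
  by exists (a * b); rewrite exprMn mulrA.
- move=> [a e]; case: hT => [|T0]; last by move/eqP: e; rewrite T0 mulr0 oner_eq0.
  move=> /(_ a^-1) /eqP; apply; rewrite exprVn.
  have a0 : a ^+ q != 0.
    by apply: contra_eq_neq e => ->; rewrite mul0r oner_neq0.
  by rewrite -[LHS]mul1r -(mulVf a0) -mulrA -e mulr1.
- by exists 0; rewrite z0 mul0r.
have ex z : exists c, W (z - c ^+ q).
  have [r [hr ->]] := frob_span z; elim: r hr => [_|[a m] r IH /= /andP[hm /IH[c hc]]].
    exists 0; rewrite big_nil z0 subr0; apply: W0W.
    by exists 0; rewrite z0 mul0r.
  have [d hd] := hl _ hm; exists (a * d + c); rewrite big_cons /=.
  have -> : a ^+ q * m + \sum_(t <- r) t.1 ^+ q * t.2 - (a * d + c) ^+ q =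
    a ^+ q * (m - d ^+ q) + (\sum_(t <- r) t.1 ^+ q * t.2 - c ^+ q).
    by rewrite (frob1D kL) exprMn; ring.
  by apply/WD/hc/WZ.
have WB x y : W x -> W y -> W (x - y).
  by move=> hx hy; apply: WD => //; rewrite -mulN1r -N1; apply: WZ.
have uq z c d : W (z - c ^+ q) -> W (z - d ^+ q) -> c = d.
  move=> hc hd; apply/eqP; rewrite -subr_eq0; apply/negP => /negP n0; apply: W1.
  have := WB _ _ hd hc.
  have -> : z - d ^+ q - (z - c ^+ q) = (c - d) ^+ q.
    by rewrite (frob1B kL) opprB addrC addrA subrK.
  by move/(WZ (c - d)^-1); rewrite -exprMn mulVf // expr1n.
pose psi z := xget 0 [set c | W (z - c ^+ q)].
have psiP z : W (z - psi z ^+ q) by have := xgetPex 0 (ex z).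
exists psi.
  split=> [x y|a x]; apply: uq (psiP _) _.
    by rewrite (frob1D kL) opprD addrACA; apply: WD.
  by rewrite exprMn -mulrBr; apply: WZ.
have W0 : W 0 by apply: W0W; exists 0; rewrite z0 mul0r.
split; first by apply: uq (psiP _) _; rewrite expr1n subrr.
apply: uq (psiP _) _; rewrite z0 subr0.
by apply: W0W; exists 1; rewrite expr1n mul1r.
Qed.

(** * Cartier operators contract pole orders and degrees *)

Section Contraction.
Variables (psi : L -> L).
Hypothesis hpsi : cartier psi.

Lemma cartierD x y : psi (x + y) = psi x + psi y. Proof. by case: hpsi. Qed.
Lemma cartierZ a x : psi (a ^+ q * x) = a * psi x. Proof. by case: hpsi. Qed.
Lemma cartier0 : psi 0 = 0.
Proof. by apply: (addIr (psi 0)); rewrite -cartierD !add0r. Qed.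

Lemma cartier_sum I (r : seq I) (P : pred I) (F : I -> L) :
  psi (\sum_(x <- r | P x) F x) = \sum_(x <- r | P x) psi (F x).
Proof. exact: (big_morph psi cartierD cartier0). Qed.

(** D clears the denominators of psi on the finitely many monomials of [mons X q.-1]. The bound c.-1
    on D itself leaves the room by which [Rd d] lies in [bdd D c d] ([bdd_Rd]). *)
Definition good (D : L) (c : nat) := [/\ D != 0, (0 < c)%N, D \in Rd c.-1 &
  forall m, m \in mons X q.-1 -> D * psi m \in Rd c].

Lemma good_Rd D c : good D c -> D \in Rd c.
Proof. by move=> [_ c0 h _]; apply: Rd_le h; apply: leq_pred. Qed.

(** One exponent N controls both the pole order along D and the degree of the numerator. *)
Definition bdd (D : L) (c N : nat) : set L := [set z | D ^+ N * z \in Rd (c * N)%N].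

Lemma bdd_le D c N N' z : good D c -> (N <= N')%N -> bdd D c N z -> bdd D c N' z.
Proof.
move=> /good_Rd hD /subnKC <-; rewrite /bdd /= => h.
by rewrite addnC exprD -mulrA mulnDr RdM // RdX.
Qed.

Lemma bdd_Rd D c d z : good D c -> z \in Rd d -> bdd D c d z.
Proof.
move=> [_ c0 hD _] hz; rewrite /bdd /= -[X in (X * d)%N](prednK c0) mulSn addnC.
by rewrite RdM // RdX.
Qed.

Lemma bddD D c N x y : bdd D c N x -> bdd D c N y -> bdd D c N (x + y).
Proof. by rewrite /bdd /= mulrDr; apply: kspanD. Qed.

Lemma bdd0 D c N : bdd D c N 0.
Proof. by rewrite /bdd /= mulr0 kspan0. Qed.

Lemma bdd_sum D c N I (r : seq I) (F : I -> L) :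
  (forall t, List.In t r -> bdd D c N (F t)) -> bdd D c N (\sum_(t <- r) F t).
Proof.
elim: r => [|t r IH] h; first by rewrite big_nil; apply: bdd0.
rewrite big_cons; apply: bddD; first by apply: h; left.
by apply: IH => u hu; apply: h; right.
Qed.

Lemma bddM D c N N' x y : bdd D c N x -> bdd D c N' y -> bdd D c (N + N') (x * y).
Proof. by rewrite /bdd /= exprD mulrACA mulnDr; apply: RdM. Qed.

(** For e = N / q + 1 one has N <= q e, and psi (D^(q e) z) = D^e psi z divides the degree by q. One
    further factor D clears the denominators of psi, whence the exponent e + 1 = N / q + 2. *)
Lemma bdd_psi D c N z : good D c -> bdd D c N z -> bdd D c (N %/ q + 2) (psi z).
Proof.
move=> gD; have [_ _ _ hm] := gD; pose e := (N %/ q).+1 => hz.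
have q0 : (0 < q)%N by apply: ltnW (card_gt1 k).
have : bdd D c (q * e) z.
  by apply: bdd_le hz => //; rewrite mulnC /e ltnW // ltn_ceil.
rewrite /bdd /= addn2 -/e => {}hz.
suff H d y : y \in Rd d -> D * psi y \in Rd (d %/ q + c)%N.
  have := H _ _ hz; rewrite [(q * e)%N]mulnC exprM cartierZ mulrA -exprS.
  by rewrite mulnA mulnK // -mulnSr.
move: y; apply: (@kspan_morph _ _ _ (fun y => D * psi y)) => [|a x y|x].
- by rewrite cartier0 mulr0.
- by rewrite cartierD -card_scalar_exp cartierZ mulrDr mulrCA card_scalar_exp.
- move=> /(mons_frob k)[a [b [ha hb ->]]]; rewrite cartierZ mulrCA.
  by apply: RdM; [exact: kspan_mem|exact: hm].
Qed.

Lemma good_ex (Z : seq L) : exists c D, good D c /\ forall z, z \in Z -> bdd D c 1 z.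
Proof.
have [c [D [D0 hD hZ]]] := common_denom (Z ++ [seq psi m | m <- mons X q.-1]).
exists c.+1, D; split.
  split=> // m hm; apply: (Rd_le (leqnSn c)).
  by apply: hZ; rewrite mem_cat map_f ?orbT.
move=> z hz; rewrite /bdd /= muln1 expr1; apply: (Rd_le (leqnSn c)).
by apply: hZ; rewrite mem_cat hz.
Qed.

Lemma good_mul D c E e : good D c -> E != 0 -> E \in Rd e ->
  good (D * E) (c + e) /\
  (forall N z, bdd D c N z -> bdd (D * E) (c + e) N z).
Proof.
move=> [D0 c0 hD hm] E0 hE; split.
  split=> [|||m /hm h]; rewrite ?mulf_neq0 ?addn_gt0 ?c0 //; last first.
    by rewrite mulrAC RdM.
  by rewrite -(prednK c0) addSn /= RdM.
move=> N z; rewrite /bdd /= exprMn mulrAC mulnDl => h.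
by rewrite RdM // RdX.
Qed.

Definition loc D c z := exists N, bdd D c N z.

Lemma locD D c x y : good D c -> loc D c x -> loc D c y -> loc D c (x + y).
Proof.
move=> gD [N hN] [N' hN']; exists (N + N')%N.
by apply: bddD; apply: bdd_le gD _ _; [exact: leq_addr|exact: hN|exact: leq_addl|exact: hN'].
Qed.
Lemma locM D c x y : loc D c x -> loc D c y -> loc D c (x * y).
Proof. by move=> [N hN] [N' hN']; exists (N + N')%N; apply: bddM. Qed.
Lemma loc_psi D c x : good D c -> loc D c x -> loc D c (psi x).
Proof. by move=> gD [N hN]; exists (N %/ q + 2)%N; apply: bdd_psi. Qed.
Lemma bdd_finite D c N : D != 0 -> exists V : seq L, forall z, bdd D c N z -> z \in V.
Proof.
move=> D0; exists [seq r / D ^+ N | r <- Rd (c * N)%N] => z hz.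
by apply/mapP; exists (D ^+ N * z) => //; rewrite mulrC mulKf ?expf_neq0.
Qed.

(* After inverting the finitely many numerators of elements of [bdd D c N],    *)
(* all these elements become units of the localization.                        *)
Lemma invert_bdd D c N : good D c -> exists c1 D1, [/\ good D1 c1,
  forall N' z, bdd D c N' z -> bdd D1 c1 N' z &
  forall u z, u != 0 -> bdd D c N u -> loc D1 c1 (u * z) -> loc D1 c1 z].
Proof.
move=> gD; have [D0 _ _ _] := gD; have hD := good_Rd gD.
pose l := [seq r <- Rd (c * N)%N | r != 0].
have lR r : r \in l -> r \in Rd (c * N)%N /\ r != 0.
  by rewrite mem_filter => /andP[].
have Rprod (s : seq L) : {subset s <= l} ->
    \prod_(x <- s) x \in Rd (c * N * size s)%N.
  elim: s => [|x s IH] sl; first by rewrite big_nil Rd1.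
  rewrite big_cons /= mulnS RdM //; first by have [] := lR x (sl _ (mem_head _ _)).
  by apply: IH => y hy; apply: sl; rewrite inE hy orbT.
pose E := \prod_(x <- l) x.
have E0 : E != 0 by rewrite /E prodf_seq_neq0; apply/allP => x /lR[].
pose e1 := (c * N + c * N * size l)%N.
have hE1 : E \in Rd e1 by apply: Rd_le (Rprod l _); rewrite ?leq_addl.
have [g1 b1] := good_mul gD E0 hE1.
exists (c + e1)%N, (D * E); split=> // u z u0 hu huz.
pose r := D ^+ N * u.
have r0 : r != 0 by rewrite mulf_neq0 ?expf_neq0.
have rl : r \in l by rewrite mem_filter r0.
pose r' := \prod_(x <- rem r l) x.
have rE : E = r * r' by rewrite /E (big_rem r).
have hr' : r' \in Rd (c * N * size l)%N.
  apply: (Rd_le _ (Rprod _ _)); last by move=> x; apply: mem_rem.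
  by rewrite leq_mul2l size_rem // leq_pred orbT.
have r'0 : r' != 0 by apply: contraNneq E0; rewrite rE => ->; rewrite mulr0.
have -> : z = D ^+ N * r' / E * (u * z).
  by rewrite rE /r; field; rewrite u0 r'0 expf_neq0.
apply: locM => //; exists 1%N; rewrite /bdd /= expr1 muln1.
have -> : D * E * (D ^+ N * r' / E) = D * (D ^+ N * r') by field.
by apply/RdM/RdM/hr'/RdX.
Qed.

End Contraction.
End Cartier.

(** * Finiteness of bounded orbits *)

Section Attractor.
Variables (k : finFieldType) (L : fieldType) (kL : {rmorphism k -> L}).
Hypothesis hL : finitely_generated_field L.
Local Notation q := #|k|.

Lemma leq_divq N : (N %/ q <= N %/ 2)%N.
Proof. by apply: leq_div2l => //; apply: card_gt1. Qed.

(** Otherwise psi would vanish on L z, which contains 1, because the monomials span L over L^q. *)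
Lemma cartier_neq0 X psi z :
  (forall S : {pred L}, divring_closed S -> {subset X <= S} -> forall x, x \in S) ->
  cartier k psi -> psi 1 = 1 -> z != 0 ->
  exists2 m, m \in mons X q.-1 & psi (m * z) != 0.
Proof.
move=> hX hpsi psi1 z0; apply: contrapT => nm.
have h m : m \in mons X q.-1 -> psi (m * z) = 0.
  by move=> hm; apply/eqP; apply: contrapT => /negP n0; apply: nm; exists m.
suff : psi (z^-1 * z) = 0 by rewrite mulVf // psi1 => /eqP; rewrite oner_eq0.
have [r [hr ->]] := frob_span kL hX z^-1.
rewrite mulr_suml (cartier_sum hpsi) big_seq big1 // => t ht.
by rewrite -mulrA (cartierZ hpsi) h ?mulr0 //; apply: (allP hr).
Qed.

(* If h and h y are bounded and y = y' ^ q, then h' = psi (m h) and h' y' are   *)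
(* bounded with halved exponents, hence end up in a fixed finite set.           *)
Lemma root_chain_finite : exists V : seq L, forall y : nat -> L,
  (forall m, y m = y m.+1 ^+ q) -> exists m0, forall m, (m0 <= m)%N -> y m \in V.
Proof.
have [X hX] := hL.
have [psi hpsi [psi1 _]] := cartier_exists kL hX (T := 0) (or_intror erefl).
have [c [D [gD hm]]] := good_ex kL hX psi (mons X q.-1).
have [D0 _ _ _] := gD.
have [V hV] := bdd_finite kL X c 5 D0.
exists [seq u / v | u <- V, v <- V] => y hy.
have [d [a [b [ha hb b0 ey]]]] := Rd_frac kL hX (y 0%N).
have H m : exists2 h, h != 0 & bdd kL X D c (maxn 5 (d - m)) h /\
    bdd kL X D c (maxn 5 (d - m)) (h * y m).
  elim: m => [|m [h h0 [hh hhy]]].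
    exists b => //; rewrite subn0 ey mulrC divfK //.
    by split; apply: (bdd_le gD (leq_maxr _ _)); apply: (bdd_Rd gD).
  have [x hx nz] := cartier_neq0 hX hpsi psi1 h0.
  exists (psi (x * h)) => //.
  (* 5 is the largest fixed point of N -> (N + 1) / 2 + 2 for integer division, so larger exponents
     drop at every step. *)
  have le : (((1 + maxn 5 (d - m)) %/ q + 2) <= maxn 5 (d - m.+1))%N.
    have := leq_divq (1 + maxn 5 (d - m)); lia.
  split; first by apply: (bdd_le gD le); apply/(bdd_psi hpsi gD)/bddM/hh/hm.
  have -> : psi (x * h) * y m.+1 = psi (x * (h * y m)).
    by rewrite (hy m) mulrA [x * h * (_ ^+ _)]mulrC (cartierZ hpsi) mulrC.
  by apply: (bdd_le gD le); apply/(bdd_psi hpsi gD)/bddM/hhy/hm.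
exists d => m dm; have [h h0 []] := H m.
rewrite (_ : (d - m = 0)%N) ?maxn0 => [/hV h1 /hV h2|]; last by apply/eqP.
by apply/allpairsP; exists (h * y m, h); split=> //=; rewrite mulrC mulKf.
Qed.

(** An infinite chain of successive q-th roots of x would end in a finite set, repeat an element and
    make x periodic under Frobenius. *)
Lemma not_inf_divisible (x : L) : (forall r, x ^+ (q ^ r.+1) != x) ->
  exists m T, x = T ^+ (q ^ m) /\ forall a, T != a ^+ q.
Proof.
move=> nper; apply: contrapT => H.
have [V hV] := root_chain_finite.
have ex m : exists T, x = T ^+ (q ^ m).
  elim: m => [|m [T eT]]; first by exists x; rewrite expn0 expr1.
  apply: contrapT => nT; apply: H; exists m, T; split=> // a; apply/eqP => ea.
  by apply: nT; exists a; rewrite expnS exprM -ea.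
have [y hy] := choice ex.
have [m0 hm0] : exists m0, forall m, (m0 <= m)%N -> y m \in V.
  apply: hV => m; apply: (@frob_inj _ _ kL m) => /=.
  by rewrite -hy -exprM -expnS -hy.
suff [a [b [ab e]]] : exists a b, (a < b)%N /\ y a = y b.
  have eb : y b ^+ (q ^ (b - a)) = y b.
    apply: (@frob_inj _ _ kL a) => /=.
    by rewrite -exprM -expnD subnK ?(ltnW ab) // -hy -e -hy.
  have /eqP := nper (b - a).-1; apply; rewrite prednK ?subn_gt0 // (hy b).
  by rewrite -exprM mulnC exprM eb.
have [a [b [ab e]]] := pigeonhole (fun i => hm0 _ (leq_addr i m0)).
by exists (m0 + a)%N, (m0 + b)%N; rewrite ltn_add2l.
Qed.

(** The q-th root of a periodic c is c^(q^r), so c starts a chain of roots; this chain is itself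
    periodic and keeps returning to c. *)
Lemma constants_finite : exists V : seq L, forall (c : L) r,
  c ^+ (q ^ r.+1) = c -> c \in V.
Proof.
have [V hV] := root_chain_finite; exists V => c r cr.
have per n : c ^+ (q ^ (r.+1 * n)) = c.
  elim: n => [|n IH]; first by rewrite muln0 expn0 expr1.
  by rewrite mulnS addnC expnD exprM IH cr.
have [m|m0 hm0] := hV (fun m => c ^+ (q ^ (r * m))).
  rewrite -exprM -expnSr mulnS -addSn expnD exprM; congr (_ ^+ _).
  by rewrite cr.
have := hm0 (r.+1 * m0)%N; rewrite mulnCA per; apply.
by rewrite leq_pmull.
Qed.

(** V is chosen before the system and depends only on L, T and the finite set C of coefficients. The
    proof is an induction on the weight: [prv] and [terms] lead to lower weights, already bounded,
    while [nxt] keeps the weight and runs through a periodic orbit. Along this orbit the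
    denominators are first confined to powers of D1 ([locs]); then psi contracts the exponents
    ([rec]). *)
Lemma sys_finite (C : seq L) (T : L) : (forall a, T != a ^+ q) -> exists V : seq L,
  forall (I : Type) (wt : I -> int) (nxt prv : I -> I) (n : nat)
    (s kap : I -> L) (terms : I -> seq (L * I)) (w0 : int),
  (forall x, wt x < w0 -> s x = 0) ->
  (forall x, wt (nxt x) = wt x) -> (forall x, wt (prv x) < wt x) ->
  (forall x, iter n.+1 nxt x = x) ->
  (forall x, [/\ kap x \in C, (kap x)^-1 \in C & kap x != 0]) ->
  (forall x t, List.In t (terms x) -> t.1 \in C /\ wt t.2 < wt x) ->
  (forall x, s x ^+ q - T * s (prv x) ^+ q =
     kap x * s (nxt x) + \sum_(t <- terms x) t.1 * s t.2) ->
  forall x, s x \in V.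
Proof.
move=> hT; have [X hX] := hL.
have [psi hpsi [psi1 psiT]] := cartier_exists kL hX (T := T) (or_introl hT).
have [c0 [D0 [g0 hZ]]] := good_ex kL hX psi (mons X q.-1 ++ T :: C).
(* 6 is where the exponents of the multipliers h in [locs] stop, the largest fixed point of N -> (N
   + 2) / 2 + 2. Inverting everything bounded by 6 allows division by h afterwards. *)
have [c1 [D1 [g1 b01 inv]]] := invert_bdd 6 g0.
have [D1n _ _ _] := g1.
have [V hV] := bdd_finite kL X c1 5 D1n.
exists V => I wt nxt prv n s kap terms w0 s0 wn wp per hk ht sys.
have hC a : a \in C -> bdd kL X D0 c0 1 a.
  by move=> ha; apply: hZ; rewrite mem_cat inE ha !orbT.
have C1 a : a \in C -> bdd kL X D1 c1 1 a by move=> /hC/b01.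
have hm m : m \in mons X q.-1 -> bdd kL X D0 c0 1 m.
  by move=> h; apply: hZ; rewrite mem_cat h.
have T1 : bdd kL X D1 c1 1 T by apply/b01/hZ; rewrite mem_cat mem_head orbT.
suff H N x : `|wt x - w0|%N = N -> bdd kL X D1 c1 5 (s x) by move=> x; apply/hV/(H _ _ erefl).
move: x; have [m] := ubnP N; elim: m N => // m IHm N lt x eN.
have [xw|wx] := ltP (wt x) w0; first by rewrite s0 //; apply: bdd0.
have small y : wt y < wt x -> bdd kL X D1 c1 5 (s y).
  move=> yx; have [yw|wy] := ltP (wt y) w0; first by rewrite s0 //; apply: bdd0.
  by apply: (IHm `|wt y - w0|%N) => //; lia.
have wtn y j : wt (iter j nxt y) = wt y by elim: j => //= j IH; rewrite wn.
have rest y : wt y = wt x -> bdd kL X D1 c1 6 (\sum_(t <- terms y) t.1 * s t.2).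
  move=> yx; apply: bdd_sum => t /ht[tC tw].
  by apply: (bddM (N := 1) (N' := 5)); [exact: C1|apply: small; rewrite -yx].
(* A denominator b of s y is moved around the periodic orbit of y by h := psi (m h), *)
(* which brings it into a fixed finite set by the time it returns to y.              *)
have locs y : wt y = wt x -> loc kL X D1 c1 (s y).
  move=> yx; have [d [a [b [ha hb bn0 ey]]]] := Rd_frac kL hX (s y).
  have H j : (j <= n.+1 * d)%N -> exists2 h, h != 0 &
      bdd kL X D0 c0 (maxn 6 (d - j)) h /\
      loc kL X D1 c1 (h * s (iter (n.+1 * d - j) nxt y)).
    elim: j => [_|j IH jd].
      exists b => //; rewrite !subn0; split.
        by apply: (bdd_le g0 (leq_maxr _ _)); apply: (bdd_Rd g0).
      have -> : iter (n.+1 * d) nxt y = y.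
        by elim: (d) => [|e IHe]; rewrite ?muln0 // mulnS iterD IHe per.
      by rewrite ey mulrC divfK //; exists d; apply/b01/(bdd_Rd g0).
    have [h h0 [hh hhs]] := IH (ltnW jd).
    move: hhs; rewrite (_ : (n.+1 * d - j = (n.+1 * d - j.+1).+1)%N); last by lia.
    set z := iter (n.+1 * d - j.+1) nxt y; rewrite iterS -/z => hhs.
    have zx : wt z = wt x by rewrite wtn.
    have [_ kV k0] := hk z.
    have hk0 : h * (kap z)^-1 != 0 by rewrite mulf_neq0 ?invr_eq0.
    have [m' hm' nz] := cartier_neq0 hX hpsi psi1 hk0.
    exists (psi (m' * (h * (kap z)^-1))) => //; split.
      have le : ((1 + (maxn 6 (d - j) + 1)) %/ q + 2 <= maxn 6 (d - j.+1))%N.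
        have := leq_divq (1 + (maxn 6 (d - j) + 1)); lia.
      apply: (bdd_le g0 le); apply/(bdd_psi hpsi g0)/bddM; first exact: hm.
      by apply: bddM => //; apply: hC.
    set u := m' * (h * (kap z)^-1).
    have -> : psi u * s z =
        psi (m' * (h * s (nxt z))) +
        psi (u * (T * s (prv z) ^+ q + \sum_(t <- terms z) t.1 * s t.2)).
      rewrite -(cartierD hpsi) mulrC -(cartierZ hpsi); congr psi.
      have -> : s z ^+ q = T * s (prv z) ^+ q +
          (kap z * s (nxt z) + \sum_(t <- terms z) t.1 * s t.2).
        by rewrite -sys addrC subrK.
      by rewrite /u; field.
    have locu : loc kL X D1 c1 u.
      apply: locM; first by exists 1%N; apply/b01/hm.
      apply: locM; last by exists 1%N; apply: C1.
      by exists (maxn 6 (d - j)); apply: b01.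
    apply: (locD g1); apply: (loc_psi hpsi g1).
      by apply: locM => //; exists 1%N; apply/b01/hm.
    apply: locM => //; apply: (locD g1); last by exists 6%N; apply: rest.
    apply: locM; first by exists 1%N.
    have lp : loc kL X D1 c1 (s (prv z)).
      by exists 5%N; apply: small; rewrite -zx; apply: wp.
    elim: q => [|e IHe]; last by rewrite exprS; apply: locM.
    rewrite expr0; exists 0%N; rewrite /bdd /= muln0 mulr1 expr0; exact: Rd1.
  have [h h0 [hh hhs]] := H (n.+1 * d)%N (leqnn _).
  rewrite subnn /= in hhs; apply: (inv h) => //.
  by rewrite (_ : maxn 6 (d - n.+1 * d) = 6) // in hh; lia.
(* When psi is applied to the system, psi 1 = 1 and psi T = 0 leave s y alone on the left. *)
have rec y : wt y = wt x -> s y = psi (kap y * s (nxt y) + \sum_(t <- terms y) t.1 * s t.2).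
  move=> yx; rewrite -sys.
  have -> : s y ^+ q - T * s (prv y) ^+ q = s y ^+ q * 1 + (- s (prv y)) ^+ q * T.
    have -> : (- s (prv y)) ^+ q = - s (prv y) ^+ q.
      by rewrite -sub0r (frob1B kL) expr0n -(prednK (ltnW (card_gt1 k))) sub0r.
    by ring.
  by rewrite (cartierD hpsi) !(cartierZ hpsi) psi1 psiT mulr0 addr0 mulr1.
(* One exponent serves the whole orbit of x because the orbit is finite; it is then lowered to 5 for
   all its elements simultaneously. *)
have [N0 hN0] : exists N0, forall j, bdd kL X D1 c1 N0 (s (iter j nxt x)).
  have [N0 hN0] : exists N0, forall j, (j <= n)%N -> bdd kL X D1 c1 N0 (s (iter j nxt x)).
    elim: (n) => [|e [N0 hN0]].
      have [N0 hN0] := locs x erefl; exists N0 => j.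
      by rewrite leqn0 => /eqP ->.
    have [N1 hN1] := locs (iter e.+1 nxt x) (wtn _ _).
    exists (N0 + N1)%N => j; rewrite leq_eqVlt => /predU1P[->|/hN0 h].
      by apply: (bdd_le g1 _ hN1); rewrite ?leq_addl.
    by apply: (bdd_le g1 _ h); rewrite ?leq_addr.
  exists N0 => j; rewrite (divn_eq j n.+1) iterD.
  have -> z : iter (j %/ n.+1 * n.+1) nxt z = z.
    by elim: (j %/ n.+1)%N => [|e IHe]; rewrite ?mul0n // mulSn addnC iterD per.
  by apply: hN0; rewrite -ltnS ltn_mod.
suff H j : forall i, bdd kL X D1 c1 (maxn 5 (N0 - j)) (s (iter i nxt x)).
  by have := H N0 0%N; rewrite subnn.
elim: j => [|j IH] i.
  by rewrite subn0; apply: (bdd_le g1 (leq_maxr _ _)).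
rewrite (rec _ (wtn _ _)).
have le : (((maxn 5 (N0 - j)).+1 %/ q + 2) <= maxn 5 (N0 - j.+1))%N.
  have := leq_divq (maxn 5 (N0 - j)).+1; lia.
apply: (bdd_le g1 le); apply: (bdd_psi hpsi g1); apply: bddD.
  rewrite -add1n; apply: bddM; first by apply: C1; case: (hk (iter i nxt x)).
  by rewrite -iterS.
by apply: (bdd_le g1 _ (rest _ (wtn _ _))); lia.
Qed.

End Attractor.

(** * Approximation by endomorphisms over L *)

Section Window.
Variables (k : finFieldType) (L : fieldType) (kL : {rmorphism k -> L}).
Variables (Lbar : closedFieldType) (LLbar : {rmorphism L -> Lbar}).

Local Notation kM := (LLbar \o kL : {rmorphism k -> Lbar}).
Local Notation lau := (laurent kM).
Local Notation Fr := (frobz kM).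
Local Notation q := #|k|.
Local Notation "c *^ g" := (lmonomial kM c 0 * g) (at level 40).

Lemma zero_cardX m : (0 : Lbar) ^+ (q ^ m) = 0.
Proof. by rewrite expr0n eqn0Ngt card_exp_gt0. Qed.
Lemma zero_card : (0 : Lbar) ^+ q = 0.
Proof. by have := zero_cardX 1; rewrite expn1. Qed.

Definition inL (x : Lbar) := exists c : L, x = LLbar c.

Lemma inL_id c : inL (LLbar c). Proof. by exists c. Qed.
Lemma inL1 : inL 1. Proof. by exists 1; rewrite rmorph1. Qed.
Lemma inL0 : inL 0. Proof. by exists 0; rewrite rmorph0. Qed.
Lemma inLB x y : inL x -> inL y -> inL (x - y).
Proof. by move=> [a ->] [b ->]; exists (a - b); rewrite rmorphB. Qed.
Lemma inLD x y : inL x -> inL y -> inL (x + y).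
Proof. by move=> [a ->] [b ->]; exists (a + b); rewrite rmorphD. Qed.
Lemma inLM x y : inL x -> inL y -> inL (x * y).
Proof. by move=> [a ->] [b ->]; exists (a * b); rewrite rmorphM. Qed.
Lemma inLV x : inL x -> inL x^-1.
Proof. by move=> [a ->]; exists a^-1; rewrite fmorphV. Qed.
Lemma inLX x m : inL x -> inL (x ^+ m).
Proof. by move=> [a ->]; exists (a ^+ m); rewrite rmorphXn. Qed.
Lemma inL_sum I (r : seq I) (P : pred I) (F : I -> Lbar) :
  (forall x, P x -> inL (F x)) -> inL (\sum_(x <- r | P x) F x).
Proof. by move=> h; apply: big_ind => //; [exact: inL0|exact: inLD]. Qed.
Lemma inLMl a x : a != 0 -> inL a -> inL (a * x) -> inL x.
Proof. by move=> a0 ha /(inLM (inLV ha)); rewrite mulKf. Qed.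

(** Membership in L^perf, with powers of q in place of powers of the characteristic so as to fit
    [frobz]. *)
Definition inP (x : Lbar) := exists m, inL (x ^+ (q ^ m)).

Lemma inP_L x : inL x -> inP x.
Proof. by exists 0%N; rewrite expn0 expr1. Qed.
Lemma inP_add m x l : inL (x ^+ (q ^ m)) -> inL (x ^+ (q ^ (m + l))).
Proof. by move=> h; rewrite expnD exprM; apply: inLX. Qed.
Lemma inP1 : inP 1. Proof. exact/inP_L/inL1. Qed.
Lemma inPB x y : inP x -> inP y -> inP (x - y).
Proof.
move=> [a ha] [b hb]; exists (a + b)%N; rewrite (qexpB kM).
by apply: inLB; [|rewrite addnC]; apply: inP_add.
Qed.
Lemma inPM x y : inP x -> inP y -> inP (x * y).
Proof.
move=> [a ha] [b hb]; exists (a + b)%N; rewrite exprMn.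
by apply: inLM; [|rewrite addnC]; apply: inP_add.
Qed.
Lemma inPV x : inP x -> inP x^-1.
Proof. by move=> [a ha]; exists a; rewrite exprVn; apply: inLV. Qed.
Lemma inPF i x : inP x -> inP (Fr i x).
Proof.
move=> [m hm]; have [a [b ->]] := int_nat2 i; exists (b + m)%N.
by rewrite expnD exprM frobzK -!exprM mulnC exprM; apply: inLX.
Qed.

Lemma inP_perf x : inP x -> in_perf LLbar x.
Proof.
move=> [m [y e]]; have [p p_pr pk] := finPcharP k.
have pL : p \in [pchar L] by rewrite (fmorph_pchar kL).
exists p, (logn p #|pPrimeCharType pk| * m)%N; split=> //; exists y.
by rewrite expnM -(card_pprimeChar pk).
Qed.

Lemma perf_inP x : in_perf LLbar x -> inP x.
Proof.
move=> [p [m [pL [y e]]]]; exists m.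
have [p' p'_pr pk] := finPcharP k.
have pL' : p' \in [pchar L] by rewrite (fmorph_pchar kL).
have ep : p' = p.
  by move: (pcharf_eq pL p'); rewrite (pL') => /esym/eqP.
rewrite {}ep in pk.
have : (p ^ m %| q ^ m)%N.
  apply: dvdn_exp2r; rewrite (card_pprimeChar pk) dvdn_exp //.
  have q1 := card_gt1 k; rewrite lt0n; apply: contraTneq q1 => e0.
  by rewrite (card_pprimeChar pk) e0 expn0.
move=> /dvdnP[c ->]; rewrite mulnC exprM e; apply: inLX.
exact: inL_id.
Qed.

(** y is purely inseparable over L and satisfies a separable equation over L. Concretely, the q^m-th
    power of the relation puts y^(q^m) in L as soon as y^(q^(m+1)) is in L. *)
Lemma perf_sep_inL (y c d : Lbar) n : inP y -> inL c -> inL d ->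
  d != 0 -> inL (c * y ^+ (q ^ n.+1) - d * y) -> inL y.
Proof.
move=> [m ym] hc hd d0 h; elim: m ym => [|m IH] ym; first by rewrite expn0 expr1 in ym.
apply: IH; have := inLX (q ^ m) h.
rewrite (qexpB kM) !exprMn => h1.
have e : inL (c ^+ (q ^ m) * (y ^+ (q ^ n.+1)) ^+ (q ^ m)).
  apply/inLM; first exact: inLX.
  have -> : (y ^+ (q ^ n.+1)) ^+ (q ^ m) = (y ^+ (q ^ m.+1)) ^+ (q ^ n).
    by rewrite -!exprM -!expnD; congr (_ ^+ (_ ^ _)); lia.
  exact: inLX.
have := inLB e h1; rewrite opprB addrC subrK.
by apply: inLMl; [rewrite expf_neq0|exact: inLX].
Qed.

(** * The operator phi_t, here [phi], of degree n with coefficients [p] in L *)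

Variables (n' : nat) (p : nat -> L) (phi : lau).
Local Notation n := n'.+1.
Hypotheses (hphi : lpoly phi n) (hp : forall m : nat, phi m%:Z = LLbar (p m))
  (pn : p n != 0).

Lemma phi_n0 : phi n%:Z != 0. Proof. by rewrite hp fmorph_eq0. Qed.
Lemma phi_neq0 : phi != 0.
Proof. by apply: contraNneq phi_n0 => ->; rewrite lcoef0. Qed.
Lemma phi_unit : phi \is a GRing.unit. Proof. by rewrite lau_unitE phi_neq0. Qed.
Lemma phi_ldeg : ldeg phi = n%:Z.
Proof. by apply: ldeg_uniq; [exact: phi_n0|exact: lpoly_ldle]. Qed.
Lemma ldle_phi_phi : ldle phi n%:Z. Proof. exact: lpoly_ldle. Qed.

Lemma ldle_mulphi (g : lau) a : ldle (g * phi) a -> ldle g (a - n%:Z).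
Proof.
move=> h; have [->|g0] := eqVneq g 0; first exact: ldle0.
have [gp e] := ldegM g0 phi_neq0; have := ldle_ltdeg gp h.
rewrite e phi_ldeg => le; have [_ hg] := ldegP g0; apply: ldle_trans hg _; lia.
Qed.

Lemma phi_expz_neq0 i : phi ^ i != 0.
Proof. by rewrite -lau_unitE unitrXz ?phi_unit. Qed.
Lemma phi_expzS i : phi ^ (i + 1) = phi ^ i * phi.
Proof. by rewrite exprzDr ?phi_unit // expr1z. Qed.
Lemma ldeg_phi_expz i : ldeg (phi ^ i) = n%:Z * i.
Proof.
have pos (m : nat) : ldeg (phi ^ m%:Z) = n%:Z * m%:Z.
  elim: m => [|m IH]; first by rewrite expr0z ldeg_mon ?oner_neq0 // mulr0.
  have -> : m.+1%:Z = m%:Z + 1 by lia.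
  rewrite phi_expzS; have [_ ->] := ldegM (phi_expz_neq0 m) phi_neq0.
  by rewrite IH phi_ldeg; lia.
case: i => m; first exact: pos.
rewrite NegzE -invr_expz ldegV ?phi_expz_neq0 // pos; lia.
Qed.

Lemma ldle_mul_phi_expz (g : lau) a i : ldle g a -> ldle (g * phi ^ i) (a + n%:Z * i).
Proof.
move=> hg; apply: ldleM => //; rewrite -ldeg_phi_expz.
by have [] := ldegP (phi_expz_neq0 i).
Qed.

Lemma mon_comm a b (g : lau) : a *^ (b *^ g) = b *^ (a *^ g).
Proof. by rewrite !mulrA !lmonomialM !frobz0 mulrC. Qed.
Lemma monM a b (g : lau) : a *^ (b *^ g) = (a * b) *^ g.
Proof. by rewrite !mulrA !lmonomialM !frobz0. Qed.
Lemma mon1 (g : lau) : 1 *^ g = g. Proof. exact: mul1r. Qed.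
Lemma monE a (g : lau) i : (a *^ g) i = a * g i.
Proof. by rewrite lcoefM_monl frobz0 subr0. Qed.
Lemma monBl a b (g : lau) : (a - b) *^ g = a *^ g - b *^ g.
Proof. by apply: lauP => i; rewrite lcoefB !monE mulrBl. Qed.
Lemma tau_mon a (g : lau) : tau kM * (a *^ g) = (a ^+ q) *^ (tau kM * g).
Proof.
rewrite !mulrA !lmonomialM !rmorph1 mulr1 mul1r addr0 add0r.
by rewrite /= expn1.
Qed.
Lemma tauE (g : lau) i : (tau kM * g) i = g (i - 1) ^+ q.
Proof. by rewrite lcoefM_monl mul1r /= expn1. Qed.

Section Rational.
Variables (f : lau).
Hypotheses (fperf : forall i, inP (f i)) (fphi : f * phi = phi * f).

(** Degree j + n of f phi = phi f is a separable equation for f_j over the higher coefficients. Its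
    q^r-th power has coefficients in L when j + r >= 0, and [perf_sep_inL] applies. For r = 0 this
    puts the coefficients of nonnegative degree in L. *)
Lemma comm_coef_inL j r : 0 <= j + r%:Z -> inL (f j ^+ (q ^ r)).
Proof.
elim/(@lcoef_ind _ _ _ f): j r => [j -> r _|j IH r jr].
  by rewrite expr0n; case: eqP => _; [exact: inL1|exact: inL0].
have hFr (i : int) (l : nat) : 0 <= i + r%:Z -> inL (Fr i (phi l%:Z) ^+ (q ^ r)).
  move=> ir; rewrite hp -[_ ^+ _]/(Fr r%:Z _) -frobzD.
  have -> : r%:Z + i = `|(r%:Z + i)%R|%N%:Z by lia.
  exact/inLX/inL_id.
have e : (\sum_(l < n.+1) f (j + n%:Z - l%:Z) * Fr (j + n%:Z - l%:Z) (phi l%:Z)) =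
   \sum_(l < n.+1) phi l%:Z * f (j + n%:Z - l%:Z) ^+ (q ^ l).
  by rewrite -lcoefM_polyr // -lcoefM_polyl // fphi.
move/(congr1 (fun x => x ^+ (q ^ r))): e.
have XS (F : 'I_n.+1 -> Lbar) : (\sum_(l < n.+1) F l) ^+ (q ^ r) = \sum_(l < n.+1) F l ^+ (q ^ r).
  apply: (big_morph (fun x => x ^+ (q ^ r))); first exact: (qexpD kM).
  exact: zero_cardX.
cbv beta; rewrite !XS big_ord_recr [in X in _ = X -> _]big_ord_recr /=.
have -> : j + n%:Z - n%:Z = j by lia.
rewrite !exprMn => e.
have hl (l : 'I_n) : j < j + n%:Z - l%:Z by case: l => l /= ?; lia.
apply: (@perf_sep_inL _ (phi n%:Z ^+ (q ^ r)) (Fr j (phi n%:Z) ^+ (q ^ r)) n').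
- by have [m hm] := fperf j; exists m; rewrite -exprM mulnC exprM; apply: inLX.
- by rewrite hp; apply/inLX/inL_id.
- exact: hFr.
- by rewrite expf_neq0 // fmorph_eq0 phi_n0.
rewrite [Fr j _ ^+ _ * _]mulrC.
have -> : (f j ^+ (q ^ r)) ^+ (q ^ n) = (f j ^+ (q ^ n)) ^+ (q ^ r).
  by rewrite -!exprM mulnC.
rewrite -[X in X - _](addKr (\sum_(l < n) (phi l%:Z * f (j + n%:Z - l%:Z) ^+ (q ^ l)) ^+ (q ^ r))).
rewrite -e addrA addrK addrC; apply: inLB; apply: inL_sum => l _; rewrite exprMn.
  apply: inLM; first by apply: IH (hl l) _ _; have := hl l; lia.
  by apply: hFr; have := hl l; lia.
rewrite hp; apply: inLM; first exact/inLX/inL_id.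
by rewrite -exprM mulnC exprM; apply/inLX/(IH _ (hl l)); have := hl l; lia.
Qed.

End Rational.

Definition posL (g : lau) := forall i : int, 0 <= i -> inL (g i).

Definition pcomm (f : lau) := (forall i, inP (f i)) /\ f * phi = phi * f.

Lemma phi_inP i : inP (phi i).
Proof.
have [i0|i0] := ltP i 0; first by rewrite hphi; [exact/inP_L/inL0|left].
by have -> : i = `|i|%N%:Z; [lia|rewrite hp; apply/inP_L/inL_id].
Qed.

Lemma pcomm_phi f : pcomm f -> pcomm (f * phi).
Proof.
move=> [fp fc]; split; last by rewrite {1}fc mulrA.
by apply: (lcoefs_inM inP1 inPB inPM inPF) => // i; apply: phi_inP.
Qed.

Lemma posL_tau f l : pcomm f -> posL (tau kM ^+ l * f).
Proof.
move=> [fp fc] i i0; rewrite -[tau kM ^+ l]/(tau kM ^ l%:Z) tau_exp lcoefM_monl mul1r.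
by apply: comm_coef_inL => //; lia.
Qed.

Lemma posLB g h : posL g -> posL h -> posL (g - h).
Proof. by move=> hg hh i i0; apply: inLB; [exact: hg|exact: hh]. Qed.
Lemma posL_mon a g : inL a -> posL g -> posL (a *^ g).
Proof. by move=> ha hg i i0; rewrite monE; apply: inLM => //; apply: hg. Qed.

Local Notation pos := (ltrunc (-1)).

Lemma pos_tau (g : lau) : pos (tau kM * g) = tau kM * pos g + lmonomial kM (g (-1) ^+ q) 0.
Proof.
apply: lauP => i; rewrite lcoefD ltruncE !tauE ltruncE /=.
have z0 := zero_card.
have [->|i0] := eqVneq i 0; first by rewrite sub0r ltxx z0 add0r ltrN10.
rewrite addr0; have [h|h] := ltP (-1) i.
  by have -> : -1 < i - 1 by lia.
by have -> : (-1 < i - 1) = false; [lia|rewrite z0].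
Qed.

(** The failure of truncation to commute with right multiplication by [phi]. It depends only on the
    coefficients of g in degrees -n to -1 and lives in degrees 0 to n - 1. It is not the
    representation [rho_inf]. *)
Definition rho (g : lau) : lau := pos (g * phi) - pos g * phi.

Lemma rhoB g h : rho (g - h) = rho g - rho h.
Proof. by rewrite /rho mulrBl !ltruncB mulrBl !opprD addrACA. Qed.
Lemma rhoD g h : rho (g + h) = rho g + rho h.
Proof. by rewrite /rho mulrDl !ltruncD mulrDl opprD addrACA. Qed.
Lemma rho_mon a g : rho (a *^ g) = a *^ rho g.
Proof. by rewrite /rho -mulrA !ltrunc_monl -mulrA mulrBr. Qed.
Lemma rho_sum I (r : seq I) (P : pred I) (F : I -> lau) :
  rho (\sum_(x <- r | P x) F x) = \sum_(x <- r | P x) rho (F x).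
Proof. by rewrite /rho mulr_suml !ltrunc_sum mulr_suml -sumrB. Qed.
Lemma rho_small g a : ldle g a -> a + n%:Z <= -1 -> rho g = 0.
Proof.
move=> hg an; rewrite /rho !ltrunc_small ?mul0r ?subr0 //.
  by apply: ldle_trans hg _; lia.
by apply: ldle_trans an; apply: ldleM hg ldle_phi_phi.
Qed.

Lemma lpolyM_neg (g h : lau) i : (forall i : int, i < 0 -> g i = 0) ->
  (forall i : int, i < 0 -> h i = 0) -> i < 0 -> (g * h) i = 0.
Proof.
move=> hg hh i0; rewrite lcoefM; apply: fsbig1 => j _.
have [j0|j0] := ltP j 0; first by rewrite hg ?mul0r.
by rewrite hh ?rmorph0 ?mulr0 //; lia.
Qed.

Lemma pos_neg (g : lau) i : i < 0 -> pos g i = 0.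
Proof. by move=> i0; rewrite ltruncE; have -> : (-1 < i) = false by lia. Qed.

Lemma rho_supp g i : i < 0 \/ n%:Z <= i -> rho g i = 0.
Proof.
case=> hi.
  rewrite /rho lcoefB pos_neg // lpolyM_neg ?subr0 // => j j0; first exact: pos_neg.
  by apply: hphi; left.
have e : rho g i = ((g - pos g) * phi) i.
  by rewrite mulrBl /rho !lcoefB ltruncE; have -> : -1 < i by lia.
rewrite e; apply: (ldleM (a := -1) (b := n%:Z)); last by lia.
  exact: ltrunc_rest.
exact: ldle_phi_phi.
Qed.

Lemma rho_inL g i : posL g -> posL (g * phi) -> inL (rho g i).
Proof.
move=> hg hgp; have [i0|i0] := ltP i 0; first by rewrite rho_supp; [exact: inL0|left].
rewrite /rho lcoefB ltruncE; have -> : -1 < i by lia.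
apply: inLB; first exact: hgp.
rewrite (lcoefM_polyr _ _ hphi); apply: inL_sum => m _; rewrite ltruncE.
case: ifP => h; last by rewrite mul0r; apply: inL0.
apply: inLM; first by apply: hg; lia.
have -> : i - m%:Z = `|(i - m%:Z)%R|%N%:Z by lia.
by rewrite hp; apply/inLX/inL_id.
Qed.

Lemma rho_tau g : rho (tau kM * g) = tau kM * rho g +
  lmonomial kM ((g * phi) (-1) ^+ q) 0 - (g (-1) ^+ q) *^ phi.
Proof.
rewrite /rho -mulrA !pos_tau mulrDl mulrBr mulrA; set a := tau kM * pos (g * phi).
by rewrite opprD addrA; congr (_ - _); rewrite addrAC.
Qed.

Lemma rho_top g : rho g n'%:Z ^+ q = phi n%:Z * g (-1) ^+ q.
Proof.
have := congr1 (fun h : lau => h n%:Z) (rho_tau g).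
rewrite rho_supp; last by right.
rewrite lcoefB lcoefD tauE monE /= addr0.
have -> : n%:Z - 1 = n'%:Z by lia.
by move/esym/eqP; rewrite subr_eq0 mulrC => /eqP.
Qed.

Lemma rho_tauS g j : rho (tau kM * g) j.+1%:Z =
  rho g j%:Z ^+ q - g (-1) ^+ q * phi j.+1%:Z.
Proof.
rewrite rho_tau lcoefB lcoefD tauE monE /= addr0.
by have -> : j.+1%:Z - 1 = j%:Z by lia.
Qed.

Lemma rho_tau0 g : rho (tau kM * g) 0 = (g * phi) (-1) ^+ q - g (-1) ^+ q * phi 0.
Proof.
rewrite rho_tau lcoefB lcoefD tauE monE [rho g _]rho_supp; last by left.
by rewrite /= zero_card add0r.
Qed.

(* multiplication by (t - a)(t - a^q)...(t - a^(q^(m-1))) for the action of     *)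
(* L[t] in which t acts by right multiplication by phi                          *)
Definition tsub a (g : lau) : lau := g * phi - a *^ g.
Fixpoint wmul m a (g : lau) : lau :=
  if m is m'.+1 then tsub a (wmul m' (a ^+ q) g) else g.

Lemma pos_tsub a g : pos (tsub a g) = pos (g * phi) - a *^ pos g.
Proof. by rewrite ltruncB ltrunc_monl. Qed.
Lemma tsubC a b g : tsub a (tsub b g) = tsub b (tsub a g).
Proof.
rewrite /tsub !mulrBl !mulrBr !mulrA !lmonomialM !frobz0 [b * a]mulrC.
by rewrite !opprD addrACA.
Qed.
Lemma tsub_tau a g : tau kM * tsub a g = tsub (a ^+ q) (tau kM * g).
Proof. by rewrite /tsub mulrBr tau_mon !mulrA. Qed.
Lemma tsub_phi a g : tsub a g * phi = tsub a (g * phi).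
Proof. by rewrite /tsub mulrBl !mulrA. Qed.
Lemma tsub_mon a c g : tsub a (c *^ g) = c *^ tsub a g.
Proof. by rewrite /tsub mulrBr mon_comm !mulrA. Qed.
Lemma tsubB a g h : tsub a (g - h) = tsub a g - tsub a h.
Proof. by rewrite /tsub mulrBl mulrBr !opprD addrACA. Qed.
(** Right multiplication by [phi] raises the degree by n > 0 and multiplication by a does not, so t
    - a has no kernel. *)
Lemma tsub_inj a g : tsub a g = 0 -> g = 0.
Proof.
move=> /eqP; rewrite subr_eq0 => /eqP e.
apply: contrapT => /eqP g0; have [g1 hg] := ldegP g0.
have := lcoefM_top hg ldle_phi_phi; rewrite e monE hg ?mulr0; last by lia.
by move/esym/eqP; rewrite mulf_eq0 (negbTE g1) fmorph_eq0 (negbTE phi_n0).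
Qed.
Lemma tsub_sum a I (r : seq I) (P : pred I) (F : I -> lau) :
  tsub a (\sum_(x <- r | P x) F x) = \sum_(x <- r | P x) tsub a (F x).
Proof. by rewrite /tsub mulr_suml mulr_sumr -sumrB. Qed.

Lemma wmul_phi m a g : wmul m a g * phi = wmul m a (g * phi).
Proof. by elim: m a => //= m IH a; rewrite tsub_phi IH. Qed.
Lemma wmul_mon m a c g : wmul m a (c *^ g) = c *^ wmul m a g.
Proof. by elim: m a => //= m IH a; rewrite IH tsub_mon. Qed.
Lemma wmulB m a g h : wmul m a (g - h) = wmul m a g - wmul m a h.
Proof. by elim: m a => //= m IH a; rewrite IH tsubB. Qed.
Lemma wmul_sum m a I (r : seq I) (P : pred I) (F : I -> lau) :
  wmul m a (\sum_(x <- r | P x) F x) = \sum_(x <- r | P x) wmul m a (F x).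
Proof. by elim: m a => //= m IH a; rewrite IH tsub_sum. Qed.
Lemma wmul_phi_expz m a g i : wmul m a g * phi ^ i = wmul m a (g * phi ^ i).
Proof.
have posi (j : nat) h : wmul m a h * phi ^+ j = wmul m a (h * phi ^+ j).
  by elim: j h => [|j IH] h; rewrite ?mulr1 // !exprS !mulrA wmul_phi IH.
case: i => j; first exact: posi.
rewrite NegzE -exprnN.
have u : phi ^+ j.+1 \is a GRing.unit by rewrite unitrX ?phi_unit.
by apply: (mulIr u); rewrite mulrVK // posi mulrVK.
Qed.
(** Both sides are (t - a)(t - a^q)...(t - a^(q^m)) applied to tau g, because tau (t - b) = (t -
    b^q) tau. *)
Lemma wmul_tau m a g :
  tsub a (tau kM * wmul m a g) = tsub (a ^+ (q ^ m)) (wmul m a (tau kM * g)).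
Proof.
elim: m a => [|m IH] a /=; first by rewrite expn0 expr1.
by rewrite tsub_tau IH tsubC expnS exprM.
Qed.
Lemma ldle_wmul m a g N : ldle (wmul m a g) N -> ldle g N.
Proof.
elim: m a => //= m IH a h; apply: (IH (a ^+ q)).
set u := wmul m _ g in h *; have [->|u0] := eqVneq u 0; first exact: ldle0.
have [u1 hu] := ldegP u0; apply: (ldle_trans hu); rewrite leNgt; apply/negP => Nu.
have /eqP : tsub a u (ldeg u + n%:Z) = 0 by apply: h; lia.
rewrite /tsub lcoefB (lcoefM_top hu ldle_phi_phi) monE.
rewrite [X in a * X]hu ?mulr0 ?subr0; last by lia.
by rewrite mulf_eq0 (negbTE u1) fmorph_eq0 (negbTE phi_n0).
Qed.
Lemma posL_wmul m a f l : inL a -> pcomm f -> posL (wmul m a (tau kM ^+ l * f)).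
Proof.
elim: m a f => [|m IH] a f ha hf /=; first exact: posL_tau.
apply: posLB; last by apply/posL_mon/IH/hf/inLX.
by rewrite wmul_phi -mulrA; apply/IH/pcomm_phi/hf/inLX.
Qed.


Lemma pcomm_expz f i : pcomm f -> pcomm (f * phi ^ i).
Proof.
move=> [fp fc]; split; last first.
  have c1 : GRing.comm phi (f * phi ^ i).
    apply: commrM; first exact/esym.
    case: i => j; first exact/commrX/erefl.
    by rewrite NegzE -exprnN; apply/commrV/commrX.
  exact/esym.
apply: (lcoefs_inM inP1 inPB inPM inPF) => //.
have pX j : lcoefs_in inP (phi ^+ j).
  elim: j => [|j IH]; first exact: (lcoefs_in1 _ inP1 inPB).
  by rewrite exprS; apply: (lcoefs_inM inP1 inPB inPM inPF) => // l; apply: phi_inP.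
case: i => j; first exact: pX.
by rewrite NegzE -exprnN; apply: (lcoefs_inV inP1 inPB inPM inPV inPF).
Qed.

Lemma phi_sum : phi = \sum_(l < n.+1) LLbar (p l) *^ tau kM ^+ l.
Proof.
apply: lauP => i; rewrite lcoef_sum.
under eq_bigr do rewrite monE -[tau kM ^+ _]/(tau kM ^ (Posz _)) tau_exp /=.
have [[i0 iN]|ni] := pselect (0 <= i /\ i <= n%:Z).
  have h : (`|i| < n.+1)%N by lia.
  rewrite (bigD1 (Ordinal h)) //= big1 ?addr0.
    by rewrite gez0_abs // eqxx mulr1 -hp gez0_abs.
  move=> l /eqP nl; case: eqP => [e|_]; rewrite ?mulr0 //.
  by case: nl; apply: val_inj => /=; lia.
rewrite hphi; last by have [?|?] := ltP i 0; [left|right; rewrite ltNge; apply/negP => ?; apply: ni].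
rewrite big1 // => l _; case: eqP => [e|_]; rewrite ?mulr0 //.
by case: ni; rewrite e; case: (l) => /= ? ?; lia.
Qed.

(** * The triangular system over L and its consequences *)

Section System.
Hypothesis hL : finitely_generated_field L.
Variables (m : nat) (T : L).
Hypotheses (pT : p 0 = T ^+ (q ^ m)) (T_nroot : forall a, T != a ^+ q)
  (T_nper : forall r, T ^+ (q ^ r.+1) != T).
Local Notation t := (LLbar T).
Local Notation th := (LLbar (p 0)).

Definition zz l (f : lau) := wmul m t (tau kM ^+ l * f).

Lemma zz_tau l f : tsub t (tau kM * zz l f) = tsub th (zz l.+1 f).
Proof. by rewrite /zz wmul_tau exprS mulrA pT rmorphXn. Qed.

Lemma zz_phi_expz l f i : zz l f * phi ^ i = zz l (f * phi ^ i).
Proof. by rewrite /zz wmul_phi_expz mulrA. Qed.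

Lemma zz_phi l f : zz l f * phi = zz l (f * phi).
Proof. by rewrite /zz wmul_phi mulrA. Qed.

Lemma zz_sum f : f * phi = phi * f ->
  \sum_(l < n.+1) LLbar (p l) *^ zz l f = zz 0 f * phi.
Proof.
move=> fc; rewrite zz_phi fc {1}phi_sum mulr_suml /zz expr0 mul1r wmul_sum.
by apply: eq_bigr => l _; rewrite -mulrA wmul_mon.
Qed.

(** The unknowns of the system: l counts powers of tau, j degrees, and i powers of [phi]. *)
Definition Z f l j i := rho (zz l f * phi ^ i) (Posz j).

Lemma Z_small f l : exists i0 : int, forall i : int, i < i0 ->
  rho (zz l f * phi ^ i) = 0 /\ (zz l f * phi ^ i) (-1) = 0.
Proof.
have [N hN] := ldle_ex (zz l f); exists (- `|N| - 2) => i hi.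
have h := ldle_mul_phi_expz (i := i) hN.
by split; [apply: (rho_small h)|apply: h]; nia.
Qed.

(** This is [rho] applied to [zz_tau] times a power of [phi]. The formulas for rho (tau g) bring in
    the coefficient of degree -1 through c. In degree 0 they show that d - Z f l.+1 0 is multiplied
    by theta from one index to the next; being zero for very negative indices it vanishes, which
    eliminates c. *)
Lemma Z_eq f l j i : Z f l j (i + 1) ^+ q - t * Z f l j i ^+ q =
  Z f l.+1 j.+1 (i + 1) - th * Z f l.+1 j.+1 i + phi j.+1%:Z * Z f l.+1 0 i.
Proof.
pose g i := zz l f * phi ^ i; pose c i := (g i) (-1) ^+ q.
have gS a : g (a + 1) = g a * phi by rewrite /g phi_expzS mulrA.
have id a : tau kM * g (a + 1) - t *^ (tau kM * g a) =
    zz l.+1 f * phi ^ (a + 1) - th *^ (zz l.+1 f * phi ^ a).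
  have phC b : phi * phi ^ b = phi ^ b * phi by rewrite -phi_expzS addrC exprzDr ?phi_unit // expr1z.
  have := congr1 (fun h => h * phi ^ a) (zz_tau l f).
  rewrite /tsub !mulrBl -!mulrA !phC !mulrA => e.
  by rewrite /g !phi_expzS !mulrA.
have idj (b : nat) a : rho (tau kM * g (a + 1)) b%:Z - t * rho (tau kM * g a) b%:Z =
    Z f l.+1 b (a + 1) - th * Z f l.+1 b a.
  by rewrite /Z -!monE -!lcoefB -!rho_mon -!rhoB id.
have r0 a : rho (tau kM * g a) 0%N%:Z = c (a + 1) - c a * th.
  by rewrite rho_tau0 (hp 0) /c gS.
have rS a : rho (tau kM * g a) j.+1%:Z = Z f l j a ^+ q - c a * phi j.+1%:Z.
  by rewrite rho_tauS.
pose d a := c (a + 1) - t * c a.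
have e0 a : d (a + 1) - Z f l.+1 0 (a + 1) = th * (d a - Z f l.+1 0 a).
  have := idj 0%N a; rewrite !r0 => e.
  have eZ : Z f l.+1 0 (a + 1) = c (a + 1 + 1) - c (a + 1) * th -
      t * (c (a + 1) - c a * th) + th * Z f l.+1 0 a by rewrite e subrK.
  by rewrite eZ /d; ring.
have d0 a : d a = Z f l.+1 0 a.
  have [i1 h1] := Z_small f l; have [i2 h2] := Z_small f l.+1.
  pose i0 := - (`|i1| + `|i2|)%:Z - 2.
  have base b : b <= i0 -> d b - Z f l.+1 0 b = 0.
    move=> bi; rewrite /d /c /g /Z.
    have [_ ->] := h1 (b + 1) ltac:(rewrite /i0 in bi; lia).
    have [_ ->] := h1 b ltac:(rewrite /i0 in bi; lia).
    have [-> _] := h2 b ltac:(rewrite /i0 in bi; lia).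
    by rewrite zero_card mulr0 lcoef0 !subr0.
  apply/eqP; rewrite -subr_eq0; apply/eqP.
  have [le|lt] := leP a i0; first exact: base.
  have -> : a = i0 + `|(a - i0)%R|%N%:Z by lia.
  elim: `|(a - i0)%R|%N => [|b IH]; first by rewrite addr0 base.
  have -> : i0 + b.+1%:Z = i0 + b%:Z + 1 by lia.
  by rewrite e0 IH mulr0.
have := idj j.+1 i; rewrite !rS => <-.
by rewrite -d0 /d; ring.
Qed.

Lemma Z_inL f l j i : pcomm f -> inL (Z f l j i).
Proof.
move=> hf; have h1 := pcomm_expz i hf; rewrite /Z zz_phi_expz.
apply: rho_inL; first exact/posL_wmul/h1/inL_id.
by rewrite zz_phi; apply/posL_wmul/pcomm_phi/h1/inL_id.
Qed.

Lemma Z_sum f j i : pcomm f -> \sum_(l < n.+1) LLbar (p l) * Z f l j i = Z f 0 j (i + 1).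
Proof.
move=> [_ fc]; rewrite /Z phi_expzS.
have -> : zz 0 f * (phi ^ i * phi) = \sum_(l < n.+1) LLbar (p l) *^ (zz l f * phi ^ i).
  have -> : phi ^ i * phi = phi * phi ^ i by rewrite -phi_expzS addrC exprzDr ?phi_unit // expr1z.
  by rewrite mulrA -zz_sum // mulr_suml; apply: eq_bigr => l _; rewrite mulrA.
by rewrite rho_sum lcoef_sum; apply: eq_bigr => l _; rewrite rho_mon monE.
Qed.

(** V is chosen before f. The relation f phi = phi f, in the form [Z_sum], eliminates the unknowns
    with l = n, and those with j = n vanish; this closes the system on 0 <= l, j < n. *)
Lemma Z_finite : exists V : seq L, forall f, pcomm f -> forall l j i, (l < n)%N ->
  (j < n)%N -> exists2 c, c \in V & Z f l j i = LLbar c.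
Proof.
(* C collects all coefficients that the system can have after this elimination; they involve only
   the coefficients of [phi]. *)
pose A1 := 1 :: [seq p l | l <- iota 0 n.+1].
pose C2 := [seq a * b | a <- A1, b <- A1].
pose C3 := [seq a * c | a <- C2, c <- [:: 1; (p n)^-1]].
pose C := C3 ++ [seq - c | c <- C3].
have A1p l : (l <= n)%N -> p l \in A1.
  by move=> h; rewrite inE (map_f p) ?orbT // mem_iota.
have C31 a b : a \in A1 -> b \in A1 -> a * b \in C3.
  move=> ha hb; apply/allpairsP; exists (a * b, 1); rewrite /= mulr1 mem_head.
  by split=> //; apply/allpairsP; exists (a, b).
have C3n a b : a \in A1 -> b \in A1 -> a * b / p n \in C3.
  move=> ha hb; apply/allpairsP; exists (a * b, (p n)^-1); split=> //=.
    by apply/allpairsP; exists (a, b).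
  by rewrite !inE eqxx orbT.
have one : 1 \in A1 by rewrite mem_head.
clearbody A1 C3.
have CC c : c \in C3 -> c \in C by rewrite /C mem_cat => ->.
have CN c : c \in C3 -> - c \in C by move=> h; rewrite /C mem_cat (map_f -%R) ?orbT.
have a1 a : a \in A1 -> a \in C3 by move=> h; rewrite -[a]mulr1 C31.
have an a : a \in A1 -> a / p n \in C3 by move=> h; rewrite -[a]mulr1 C3n.
clearbody C; have pnV : (p n)^-1 \in C3 by rewrite -[_^-1]mul1r an.
have [V hV] := sys_finite kL hL C T_nroot.
exists V => f hf.
pose S l j i := xget 0 [set c | Z f l j i = LLbar c].
have SE l j i : LLbar (S l j i) = Z f l j i.
  by have [c hc] := Z_inL l j i hf; symmetry; apply: (xgetPex 0 (P := [set c | _ = LLbar c])); exists c.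
have Sn l i : S l n i = 0.
  by apply: (fmorph_inj LLbar); rewrite SE rmorph0 /Z rho_supp //; right.
have Seq l j i : S l j i ^+ q - T * S l j (i - 1) ^+ q =
    S l.+1 j.+1 i - p 0 * S l.+1 j.+1 (i - 1) + p j.+1 * S l.+1 0 (i - 1).
  apply: (fmorph_inj LLbar).
  rewrite !(rmorphB, rmorphD, rmorphM, rmorphXn) /= !SE.
  by have := Z_eq f l j (i - 1); rewrite subrK hp.
have Ssum j i : S n j i = (S 0 j (i + 1) - \sum_(l < n) p l * S l j i) / p n.
  apply: (mulIf pn); rewrite divfK //; apply: (fmorph_inj LLbar).
  have := Z_sum j i hf; rewrite big_ord_recr /=.
  rewrite rmorphB rmorphM /= !SE => <-.
  have -> : LLbar (\sum_(l < n) p l * S l j i) = \sum_(l < n) LLbar (p l) * Z f l j i.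
    by rewrite rmorph_sum; apply: eq_bigr => l _; rewrite rmorphM /= SE.
  by rewrite [RHS]addrC addKr mulrC.
have [nx nxP] : exists nx : 'I_n -> 'I_n, forall a, (nx a : nat) = (a.+1 %% n)%N.
  by exists (@ordS n).
pose I := ('I_n * 'I_n * int)%type.
(* The weight is preserved by (l, j, i) -> (l + 1, j + 1, i), and a wrap of l or j modulo n is
   compensated by a change of i. The other unknowns on the right of an equation have smaller
   weight. *)
pose wt (x : I) : int := let: (l, j, i) := x in n%:Z * i - (j : nat)%:Z + (l : nat)%:Z.
pose nxt (x : I) : I := let: (l, j, i) := x in
  (nx l, nx j, i + (l.+1 %/ n)%N%:Z - (j.+1 %/ n)%N%:Z).
pose prv (x : I) : I := let: (l, j, i) := x in (l, j, i - 1).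
pose s (x : I) : L := let: (l, j, i) := x in S l j i.
(* When j wraps around, the main term is the one with coefficient p_n; when l wraps around, the
   elimination of l = n divides by p_n. *)
pose kap (x : I) : L := let: (l, j, i) := x in
  (if (j.+1 < n)%N then 1 else p n) * (if (l.+1 < n)%N then 1 else (p n)^-1).
pose terms (x : I) : seq (L * I) := let: (l, j, i) := x in
  if (j.+1 < n)%N then
    if (l.+1 < n)%N then
      [:: (- p 0, (nx l, nx j, i - 1)); (p j.+1, (nx l, ord0, i - 1))]
    else [seq (- (p a / p n), (a, nx j, i)) | a : 'I_n <- enum 'I_n] ++
      [seq (p 0 * p a / p n, (a, nx j, i - 1)) | a : 'I_n <- enum 'I_n] ++
      [seq (- (p j.+1 * p a / p n), (a, ord0, i - 1)) | a : 'I_n <- enum 'I_n] ++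
      [:: (- (p 0 / p n), (ord0, nx j, i)); (p j.+1 / p n, (ord0, ord0, i))]
  else if (l.+1 < n)%N then [::]
  else [seq (- p a, (a, ord0, i - 1)) | a : 'I_n <- enum 'I_n].
have lastE (a : 'I_n) : (a.+1 < n)%N = false -> a.+1 = n.
  by move=> h; apply/eqP; rewrite eqn_leq ltn_ord leqNgt h.
have nxlt (a : 'I_n) : (a.+1 < n)%N -> (nx a : nat) = a.+1 /\ (a.+1 %/ n = 0)%N.
  by move=> h; rewrite nxP modn_small // divn_small.
have nxge (a : 'I_n) : (a.+1 < n)%N = false -> (nx a : nat) = 0%N /\ (a.+1 %/ n = 1)%N.
  by move=> /lastE e; rewrite nxP e modnn divnn.
have [i00 h00] : exists w0, forall x, wt x < w0 -> s x = 0.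
  have [i0 h0] : exists i0 : int, forall l i, (l < n)%N -> i < i0 -> rho (zz l f * phi ^ i) = 0.
    elim: n => [|b [i0 h0]]; first by exists 0.
    have [i1 h1] := Z_small f b; exists (- `|i0| - `|i1|) => l i.
    rewrite ltnS leq_eqVlt => /predU1P[->|lb] hi; first by have [] := h1 i ltac:(lia).
    by apply: h0 => //; lia.
  exists (n%:Z * i0 - n%:Z) => -[[l j] i] /= hw.
  apply: (fmorph_inj LLbar); rewrite SE rmorph0 /Z h0 ?ltn_ord //.
  have := ltn_ord j; move: hw; nia.
move=> l j i ln jn.
exists (S l j i); last by rewrite SE.
apply: (hV I wt nxt prv n' s kap terms i00 _ _ _ _ _ _ _ (Ordinal ln, Ordinal jn, i)) => //.
- move=> [[{ln}l {jn}j] {}i] /=.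
  case hl : (l.+1 < n)%N; case hj : (j.+1 < n)%N.
  + by have [-> ->] := nxlt l hl; have [-> ->] := nxlt j hj; lia.
  + have [-> ->] := nxlt l hl; have [-> ->] := nxge j hj; have := lastE _ hj; nia.
  + have [-> ->] := nxge l hl; have [-> ->] := nxlt j hj; have := lastE _ hl; nia.
  + have [-> ->] := nxge l hl; have [-> ->] := nxge j hj.
    by have := lastE _ hl; have := lastE _ hj; nia.
- by move=> [[a b] c] /=; nia.
- move=> [[a b] c].
  have it r : iter r nxt (a, b, c) = (inord ((a + r) %% n), inord ((b + r) %% n),
      c + ((a + r) %/ n)%N%:Z - ((b + r) %/ n)%N%:Z).
    elim: r => [|r IH].
      rewrite /= !addn0 !modn_small ?ltn_ord // !divn_small ?ltn_ord // !inord_val.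
      by congr (_, _); lia.
    rewrite iterS IH /nxt; congr (_, _, _).
    * apply: val_inj; rewrite /= nxP !inordK ?ltn_mod //.
      by rewrite -addn1 modnDml addn1 addnS.
    * apply: val_inj; rewrite /= nxP !inordK ?ltn_mod //.
      by rewrite -addn1 modnDml addn1 addnS.
    * rewrite !inordK ?ltn_mod //.
      have D (e : nat) : ((e + r.+1) %/ n = (e + r) %/ n + ((e + r) %% n).+1 %/ n)%N.
        by rewrite addnS {1}(divn_eq (e + r) n) -addnS divnMDl.
      rewrite !D; lia.
  rewrite it -[n'.+1]/n !modnDr !divnDr ?dvdnn // divnn.
  rewrite !modn_small ?ltn_ord // !divn_small ?ltn_ord // !inord_val.
  by congr (_, _); lia.
- move=> [[a b] c] /=; case: ifP => _; case: ifP => _; rewrite ?mul1r ?mulr1 ?invr1 ?invrK.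
  + by rewrite oner_neq0 CC ?a1.
  + by split; [exact: CC|exact/CC/a1/A1p|rewrite invr_eq0].
  + by split; [exact/CC/a1/A1p|exact: CC|exact: pn].
  + by rewrite mulfV // invr1 oner_neq0 CC ?a1.
- have inmap (G : 'I_n -> L * I) u : List.In u [seq G a | a <- enum 'I_n] -> exists a, u = G a.
    by elim: (enum _) => //= x r IH [<-|/IH //]; exists x.
  have incat (r1 r2 : seq (L * I)) u :
      List.In u (r1 ++ r2) -> List.In u r1 \/ List.In u r2.
    elim: r1 => [|x r1 IH] /=; first by right.
    by move=> [->|/IH[]]; [left; left|left; right|right].
  move=> [[a b] c] u; rewrite /terms.
  case hb : (b.+1 < n)%N; case ha : (a.+1 < n)%N.
  + have [ea _] := nxlt a ha; have [eb _] := nxlt b hb.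
    case=> [<-|[<-|//]]; rewrite /wt /=; split.
    * by rewrite CN ?a1 ?A1p.
    * rewrite ea eb; lia.
    * by rewrite CC ?a1 ?A1p // ltnW.
    * rewrite ea; lia.
  + have [eb _] := nxlt b hb; have ea := lastE _ ha.
    move=> /incat[/inmap[x ->]|/incat[/inmap[x ->]|/incat[/inmap[x ->]|]]].
    * split; first by rewrite CN ?an ?A1p // ltnW.
      rewrite /wt /= eb; have := ltn_ord x; lia.
    * split; first by rewrite CC ?C3n ?A1p // ltnW.
      rewrite /wt /= eb; have := ltn_ord x; lia.
    * split; first by rewrite CN ?C3n ?A1p // ltnW.
      rewrite /wt /=; have := ltn_ord x; lia.
    * case=> [<-|[<-|//]]; split.
      - by rewrite CN ?an ?A1p.
      - rewrite /wt /= eb; lia.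
      - by rewrite CC ?an ?A1p // ltnW.
      - rewrite /wt /=; lia.
  + by [].
  + move=> /inmap[x ->]; split; first by rewrite CN ?a1 ?A1p // ltnW.
    rewrite /wt /=; have := ltn_ord x; have := lastE _ ha; have := lastE _ hb; lia.
- have sumT (G : 'I_n -> L) (x : 'I_n -> I) e F :
      (forall a, G a * s (x a) = e * (p a * F a)) ->
      \sum_(u <- [seq (G a, x a) | a : 'I_n <- enum 'I_n]) u.1 * s u.2 =
      e * \sum_(a < n) p a * F a.
    by move=> h; rewrite big_map -big_enum mulr_sumr; apply: eq_bigr => a _; apply: h.
  move=> [[a b] c]; rewrite /prv /nxt /kap /terms.
  case hb : (b.+1 < n)%N; case ha : (a.+1 < n)%N.
  + have [ea ->] := nxlt a ha; have [eb ->] := nxlt b hb.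
    rewrite !big_cons big_nil /s /= Seq !ea !eb.
    by rewrite addr0 subr0; ring.
  + have [ea ->] := nxge a ha; have [eb ->] := nxlt b hb; have el := lastE _ ha.
    rewrite !big_cat !big_cons big_nil /=.
    rewrite (sumT _ _ (- (p n)^-1) (fun x => S x b.+1 c)) => [|?]; last by rewrite /s eb; ring.
    rewrite (sumT _ _ (p 0 / p n) (fun x => S x b.+1 (c - 1))) => [|?]; last by rewrite /s eb; ring.
    rewrite (sumT _ _ (- (p b.+1 / p n)) (fun x => S x 0%N (c - 1))) => [|?]; last by rewrite /s; ring.
    rewrite /s /= Seq !ea !eb el subr0 !Ssum subrK.
    by ring.
  + have [ea ->] := nxlt a ha; have [eb ->] := nxge b hb; have el := lastE _ hb.
    rewrite big_nil /s Seq !ea !eb el !Sn; have -> : c + 0%:Z - 1%:Z = c - 1 by lia.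
    by ring.
  + have [ea ->] := nxge a ha; have [eb ->] := nxge b hb.
    have el := lastE _ ha; have el' := lastE _ hb.
    rewrite (sumT _ _ (-1) (fun x => S x 0%N (c - 1))) => [|?]; last by rewrite /s; ring.
    rewrite /s Seq !ea !eb el el' !Sn Ssum subrK.
    have -> : c + 1%:Z - 1%:Z = c by lia.
    by rewrite mulfV //; field.
Qed.

Definition tpol (g : lau) := (forall i : int, i < 0 -> g i = 0) /\ (forall i, inL (g i)).

Lemma tpolB g h : tpol g -> tpol h -> tpol (g - h).
Proof.
move=> [g0 gL] [h0 hL']; split=> i; last by rewrite lcoefB; apply: inLB.
by move=> i0; rewrite lcoefB g0 ?h0 ?subr0.
Qed.
Lemma tpolD g h : tpol g -> tpol h -> tpol (g + h).
Proof.
move=> [g0 gL] [h0 hL']; split=> i; last by rewrite lcoefD; apply: inLD.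
by move=> i0; rewrite lcoefD g0 ?h0 ?addr0.
Qed.
Lemma tpol0 : tpol 0. Proof. by split=> // i; apply: inL0. Qed.
Lemma tpol_sum I (r : seq I) (P : pred I) (F : I -> lau) :
  (forall x, P x -> tpol (F x)) -> tpol (\sum_(x <- r | P x) F x).
Proof. by move=> h; apply: big_ind => //; [exact: tpol0|exact: tpolD]. Qed.
Lemma tpol_mon a g : inL a -> tpol g -> tpol (a *^ g).
Proof.
move=> ha [g0 gL]; split=> i; last by rewrite monE; apply: inLM.
by move=> i0; rewrite monE g0 ?mulr0.
Qed.
Lemma tpol_tau g : tpol g -> tpol (tau kM * g).
Proof.
move=> [g0 gL]; split=> i; last by rewrite tauE; apply: inLX.
by move=> i0; rewrite tauE g0 ?zero_card //; lia.
Qed.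
Lemma tpol_pos g : posL g -> tpol (pos g).
Proof.
move=> hg; split=> i; first exact: pos_neg.
by rewrite ltruncE; case: ifP => h; [apply: hg; lia|exact: inL0].
Qed.

Lemma tsub_diff a b g : tsub b g - tsub a g = (a - b) *^ g.
Proof. by rewrite monBl /tsub opprB addrC addrA subrK. Qed.

(** Division by W, one factor at a time. For r = 0, cancelling t - theta gives Zs l = tau^l Zs 0,
    and the sum relation says that Zs 0 commutes with [phi]. Otherwise t - A and t - theta differ by
    a nonzero constant b of L, so each Zs l is t - A times an explicit twisted polynomial Y l over
    L, and the Y l satisfy the same relations with A^q in place of A. *)
Lemma divide_w r A (Zs : nat -> lau) : p 0 = A ^+ (q ^ r) ->
  (forall j, A ^+ (q ^ j.+1) != A) ->
  (forall l, (l <= n)%N -> tpol (Zs l)) ->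
  (forall l, (l < n)%N -> tsub (LLbar A) (tau kM * Zs l) = tsub th (Zs l.+1)) ->
  \sum_(l < n.+1) LLbar (p l) *^ Zs l = Zs 0 * phi ->
  exists e, [/\ tpol e, e * phi = phi * e & Zs 0 = wmul r (LLbar A) e].
Proof.
elim: r A Zs => [|r IH] A Zs pA nper hZ hrec hsum.
  have {}hrec l : (l < n)%N -> Zs l.+1 = tau kM * Zs l.
    move=> ln; apply/eqP; rewrite -subr_eq0; apply/eqP; apply: (tsub_inj (a := th)).
    by rewrite tsubB -(hrec _ ln) pA expn0 expr1 subrr.
  have hX l : (l <= n)%N -> Zs l = tau kM ^+ l * Zs 0.
    by elim: l => [|l IHl] ln; rewrite ?mul1r // hrec // IHl ?(ltnW ln) // exprS mulrA.
  exists (Zs 0); split=> //; first exact: hZ.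
  rewrite -hsum [in RHS]phi_sum mulr_suml; apply: eq_bigr => l _.
  by rewrite -mulrA -hX // -ltnS.
set a := LLbar A in hrec *; pose b := a - th.
have b0 : b != 0 by rewrite /b /a pA subr_eq0 (inj_eq (fmorph_inj _)) eq_sym.
have bb g : b^-1 *^ (b *^ g) = g by rewrite monM mulVf // mon1.
pose Y' l := b^-1 *^ (tau kM * Zs l - Zs l.+1).
(* Zs 0 has no predecessor; for it the sum relation gives (t - theta) Zs 0 = (t - A) X. *)
pose X : lau := \sum_(l < n) LLbar (p l.+1) *^ Y' l.
pose Y l := if l is l'.+1 then Y' l' else b^-1 *^ (X - Zs 0).
have ZY' l : (l < n)%N -> Zs l.+1 = tsub a (Y' l).
  by move=> ln; rewrite /Y' tsub_mon tsubB hrec // tsub_diff bb.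
have ZY l : (l <= n)%N -> Zs l = tsub a (Y l).
  case: l => [_|l]; last exact: ZY'.
  have e : tsub th (Zs 0) = tsub a X.
    rewrite {1}/tsub -hsum big_ord_recl /= addrC addKr /X tsub_sum.
    by apply: eq_bigr => l _; rewrite tsub_mon -ZY'.
  by rewrite /Y tsub_mon tsubB -e tsub_diff bb.
have binL : inL b^-1 by apply/inLV/inLB/inL_id/inL_id.
have tY' l : (l < n)%N -> tpol (Y' l).
  move=> ln; apply: tpol_mon => //; apply: tpolB; last exact: hZ.
  by apply/tpol_tau/hZ/ltnW.
have tY l : (l <= n)%N -> tpol (Y l).
  case: l => [_|l]; last exact: tY'.
  apply: tpol_mon => //; apply: tpolB; last exact: hZ.
  by apply: tpol_sum => l _; apply: tpol_mon; [exact: inL_id|exact: tY'].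
have [||||e [te ec eY]] := IH (A ^+ q) Y _ _ tY.
- by rewrite pA expnS exprM.
- move=> j; rewrite -exprM mulnC exprM.
  by apply: contra (nper j) => /eqP/(@frob1_inj _ _ kL) ->.
- move=> l ln; apply/eqP; rewrite -subr_eq0; apply/eqP; apply: (tsub_inj (a := a)).
  rewrite tsubB rmorphXn /= -tsub_tau [tsub a (tsub th _)]tsubC -ZY' // -ZY 1?ltnW // hrec //.
  by rewrite subrr.
- apply/eqP; rewrite -subr_eq0; apply/eqP; apply: (tsub_inj (a := a)).
  rewrite tsubB -tsub_phi -ZY // -hsum tsub_sum -sumrB big1 // => l _.
  by rewrite tsub_mon -ZY ?subrr // -ltnS.
by exists e; split=> //=; rewrite ZY // eY rmorphXn.
Qed.

(** Vanishing of Z means that truncation commutes with right multiplication by [phi] on zz l f phi^i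
    for i < b, so the truncations satisfy the relations of [divide_w]; the index i = 1 serves for l
    = n. As (g - pos g) phi^b has no polynomial part, g - pos g has degree below -n b, and dividing
    by W does not raise degrees. *)
Lemma window_zero f b : pcomm f -> (1 < b)%N ->
  (forall l j i, (l < n)%N -> (j < n)%N -> (i < b)%N -> Z f l j i%:Z = 0) ->
  exists e, [/\ tpol e, e * phi = phi * e & ldle (f - e) (- (n * b)%N%:Z)].
Proof.
move=> hf b1 hw; have [_ fc] := hf.
have rho0 l i : (l < n)%N -> (i < b)%N -> rho (zz l f * phi ^ i%:Z) = 0.
  move=> ln ib; apply: lauP => j; rewrite lcoef0.
  have [[j0 jn]|nj] := pselect (0 <= j /\ j < n%:Z); last first.
    apply: rho_supp; have [?|?] := ltP j 0; first by left.
    by right; rewrite leNgt; apply/negP => ?; apply: nj.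
  have -> : j = `|j|%N%:Z by lia.
  by apply: hw => //; lia.
have rhol l : (l < n)%N -> rho (zz l f) = 0.
  by move=> ln; have := rho0 l 0%N ln (ltnW b1); rewrite expr0z mulr1.
have rhol1 l : (l < n)%N -> rho (zz l f * phi) = 0.
  by move=> ln; have := rho0 l 1%N ln b1; rewrite expr1z.
have rhon l : (l <= n)%N -> rho (zz l f) = 0.
  rewrite leq_eqVlt => /predU1P[->|]; last exact: rhol.
  have := congr1 rho (zz_sum fc); rewrite big_ord_recr /= rhol1 //.
  move/esym/eqP; rewrite -subr_eq0 sub0r oppr_eq0 => /eqP.
  rewrite rhoD.
  rewrite rho_sum big1 ?add0r => [|l' _]; last by rewrite rho_mon rhol ?mulr0.
  rewrite rho_mon => e.
  have u : (LLbar (p n))^-1 * LLbar (p n) = 1 by rewrite mulVf ?fmorph_eq0.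
  by rewrite -[LHS]mon1 -u -monM e mulr0.
have tint g : rho g = 0 -> pos (g * phi) = pos g * phi.
  by move/eqP; rewrite subr_eq0 => /eqP.
(* The top coefficient of [rho] determines the coefficient of degree -1, the only obstruction in
   [pos_tau]. *)
have neg1 l : (l < n)%N -> zz l f (-1) = 0 /\ (zz l f * phi) (-1) = 0.
  move=> ln; split; apply: (@qexp_inj _ _ kM 1); rewrite expn1 zero_card;
    apply: (mulfI phi_n0); rewrite mulr0 -rho_top ?rhol ?rhol1 // lcoef0 zero_card //.
pose Zs l := pos (zz l f).
have postau (g : lau) : g (-1) = 0 -> pos (tau kM * g) = tau kM * pos g.
  move=> e; rewrite pos_tau e zero_card; have -> : lmonomial kM 0 0 = 0 by apply: lauP => i /=; case: ifP.
  by rewrite addr0.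
have [|||e [te ec eZ]] := @divide_w m T Zs pT T_nper.
- by move=> l _; apply/tpol_pos/posL_wmul/hf/inL_id.
- move=> l ln; have := congr1 pos (zz_tau l f).
  have [n1 n2] := neg1 l ln.
  have e1 : pos (tau kM * zz l f * phi) = tau kM * Zs l * phi.
    by rewrite -mulrA postau // tint ?rhol // mulrA.
  have e2 : pos (tau kM * zz l f) = tau kM * Zs l by rewrite postau.
  have e3 : pos (zz l.+1 f * phi) = Zs l.+1 * phi by rewrite tint ?rhon.
  by rewrite !pos_tsub e1 e2 e3.
- rewrite /Zs -tint ?rhol // -zz_sum // ltrunc_sum; apply: eq_bigr => l _.
  by rewrite ltrunc_monl.
exists e; split=> //; apply: (@ldle_wmul m t); rewrite wmulB -eZ.
have -> : wmul m t f = zz 0 f by rewrite /zz expr0 mul1r.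
rewrite /Zs; set g := zz 0 f.
have posi i : (i <= b)%N -> pos (g * phi ^+ i) = pos g * phi ^+ i.
  elim: i => [|i IHi] ib; first by rewrite !mulr1.
  rewrite exprSr !mulrA tint ?IHi ?(ltnW ib) //.
  exact: (rho0 0%N i isT ib).
have : pos ((g - pos g) * phi ^+ b) = 0.
  rewrite mulrBl ltruncB posi //; apply/eqP; rewrite subr_eq0; apply/eqP/lauP => i.
  rewrite ltruncE; case: ifP => // /negbT; rewrite -leNgt => i1.
  apply: lpolyM_neg => [j j0|j j0|]; [exact: pos_neg| |lia].
  elim: (b) j j0 => [|c IHc] j j0; first by rewrite expr0 lcoef1; case: eqP => // ej; lia.
  by rewrite exprS; apply: lpolyM_neg => // l l0; apply: hphi; left.
move=> h0; have : ldle ((g - pos g) * phi ^+ b) (-1).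
  by move=> i hi; have := congr1 (fun h : lau => h i) h0; rewrite ltruncE hi.
have: forall c N h, ldle (h * phi ^+ c) N -> ldle h (N - (n * c)%N%:Z).
  elim=> [|c IHc] N h; first by rewrite mulr1 muln0 subr0.
  rewrite exprSr mulrA => /ldle_mulphi /IHc hh.
  by apply: (ldle_trans hh); lia.
by move=> H /H hh; apply: (ldle_trans hh); lia.
Qed.

Lemma pcommB f g : pcomm f -> pcomm g -> pcomm (f - g).
Proof.
move=> [fp fc] [gp gc]; split; last by rewrite mulrBl mulrBr fc gc.
by move=> i; rewrite lcoefB; apply: inPB.
Qed.

Lemma ZB f g l j i : Z (f - g) l j i = Z f l j i - Z g l j i.
Proof. by rewrite /Z /zz mulrBr wmulB mulrBl rhoB lcoefB. Qed.

(** The values of Z on a window of b indices form one of finitely many tables, so f phi^i and f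
    phi^j share a table for some i < j; as Z is additive, their difference has the zero table. With
    b = B + 2 both 1 < b and n b >= B hold. *)
Lemma window_finite f B : pcomm f -> exists i j e, [/\ (i < j)%N, tpol e,
  e * phi = phi * e & ldle (f * (phi ^+ j - phi ^+ i) - e) (- B%:Z)].
Proof.
move=> hf; have [V hV] := Z_finite; pose b := B.+2.
pose T0 := {ffun 'I_n * 'I_n * 'I_b -> 'I_(size V).+1}.
pose S g l j i := xget 0 [set c | c \in V /\ Z g l j i = LLbar c].
have SP g l j i : pcomm g -> (l < n)%N -> (j < n)%N ->
    S g l j i \in V /\ Z g l j i = LLbar (S g l j i).
  move=> hg ln jn; have [c cV hc] := hV g hg l j i ln jn.
  by apply: (xgetPex 0 (P := [set c | c \in V /\ Z g l j i = LLbar c])); exists c.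
pose W (a : nat) : T0 := [ffun x : ('I_n * 'I_n * 'I_b)%type => inord (index (S (f * phi ^ a%:Z) x.1.1 x.1.2 (x.2 : nat)%:Z) V)].
have [i [j [ij eW]]] : exists i j, (i < j)%N /\ W i = W j.
  apply: contrapT => nex.
  have inj : injective (fun x : 'I_(#|T0|.+1) => W x).
    move=> x y /= e; have [xy|xy|/val_inj //] := ltngtP x y; case: nex.
      by exists x, y.
    by exists y, x.
  by have := leq_card _ inj; rewrite card_ord ltnn.
have ei := pcomm_expz i%:Z hf; have ej := pcomm_expz j%:Z hf.
have [|e [te ec ee]] := @window_zero (f * phi ^ j%:Z - f * phi ^ i%:Z) b (pcommB ej ei) isT.
  move=> l c a ln cn ab; rewrite ZB.
  have := congr1 (fun w : T0 => w (Ordinal ln, Ordinal cn, Ordinal ab)) eW.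
  rewrite !ffunE /= => /(congr1 (@nat_of_ord _)).
  have [Vi ->] := SP _ l c a%:Z ei ln cn; have [Vj ->] := SP _ l c a%:Z ej ln cn.
  rewrite !inordK ?ltnS ?index_size // => eI.
  by rewrite -(nth_index 0 Vi) eI nth_index // subrr.
exists i, j, e; split=> //; rewrite mulrBr; apply: (ldle_trans ee).
by rewrite /b; lia.
Qed.

End System.

End Window.

(** * Discrete valuations of function fields *)

Section DiscreteValuation.
Variables (K : fieldType) (v : K -> \bar int).
Hypothesis hv : discrete_valuation v.

Definition vge (N : int) (x : K) := (N%:E <= v x)%E.

Lemma dval0 : v 0 = +oo%E. Proof. by case: hv => h _ _ _; apply/h. Qed.

Lemma dvalM x y : v (x * y) = (v x + v y)%E. Proof. by case: hv. Qed.

Lemma dval_fin x : x != 0 -> exists o : int, v x = o%:E.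
Proof.
move=> x0; have h : (v x + v x^-1 = 0)%E by rewrite -dvalM mulfV // (dval1 hv).
case e : (v x) h => [o||] h; first by exists o.
  by case: hv => /(_ x)[/(_ e) x00 _]; rewrite x00 eqxx in x0.
by case: (v x^-1) h.
Qed.

Lemma vge0 N : vge N 0. Proof. by rewrite /vge dval0 leey. Qed.
Lemma vgeD N x y : vge N x -> vge N y -> vge N (x + y).
Proof.
move=> hx hy; case: hv => _ _ /(_ x y) h _; apply: le_trans h.
by rewrite le_min; apply/andP.
Qed.
Lemma vgeN N x : vge N x -> vge N (- x). Proof. by rewrite /vge dvalN. Qed.
Lemma vgeB N x y : vge N x -> vge N y -> vge N (x - y).
Proof. by move=> hx hy; apply/vgeD/vgeN. Qed.
Lemma vgeM a b x y : vge a x -> vge b y -> vge (a + b) (x * y).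
Proof. by move=> hx hy; rewrite /vge dvalM EFinD leeD. Qed.
Lemma vge_le a b x : a <= b -> vge b x -> vge a x.
Proof. by move=> ab; apply: le_trans; rewrite lee_fin. Qed.
Lemma vge_sum N I (r : seq I) (P : pred I) (F : I -> K) :
  (forall i, P i -> vge N (F i)) -> vge N (\sum_(i <- r | P i) F i).
Proof. by move=> h; apply: (big_ind (vge N)) => //; [exact: vge0|exact: vgeD]. Qed.
Lemma vge_ex x : exists N : nat, vge (- N%:Z) x.
Proof.
have [->|/dval_fin[o e]] := eqVneq x 0; first by exists 0%N; apply: vge0.
by exists `|o|%N; rewrite /vge e lee_fin; lia.
Qed.
Lemma vge1 : vge 0 1. Proof. by rewrite /vge (dval1 hv). Qed.
Lemma vgeX0 x m : vge 0 x -> vge 0 (x ^+ m).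
Proof.
move=> h; elim: m => [|m IH]; first by rewrite expr0 vge1.
by rewrite exprS -[0]/(0 + 0 : int); apply: vgeM.
Qed.
Lemma dvalX x m o : v x = o%:E -> v (x ^+ m) = (m%:Z * o)%:E.
Proof.
move=> e; elim: m => [|m IH]; first by rewrite expr0 (dval1 hv) mul0r.
by rewrite exprS dvalM IH e -EFinD; congr EFin; lia.
Qed.

Lemma vge_periodic c m : (1 < m)%N -> c ^+ m = c -> vge 0 c.
Proof.
move=> m1 e; have [->|/dval_fin[o eo]] := eqVneq c 0; first exact: vge0.
have := dvalX m eo; rewrite e eo => -[] h; rewrite /vge eo lee_fin; nia.
Qed.

(** Multiplying the relation by C_r^(r-1) makes it monic in y = C_r x, with integral
    coefficients. *)
Lemma vge_integral r (C : nat -> K) x : (forall i, vge 0 (C i)) -> C r != 0 ->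
  \sum_(i < r.+1) C i * x ^+ i = 0 -> vge 0 (C r * x).
Proof.
case: r => [|r] hC Cr rel.
  by move: rel; rewrite big_ord1 mulr1 => /eqP; rewrite (negbTE Cr).
set y := C r.+1 * x.
have [->|/dval_fin[o eo]] := eqVneq y 0; first exact: vge0.
rewrite /vge eo lee_fin leNgt; apply/negP => o0.
have e : y ^+ r.+1 = - \sum_(i < r.+1) (C i * C r.+1 ^+ (r - i)) * y ^+ i.
  move/(congr1 (fun z => C r.+1 ^+ r * z)): rel.
  rewrite mulr0 big_ord_recr /= mulrDr => /eqP.
  rewrite [C r.+1 ^+ r * (_ * _)]mulrA -exprSr -exprMn -/y addrC addr_eq0 => /eqP ->.
  rewrite mulr_sumr; congr (- _); apply: eq_bigr => i _.
  have -> : C r.+1 ^+ r = C r.+1 ^+ (r - i) * C r.+1 ^+ i.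
    by rewrite -exprD subnK // -ltnS.
  by rewrite exprMn; ring.
have : vge (r%:Z * o) (y ^+ r.+1).
  rewrite e; apply/vgeN/vge_sum => i _.
  have -> : r%:Z * o = 0 + 0 + r%:Z * o by rewrite !add0r.
  apply: vgeM; first by apply: vgeM => //; apply: vgeX0.
  rewrite /vge (dvalX _ eo) lee_fin; have := ltn_ord i; nia.
by rewrite /vge (dvalX _ eo) lee_fin; nia.
Qed.

End DiscreteValuation.

(** * Algebraic dependence of two elements of a function field *)

Section Transcendence.
Variables (k : finFieldType) (F : fieldType) (kF : {rmorphism k -> F}).
Hypothesis hF : global_function_field kF.
Local Notation q := #|k|.

(* The N^2 monomials t^a x^b lie in a k-space of dimension O(N). *)
Lemma algebraic_pair (t x : F) : exists N, exists2 c : {ffun 'I_N * 'I_N -> k},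
  c != [ffun => 0] & \sum_ab kF (c ab) * t ^+ ab.1 * x ^+ ab.2 = 0.
Proof.
have [[t0 _ [m [b hb]]] _] := hF.
pose ev (p : {poly k}) : F := (map_poly kF p).[t0].
have evM (p r : {poly k}) : ev (p * r) = ev p * ev r by rewrite /ev rmorphM hornerM.
have evD (p r : {poly k}) : ev (p + r) = ev p + ev r by rewrite /ev rmorphD hornerD.
have evZ c (p : {poly k}) : ev (c *: p) = kF c * ev p by rewrite /ev linearZ /= hornerZ.
(* Combinations of the b_i whose coefficients are polynomials in t0 of size at most d: a k-space of
   dimension at most m d. *)
pose W d (z : F) := exists P : 'I_m -> {poly k},
  (forall i, (size (P i) <= d)%N) /\ z = \sum_i ev (P i) * b i.
have Wpoly d z (p : {poly k}) : W d z -> W (d + size p)%N (ev p * z).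
  move=> [P [hP ->]]; exists (fun i => p * P i); split=> [i|].
    by apply: leq_trans (size_polyMleq _ _) _; have := hP i; lia.
  by rewrite mulr_sumr; apply: eq_bigr => i _; rewrite evM mulrA.
have Wle d d' z : (d <= d')%N -> W d z -> W d' z.
  by move=> dd [P [hP ->]]; exists P; split=> // i; apply: leq_trans (hP i) dd.
have WD d z z' : W d z -> W d z' -> W d (z + z').
  move=> [P [hP ->]] [P' [hP' ->]]; exists (fun i => P i + P' i); split=> [i|].
    by apply: leq_trans (size_polyD _ _) _; rewrite geq_max hP hP'.
  by rewrite -big_split; apply: eq_bigr => i _ /=; rewrite evD mulrDl.
have W0 d : W d 0.
  exists (fun=> 0); split=> [i|]; first by rewrite size_poly0.
  by rewrite big1 // => i _; rewrite /ev rmorph0 horner0 mul0r.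
have WZ d c z : W d z -> W d (kF c * z).
  move=> [P [hP ->]]; exists (fun i => c *: P i); split=> [i|].
    by apply: leq_trans (size_scale_leq _ _) (hP i).
  by rewrite mulr_sumr; apply: eq_bigr => i _; rewrite evZ mulrA.
have W_sum d (J : Type) (r : seq J) (G : J -> F) : (forall j, W d (G j)) -> W d (\sum_(j <- r) G j).
  by move=> h; apply: (big_ind (W d)) => //; apply: WD.
have Wden z : exists D d, ev D != 0 /\ W d (ev D * z).
  have [c [hc ->]] := hb z.
  suff [D [D0 [P hP]]] : exists D, ev D != 0 /\ exists P : 'I_m -> {poly k}, forall i, ev D * c i = ev (P i).
    exists D, (\max_i size (P i))%N; split=> //; exists P; split=> [i|]; first exact: leq_bigmax.
    by rewrite mulr_sumr; apply: eq_bigr => i _; rewrite mulrA hP.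
  have [D [D0 hD]] : exists D, ev D != 0 /\ forall i, i \in enum 'I_m -> exists p, ev D * c i = ev p.
    elim: (enum _) => [|i s [D [D0 IH]]].
      by exists 1; rewrite /ev rmorph1 hornerC oner_neq0.
    have [p [r [r0 ei]]] := hc i; exists (D * r); rewrite evM mulf_neq0 //; split=> // j.
    rewrite inE => /predU1P[->|/IH[p' hp']].
      by exists (D * p); rewrite evM ei -/(ev p) -/(ev r); field.
    by exists (p' * r); rewrite evM -hp' mulrAC.
  exists D; split=> //; have /choice[P hP] : forall i : 'I_m, exists p, ev D * c i = ev p.
    by move=> i; apply: hD; rewrite mem_enum.
  by exists P.
(* After a denominator is cleared, multiplication by y raises the size bound by a constant. *)
have Wmul y : exists D c, ev D != 0 /\ forall d z, W d z -> W (d + c)%N (ev D * y * z).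
  have [D [D0 [c hc]]] : exists D, ev D != 0 /\ exists c, forall i, i \in enum 'I_m -> W c (ev D * (y * b i)).
    elim: (enum _) => [|i s [D [D0 [c IH]]]].
      by exists 1; rewrite /ev rmorph1 hornerC oner_neq0; split=> //; exists 0%N.
    have [D' [d [D'0 hd]]] := Wden (y * b i).
    exists (D * D'); rewrite evM mulf_neq0 //; split=> //.
    exists (c + d + size D + size D')%N => j; rewrite inE => /predU1P[->|/IH hj].
      by rewrite -mulrA; apply: Wle (Wpoly _ _ D hd); lia.
    by rewrite [ev D * _]mulrC -mulrA; apply: Wle (Wpoly _ _ D' hj); lia.
  exists D, c; split=> // d z [P [hP ->]]; rewrite mulr_sumr.
  apply: W_sum => i; have -> : ev D * y * (ev (P i) * b i) = ev (P i) * (ev D * (y * b i)).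
    by ring.
  by apply: Wle (Wpoly _ _ (P i) (hc i _)); rewrite ?mem_enum // addnC leq_add2r.
have [Dt [ct [Dt0 ht]]] := Wmul t; have [Dx [cx [Dx0 hx]]] := Wmul x.
have [D1 [d1 [D10 h1]]] := Wden 1.
have ht' d z a : W d z -> W (d + a * ct)%N (ev Dt ^+ a * t ^+ a * z).
  move=> hz; elim: a => [|a IH]; first by rewrite !mul1r mul0n addn0.
  have -> : ev Dt ^+ a.+1 * t ^+ a.+1 * z = ev Dt * t * (ev Dt ^+ a * t ^+ a * z).
    by rewrite !exprS; ring.
  by rewrite mulSnr addnA; apply: ht.
have hx' d z a : W d z -> W (d + a * cx)%N (ev Dx ^+ a * x ^+ a * z).
  move=> hz; elim: a => [|a IH]; first by rewrite !mul1r mul0n addn0.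
  have -> : ev Dx ^+ a.+1 * x ^+ a.+1 * z = ev Dx * x * (ev Dx ^+ a * x ^+ a * z).
    by rewrite !exprS; ring.
  by rewrite mulSnr addnA; apply: hx.
have evX (p : {poly k}) a : ev p ^+ a = ev (p ^+ a) by rewrite /ev rmorphXn /= horner_exp.
have size_gt0 (p : {poly k}) : ev p != 0 -> (0 < size p)%N.
  by rewrite size_poly_gt0; apply: contraNneq => ->; rewrite /ev rmorph0 horner0.
have := size_gt0 _ Dt0; have := size_gt0 _ Dx0 => sDx sDt.
pose c := (ct + cx + size Dt + size Dx)%N.
(* Large enough for N^2 > m (d1 + 2 c N), which bounds the dimension of the space containing all E
   t^a x^b with a, b <= N. *)
pose N := (m * (c * 2 + d1)).+1.
pose E : F := ev D1 * ev Dt ^+ N * ev Dx ^+ N.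
have mon a b' : (a <= N)%N -> (b' <= N)%N -> W (d1 + c * 2 * N)%N (E * (t ^+ a * x ^+ b')).
  move=> aN bN; have := hx' _ _ b' (ht' _ _ a h1).
  move/(Wpoly _ _ (Dt ^+ (N - a)))/(Wpoly _ _ (Dx ^+ (N - b'))).
  rewrite -!evX mulr1.
  have -> : ev Dx ^+ (N - b') * (ev Dt ^+ (N - a) * (ev Dx ^+ b' * x ^+ b' *
     (ev Dt ^+ a * t ^+ a * ev D1))) = E * (t ^+ a * x ^+ b').
    have eT : ev Dt ^+ N = ev Dt ^+ (N - a) * ev Dt ^+ a by rewrite -exprD subnK.
    have eX : ev Dx ^+ N = ev Dx ^+ (N - b') * ev Dx ^+ b' by rewrite -exprD subnK.
    by rewrite /E eT eX; ring.
  apply: Wle.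
  have sX (p : {poly k}) j : (j <= N)%N -> (size (p ^+ j) <= size p * N + 1)%N.
    move=> jN; apply: leq_trans (size_poly_exp_leq _ _) _; nia.
  have := sX Dt (N - a)%N (leq_subr _ _); have := sX Dx (N - b')%N (leq_subr _ _).
  by rewrite /c; nia.
pose val' (l : {ffun 'I_N * 'I_N -> k}) : F := \sum_ab kF (l ab) * t ^+ ab.1 * x ^+ ab.2.
have Wval l : W (d1 + c * 2 * N)%N (E * val' l).
  rewrite /val' mulr_sumr; apply: W_sum => ab.
  rewrite -mulrA mulrCA; apply: WZ; apply: mon; exact: ltnW.
have [P hP] := choice Wval.
pose G (l : {ffun 'I_N * 'I_N -> k}) : {ffun 'I_m * 'I_(d1 + c * 2 * N) -> k} :=
  [ffun ij : ('I_m * 'I_(d1 + c * 2 * N))%type => (P l ij.1)`_ij.2].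
have [[l l'] [/eqP nl eG]] : exists ll, ll.1 <> ll.2 /\ G ll.1 = G ll.2.
  apply: contrapT => nex; have inj : injective G.
    by move=> l l' e; apply: contrapT => nl; apply: nex; exists (l, l').
  have := leq_card _ inj; rewrite !card_ffun !card_prod !card_ord leq_exp2l ?card_gt1 //.
  by rewrite /N; nia.
have E0 : E != 0 by rewrite !mulf_neq0 ?expf_neq0.
have eV : val' l = val' l'.
  apply: (mulfI E0); have [sl ->] := hP l; have [sl' ->] := hP l'.
  apply: eq_bigr => i _; congr (ev _ * _); apply/polyP => j.
  have [jd|dj] := ltnP j (d1 + c * 2 * N)%N.
    by have := congr1 (fun g : {ffun _} => g (i, Ordinal jd)) eG; rewrite !ffunE.
  by rewrite !nth_default //; apply: leq_trans dj.
exists N, [ffun ab => l ab - l' ab].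
  apply: contra nl => /eqP e0; apply/eqP/ffunP => ab.
  have := congr1 (fun g : {ffun _} => g ab) e0; rewrite !ffunE => /eqP.
  by rewrite subr_eq0 => /eqP.
transitivity (val' l - val' l'); last by rewrite eV subrr.
by rewrite /val' -sumrB; apply: eq_bigr => ab _; rewrite ffunE rmorphB !mulrBl.
Qed.

End Transcendence.

(** * Extension of phi to the completion *)

Lemma lau_small (k : finFieldType) (M : closedFieldType) (kM : {rmorphism k -> M})
  (f g : laurent kM) : (forall K : nat, ldle (f - g) (- K%:Z)) -> f = g.
Proof.
move=> h; apply: lauP => i; apply/eqP; rewrite -subr_eq0 -lcoefB; apply/eqP.
by apply: (h `|i|.+1%N); lia.
Qed.

Section Extension.
Variables (k : finFieldType) (F : fieldType) (kF : {rmorphism k -> F}).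
Hypothesis hF : global_function_field kF.
Variables (ord : F -> \bar int) (hord : discrete_valuation ord).
Variables (Finf : fieldType) (FFinf : {rmorphism F -> Finf}) (ordinf : Finf -> \bar int).
Hypothesis hFinf : is_completion ord FFinf ordinf.
Variables (M : closedFieldType) (kM : {rmorphism k -> M}).
Local Notation lau := (laurent kM).
Local Notation Fr := (frobz kM).
Local Notation q := #|k|.
Local Notation A := (ringA ord).
Variable phi : {rmorphism A -> lau}.
Hypothesis phi_inj : forall a, phi a = 0 -> a = 0.
Variable t : A.
Hypothesis t_deg : 0 < ldeg (phi t).

Lemma phi_neq (a : A) : a != 0 -> phi a != 0.
Proof. by apply: contraNneq => /phi_inj ->. Qed.

Lemma ldegX (f : lau) m : f != 0 -> f ^+ m != 0 /\ ldeg (f ^+ m) = m%:Z * ldeg f.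
Proof.
move=> f0; elim: m => [|m [fm IH]].
  by rewrite expr0 oner_neq0 ldeg_mon ?oner_neq0 // mul0r.
have [h e] := ldegM f0 fm; rewrite exprS; split=> //; rewrite e IH; lia.
Qed.

Lemma t_neq0 : t != 0.
Proof.
apply: contraTneq t_deg => ->; rewrite rmorph0.
by rewrite /ldeg xgetPN // => d [] /eqP; rewrite lcoef0.
Qed.

Lemma t_nper m : (1 < m)%N -> t ^+ m != t.
Proof.
move=> m1; apply/eqP => e; have [_] := ldegX m (phi_neq t_neq0).
rewrite -rmorphXn /= e; move: t_deg; set d := ldeg (phi t) => d0 ed.
have : (m%:Z - 1) * d = 0 by lia.
by move/eqP; rewrite mulf_eq0 => /orP[] /eqP; lia.
Qed.

Lemma phi_comm (a b : A) : phi a * phi b = phi b * phi a.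
Proof. by rewrite -!rmorphM mulrC. Qed.

Lemma const_regular (c : k) : kF c \in regular_away ord.
Proof.
apply/asboolP => v hv _; apply: (vge_periodic hv (card_gt1 k)).
exact: (card_scalar_exp kF).
Qed.

(** Read an algebraic relation between t and x as a polynomial in x over k[t]. Its leading
    coefficient times x is integral at every place other than the given one, hence lies in A. *)
Lemma frac_A (x : F) : exists a b : A, b != 0 /\ x * (b : F) = (a : F).
Proof.
have [N [c c0 rel]] := algebraic_pair hF (t : F) x.
pose C (i : nat) : F :=
  \sum_(a < N) kF (oapp (fun j => c (a, j)) 0 (insub i)) * (t : F) ^+ a.
have tA : (t : F) \in regular_away ord by case: (t).
have CA i : C i \in regular_away ord.
  by apply: rpred_sum => a _; apply: rpredM; [exact: const_regular|exact: rpredX].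
have relC : \sum_(i < N) C i * x ^+ i = 0.
  transitivity (\sum_(a < N) \sum_(b < N) kF (c (a, b)) * (t : F) ^+ a * x ^+ b).
    2: by rewrite pair_bigA -[RHS]rel; apply: eq_bigr => -[a b] _.
  rewrite exchange_big /=; apply: eq_bigr => i _; rewrite mulr_suml.
  by apply: eq_bigr => a _; rewrite valK.
have [[a0 j0] ca0] : exists ab, c ab != 0.
  apply: contrapT => nex; move/eqP: c0; apply; apply/ffunP => ab; rewrite ffunE.
  by apply/eqP; apply: contrapT => /negP h; apply: nex; exists ab.
(* Otherwise t would be algebraic over k, hence a constant, and t^q = t, against the positive degree
   of phi_t. *)
have Cj0 : C j0 != 0.
  apply/eqP => C0; have := t_nper (card_gt1 k); apply/negP; rewrite negbK.
  have [e et] : exists e, (t : F) = kF e.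
    have [_] := hF; apply; exists (\poly_(a < N) (if insub a is Some a' then c (a', j0) else 0)).
      apply/eqP => /(congr1 (fun p : {poly k} => p`_a0)); rewrite coef0 coef_poly ltn_ord valK.
      by move/eqP; rewrite (negbTE ca0).
    rewrite rootE -[X in _ == X]C0 map_polyE; apply/eqP.
    rewrite -map_polyE (@horner_coef_wide _ N); last first.
      by rewrite size_map_poly size_poly.
    apply: eq_bigr => a _; rewrite coef_map coef_poly ltn_ord valK /=.
    by rewrite /C valK.
  have valX m : ringA_val (t ^+ m) = (t : F) ^+ m.
    by elim: m => // m IH; rewrite !exprS -IH.
  by apply/eqP/val_inj; rewrite /= valX et (card_scalar_exp kF).
have exC : exists i, (i < N)%N && (C i != 0) by exists j0; rewrite ltn_ord.
have ubC i : (i < N)%N && (C i != 0) -> (i <= N)%N by move=> /andP[/ltnW].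
case: (ex_maxnP exC ubC) => r /andP[rN Cr] rmax.
have relr : \sum_(i < r.+1) C i * x ^+ i = 0.
  rewrite (big_ord_widen N (fun i => C i * x ^+ i) rN) -[RHS]relC big_mkcond.
  apply: eq_bigr => i _; case: ifP => // /negbT; rewrite -leqNgt => ri.
  have [->|h] := eqVneq (C i) 0; first by rewrite mul0r.
  by have := rmax i; rewrite ltn_ord h leqNgt ri => /(_ isT).
have xA : C r * x \in regular_away ord.
  apply/asboolP => v hv nv; apply: (vge_integral hv _ Cr relr) => i.
  by have /asboolP/(_ v hv nv) := CA i.
exists (RingA xA), (RingA (CA r)); split; last by rewrite /= mulrC.
by apply: contraNneq Cr => /(congr1 (@ringA_val F ord)) /= ->.
Qed.

Lemma A_neq0 (a : A) : a != 0 -> (a : F) != 0.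
Proof. by apply: contraNneq => h; apply/eqP/val_inj. Qed.

Definition PhiF (x : F) : lau := xget 0 [set y | exists a b : A,
  [/\ b != 0, x * (b : F) = (a : F) & y * phi b = phi a]].

Lemma PhiFP x (a b : A) : b != 0 -> x * (b : F) = (a : F) -> PhiF x * phi b = phi a.
Proof.
move=> b0 e.
have [c [d [d0 e' h]]] : [set y | exists a b : A,
    [/\ b != 0, x * (b : F) = (a : F) & y * phi b = phi a]] (PhiF x).
  apply: (@xgetPex _ 0); exists (phi a * (phi b)^-1), a, b; split=> //.
  by rewrite mulrVK // lau_unitE phi_neq.
have u : phi d \is a GRing.unit by rewrite lau_unitE phi_neq.
apply: (mulIr u); rewrite -mulrA phi_comm mulrA h -!rmorphM /=; congr (phi _).
by apply: val_inj; rewrite /= -e -e' -!mulrA [X in _ * X]mulrC.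
Qed.

Lemma PhiF_uniq x y (a b : A) : b != 0 -> x * (b : F) = (a : F) -> y * phi b = phi a -> y = PhiF x.
Proof.
move=> b0 e h; have u : phi b \is a GRing.unit by rewrite lau_unitE phi_neq.
by apply: (mulIr u); rewrite h (PhiFP b0 e).
Qed.

Lemma PhiF_A (a : A) : PhiF a = phi a.
Proof. by symmetry; apply: (@PhiF_uniq _ _ a 1); rewrite ?oner_neq0 ?rmorph1 ?mulr1. Qed.

Lemma PhiFB x y : PhiF (x - y) = PhiF x - PhiF y.
Proof.
have [a [b [b0 e]]] := frac_A x; have [c [d [d0 e']]] := frac_A y.
symmetry; apply: (@PhiF_uniq _ _ (a * d - c * b) (b * d)).
- by rewrite -(inj_eq val_inj) /= mulf_neq0 ?(inj_eq val_inj).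
- by rewrite /= -e -e'; ring.
- rewrite rmorphM mulrBl mulrA (PhiFP b0 e) phi_comm mulrA (PhiFP d0 e').
  by rewrite rmorphB !rmorphM.
Qed.

Lemma PhiFM x y : PhiF (x * y) = PhiF x * PhiF y.
Proof.
have [a [b [b0 e]]] := frac_A x; have [c [d [d0 e']]] := frac_A y.
symmetry; apply: (@PhiF_uniq _ _ (a * c) (b * d)).
- by rewrite -(inj_eq val_inj) /= mulf_neq0 ?(inj_eq val_inj).
- by rewrite /= -e -e'; ring.
- rewrite rmorphM phi_comm -mulrA [PhiF y * _]mulrA (PhiFP d0 e').
  by rewrite phi_comm mulrA (PhiFP b0 e) rmorphM.
Qed.

Lemma PhiF0 : PhiF 0 = 0. Proof. by rewrite -(subrr (0 : F)) PhiFB subrr. Qed.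
Lemma PhiF1 : PhiF 1 = 1.
Proof. by have := PhiF_A 1; rewrite rmorph1. Qed.

Lemma PhiF_neq0 x : x != 0 -> PhiF x != 0.
Proof.
move=> x0; have : PhiF x * PhiF x^-1 = 1 by rewrite -PhiFM mulfV ?PhiF1.
by apply: contra_eq_neq => ->; rewrite mul0r eq_sym oner_neq0.
Qed.

Let wt x := - ldeg (PhiF x).

Let wtM x y : x != 0 -> y != 0 -> wt (x * y) = wt x + wt y.
Proof.
move=> x0 y0; rewrite /wt PhiFM; have [_ ->] := ldegM (PhiF_neq0 x0) (PhiF_neq0 y0).
by rewrite opprD.
Qed.

Let wtV x : x != 0 -> wt x^-1 = - wt x.
Proof.
move=> x0; have := wtM x0 (invr_neq0 x0); rewrite mulfV //.
rewrite {1}/wt PhiF1 ldeg_mon ?oner_neq0 //; lia.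
Qed.

Let wtX x (m : int) : x != 0 -> wt (x ^ m) = m * wt x.
Proof.
move=> x0; have pos (j : nat) : wt (x ^+ j) = j%:Z * wt x.
  elim: j => [|j IH]; first by rewrite expr0 /wt PhiF1 ldeg_mon ?oner_neq0 // mul0r.
  by rewrite exprS wtM ?expf_neq0 // IH; lia.
case: m => j; first exact: pos.
rewrite NegzE -exprnN wtV ?expf_neq0 // pos; lia.
Qed.

(** The function - [ldeg] (PhiF x), divided by its least positive value e, is a normalized
    valuation. It is negative at t, which is regular at all places other than the given one, so it
    must be [ord]. *)
Lemma ord_deg : exists e : nat, (0 < e)%N /\
  forall x o, ord x = o%:E -> x != 0 -> ldeg (PhiF x) = - (e%:Z * o).
Proof.
have ex : exists m, (0 < m)%N && `[< exists2 x, x != 0 & wt x = m%:Z >].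
  exists `|ldeg (phi t)|%N; apply/andP; split; first by move: t_deg; lia.
  have t0 : (t : F) != 0 by apply: A_neq0 t_neq0.
  apply/asboolP; exists (t : F)^-1; rewrite ?invr_neq0 // wtV // /wt PhiF_A.
  by move: t_deg; lia.
case: (ex_minnP ex) => e /andP[e0 /asboolP[x1 x10 ex1]] emin.
have dvd x : x != 0 -> exists m, wt x = m * e%:Z.
  move=> x0; exists (wt x %/ e%:Z)%Z; rewrite {1}(divz_eq (wt x) e%:Z).
  suff -> : (wt x %% e%:Z)%Z = 0 by rewrite addr0.
  apply/eqP; apply: contrapT => /negP nz.
  have r0 : 0 <= (wt x %% e%:Z)%Z by apply: modz_ge0; lia.
  have rlt : (wt x %% e%:Z)%Z < e%:Z by apply: ltz_pmod; lia.
  have := emin `|(wt x %% e%:Z)%Z|%N; rewrite leqNgt => /(_ _)/negP; apply; last by lia.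
  apply/andP; split; first by lia.
  apply/asboolP; exists (x * x1 ^ (- (wt x %/ e%:Z)%Z)).
    by rewrite mulf_neq0 // expfz_neq0.
  rewrite wtM ?expfz_neq0 // wtX // ex1 gez0_abs // {1}(divz_eq (wt x) e%:Z); lia.
have wtD x y N : x != 0 -> y != 0 -> x + y != 0 -> N <= wt x -> N <= wt y -> N <= wt (x + y).
  move=> x0 y0 xy0; rewrite /wt => hx hy.
  have : ldle (PhiF (x + y)) (- N).
    rewrite -[y]opprK PhiFB -[- y]sub0r PhiFB PhiF0 sub0r opprK.
    apply: ldleD.
      by have [_ h] := ldegP (PhiF_neq0 x0); apply: ldle_trans h _; lia.
    by have [_ h] := ldegP (PhiF_neq0 y0); apply: ldle_trans h _; lia.
  move/(ldle_ltdeg (PhiF_neq0 xy0)); lia.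
pose v x : \bar int := if x == 0 then +oo%E else ((wt x %/ e%:Z)%Z)%:E.
have eN0 : (e%:Z : int) != 0 by lia.
have vdiv x : x != 0 -> wt x = (wt x %/ e%:Z)%Z * e%:Z.
  by move=> x0; have [m ->] := dvd x x0; rewrite mulzK.
have hv : discrete_valuation v.
  split.
  - by move=> x; rewrite /v; case: eqP => // nx; split.
  - move=> x y; rewrite /v mulf_eq0.
    have [|x0] := eqVneq x 0; first by case: (y == 0).
    have [|y0] := eqVneq y 0; first by [].
    rewrite /= -EFinD wtM //; congr EFin.
    by rewrite {1}(vdiv x x0) {1}(vdiv y y0) -mulrDl mulzK.
  - move=> x y; rewrite /v.
    have [->|x0] := eqVneq x 0; first by rewrite add0r; case: (eqVneq y 0); rewrite ?minyy // ge_min lexx orbT.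
    have [->|y0] := eqVneq y 0; first by rewrite addr0 (negbTE x0) ge_min lexx.
    have [|xy0] := eqVneq (x + y) 0; first by rewrite leey.
    rewrite -EFin_min lee_fin.
    have h := wtD x y (Num.min (wt x) (wt y)) x0 y0 xy0.
    have {h} : Num.min (wt x) (wt y) <= wt (x + y) by apply: h; lia.
    rewrite (vdiv x x0) (vdiv y y0) (vdiv _ xy0) !mulzK //; nia.
  - by exists x1; rewrite /v (negbTE x10) ex1 divzz eN0.
have vord : v = ord.
  apply: contrapT => nv; have /asboolP/(_ v hv nv) : (t : F) \in regular_away ord by case: (t).
  have t0 : (t : F) != 0 by apply: A_neq0 t_neq0.
  rewrite /v (negbTE t0) lee_fin; have := vdiv _ t0; rewrite {1}/wt PhiF_A.
  by move: t_deg; nia.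
exists e; split=> // x o; rewrite -vord /v => + x0; rewrite (negbTE x0) => -[] <-.
have := vdiv x x0; rewrite {1}/wt; lia.
Qed.

(** * Continuous extension from F to its completion *)

Section Completion.
Variables (e : nat) (e0 : (0 < e)%N).
Hypothesis hdeg : forall x o, ord x = o%:E -> x != 0 -> ldeg (PhiF x) = - (e%:Z * o).

Let hv : discrete_valuation ordinf. Proof. by case: hFinf. Qed.
Let ordE x : ordinf (FFinf x) = ord x. Proof. by case: hFinf. Qed.

Lemma PhiF_vge N x : vge ord N x -> ldle (PhiF x) (- (e%:Z * N)).
Proof.
have [->|x0] := eqVneq x 0; first by rewrite PhiF0.
have [o eo] := dval_fin hord x0; rewrite /vge eo lee_fin => No.
have [_ h] := ldegP (PhiF_neq0 x0); apply: ldle_trans h _.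
by rewrite (hdeg eo x0); nia.
Qed.

Lemma approx x N : exists y, vge ordinf N (x - FFinf y).
Proof. by case: hFinf => _ _ /(_ x N). Qed.

Definition apx x N : F := xget 0 [set y | vge ordinf N (x - FFinf y)].
Lemma apxP x N : vge ordinf N (x - FFinf (apx x N)).
Proof. exact: (xgetPex 0 (approx x N)). Qed.

Lemma approx_diff x y y' N : vge ordinf N (x - FFinf y) -> vge ordinf N (x - FFinf y') ->
  ldle (PhiF y - PhiF y') (- (e%:Z * N)).
Proof.
move=> h h'; rewrite -PhiFB; apply: PhiF_vge; rewrite /vge -ordE.
have -> : FFinf (y - y') = (x - FFinf y') - (x - FFinf y).
  by rewrite rmorphB; ring.
exact: vgeB.
Qed.

Lemma PhiI_coef x y (N i : int) : vge ordinf N (x - FFinf y) -> - (e%:Z * N) < i ->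
  PhiF (apx x (`|i|%N%:Z + 1)) i = PhiF y i.
Proof.
move=> h hi; apply/eqP; rewrite -subr_eq0 -lcoefB; apply/eqP.
pose N' := Num.min (`|i|%N%:Z + 1) N.
have h1 : vge ordinf N' (x - FFinf (apx x (`|i|%N%:Z + 1))).
  by apply: vge_le (apxP x _); rewrite /N'; lia.
have h2 : vge ordinf N' (x - FFinf y) by apply: vge_le h; rewrite /N'; lia.
apply: (approx_diff h1 h2).
have [c|c] := leP (`|i|%N%:Z + 1) N.
  have -> : N' = `|i|%N%:Z + 1 by rewrite /N'; lia.
  have e1 : 1 <= e%:Z by lia.
  by nia.
by have -> : N' = N by rewrite /N'; lia.
Qed.

(** The i-th coefficient of the limit is that of any approximation to precision N with - e N < i;
    since e >= 1, the precision |i| + 1 suffices. *)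
Fact PhiI_subproof x : exists N : int, forall i, N < i -> PhiF (apx x (`|i|%N%:Z + 1)) i = 0.
Proof.
have [N hN] := ldle_ex (PhiF (apx x 0)); exists (`|N|%N%:Z) => i hi.
by rewrite (PhiI_coef (apxP x 0)) ?hN //; lia.
Qed.
Definition PhiI x : lau := Laurent kM (PhiI_subproof x).

Lemma PhiI_ap x y (N : int) : vge ordinf N (x - FFinf y) ->
  ldle (PhiI x - PhiF y) (- (e%:Z * N)).
Proof. by move=> h i hi; rewrite lcoefB /= (PhiI_coef h hi) subrr. Qed.

Lemma PhiI_F x : PhiI (FFinf x) = PhiF x.
Proof.
apply: lau_small => K; apply: ldle_trans (PhiI_ap (N := K%:Z) _) _; last by nia.
by rewrite subrr; apply: vge0.
Qed.

Lemma PhiIB x y : PhiI (x - y) = PhiI x - PhiI y.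
Proof.
apply: lau_small => K; pose x' := apx x K%:Z; pose y' := apx y K%:Z.
have h : vge ordinf K%:Z (x - y - FFinf (x' - y')).
  have -> : x - y - FFinf (x' - y') = (x - FFinf x') - (y - FFinf y') by rewrite rmorphB; ring.
  by apply: vgeB => //; apply: apxP.
have -> : PhiI (x - y) - (PhiI x - PhiI y) = (PhiI (x - y) - PhiF (x' - y'))
   - ((PhiI x - PhiF x') - (PhiI y - PhiF y')).
  by apply: lauP => i; rewrite PhiFB !lcoefB; ring.
apply: (@ldle_trans _ _ _ _ (- (e%:Z * K%:Z))); last by nia.
apply: ldleB; first exact: PhiI_ap.
by apply: ldleB; apply: PhiI_ap; apply: apxP.
Qed.

Lemma PhiI_vge N x : vge ordinf N x -> ldle (PhiI x) (- (e%:Z * N)).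
Proof. by move=> h; have := @PhiI_ap x 0 N; rewrite rmorph0 PhiF0 !subr0; apply. Qed.

Lemma PhiIM x y : PhiI (x * y) = PhiI x * PhiI y.
Proof.
apply: lau_small => K.
have [c1 h1] := vge_ex hv x; have [c2 h2] := vge_ex hv y.
pose c := (c1 + c2)%N.
have hx : vge ordinf (- c%:Z) x by apply: vge_le h1; rewrite /c; lia.
have hy : vge ordinf (- c%:Z) y by apply: vge_le h2; rewrite /c; lia.
pose N : int := K%:Z + c%:Z; pose x' := apx x N; pose y' := apx y N.
have ax := apxP x N; have ay := apxP y N; rewrite -/x' -/y' in ax ay.
have hx' : vge ordinf (- c%:Z) (FFinf x').
  have -> : FFinf x' = x - (x - FFinf x') by ring.
  by apply: vgeB => //; apply: vge_le ax; rewrite /N; lia.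
have NK : N - c%:Z = K%:Z by rewrite /N; lia.
have h : vge ordinf K%:Z (x * y - FFinf (x' * y')).
  have -> : x * y - FFinf (x' * y') = (x - FFinf x') * y + FFinf x' * (y - FFinf y').
    by rewrite rmorphM; ring.
  by apply: vgeD => //; rewrite -NK; [|rewrite addrC]; apply: vgeM.
have -> : PhiI (x * y) - PhiI x * PhiI y = (PhiI (x * y) - PhiF (x' * y'))
   - ((PhiI x - PhiF x') * PhiI y + PhiF x' * (PhiI y - PhiF y')).
  by rewrite PhiFM mulrBl mulrBr addrA subrK opprB addrA subrK.
apply: (@ldle_trans _ _ _ _ (- (e%:Z * K%:Z))); last by nia.
apply: ldleB; first exact: PhiI_ap.
have eK : - (e%:Z * K%:Z) = - (e%:Z * N) + - (e%:Z * - c%:Z) by rewrite -NK; lia.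
apply: ldleD; rewrite eK.
  by apply: ldleM; [exact: PhiI_ap|exact: PhiI_vge].
rewrite [X in ldle _ X]addrC; apply: ldleM; last exact: PhiI_ap.
by apply: PhiF_vge; rewrite /vge -ordE.
Qed.

Lemma PhiI1 : PhiI 1 = 1. Proof. by rewrite -(rmorph1 FFinf) PhiI_F PhiF1. Qed.
Lemma PhiI0 : PhiI 0 = 0. Proof. by rewrite -(rmorph0 FFinf) PhiI_F PhiF0. Qed.
Lemma PhiI_A (a : A) : PhiI (FFinf (a : F)) = phi a.
Proof. by rewrite PhiI_F PhiF_A. Qed.

Lemma PhiI_neq0 x : x != 0 -> PhiI x != 0.
Proof.
move=> x0; have : PhiI x * PhiI x^-1 = 1 by rewrite -PhiIM mulfV ?PhiI1.
by apply: contra_eq_neq => ->; rewrite mul0r eq_sym oner_neq0.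
Qed.

Lemma PhiI_ldeg x o : ordinf x = o%:E -> x != 0 -> ldeg (PhiI x) = - (e%:Z * o).
Proof.
move=> eo x0; pose y := apx x (o + 1).
have ay := apxP x (o + 1); rewrite -/y in ay.
have a1 := PhiI_ap ay.
have y0 : y != 0.
  apply/eqP => y0; move: ay; rewrite y0 rmorph0 subr0 /vge eo lee_fin; lia.
have [o' eo'] := dval_fin hord y0.
have oo' : o' = o.
  have hy : vge ordinf o (FFinf y).
    have -> : FFinf y = x - (x - FFinf y) by ring.
    by apply: vgeB => //; [rewrite /vge eo|apply: vge_le ay; lia].
  have hx : vge ordinf (Num.min o' (o + 1)) x.
    have -> : x = FFinf y + (x - FFinf y) by ring.
    apply: vgeD => //; last by apply: vge_le ay; lia.
    by rewrite /vge ordE eo' lee_fin; lia.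
  move: hy hx; rewrite /vge ordE eo' eo !lee_fin; lia.
have dy := hdeg eo' y0; rewrite oo' in dy.
have [y1 hy] := ldegP (PhiF_neq0 y0); rewrite dy in y1 hy.
have lt : - (e%:Z * (o + 1)) < - (e%:Z * o) by nia.
have -> : PhiI x = PhiF y + (PhiI x - PhiF y) by rewrite addrC subrK.
apply: ldeg_uniq; first by rewrite lcoefD [X in _ + X]a1 // addr0.
by apply: ldleD => //; apply: ldle_trans a1 _; apply: ltW.
Qed.

Lemma PhiI_ord x : ord_tauV (PhiI x) = (e%:Z%:E * ordinf x)%E.
Proof.
rewrite /ord_tauV; have [->|x0] := eqVneq x 0.
  by rewrite PhiI0 eqxx (dval0 hv) gt0_muley // lte_fin ltz_nat.
rewrite (negbTE (PhiI_neq0 x0)); have [o eo] := dval_fin hv x0.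
by rewrite (PhiI_ldeg eo x0) opprK eo.
Qed.

Lemma PhiI_comm x y : PhiI x * PhiI y = PhiI y * PhiI x.
Proof. by rewrite -!PhiIM mulrC. Qed.

Lemma PhiI_uniq (Phi : Finf -> lau) : (forall x y, Phi (x - y) = Phi x - Phi y) ->
  (forall x y, Phi (x * y) = Phi x * Phi y) ->
  (forall a : A, Phi (FFinf (a : F)) = phi a) ->
  (forall x, ord_tauV (Phi x) = (e%:Z%:E * ordinf x)%E) -> forall x, Phi x = PhiI x.
Proof.
move=> PB PM PA Pord x.
have PF y : Phi (FFinf y) = PhiF y.
  have [a [b [b0 eb]]] := frac_A y.
  by apply: (PhiF_uniq b0 eb); rewrite -!PA -PM -rmorphM eb.
apply: lau_small => K; pose y := apx x K%:Z.
have ay := apxP x K%:Z; rewrite -/y in ay.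
have -> : Phi x - PhiI x = (Phi x - PhiF y) - (PhiI x - PhiF y).
  by rewrite opprB addrA subrK.
apply: (@ldle_trans _ _ _ _ (- (e%:Z * K%:Z))); last by nia.
apply: ldleB; last exact: PhiI_ap.
rewrite -PF -PB; set z := x - FFinf y in ay *.
have [->|P0] := eqVneq (Phi z) 0; first exact: ldle0.
have z0 : z != 0.
  apply: contraNneq P0 => ->; rewrite -(subrr (0 : Finf)) PB subrr; exact/eqP.
have [o eo] := dval_fin hv z0.
have := Pord z; rewrite /ord_tauV (negbTE P0) eo -EFinM => -[] ez.
have [_ h] := ldegP P0; apply: ldle_trans h _.
by move: ay; rewrite /vge eo lee_fin; nia.
Qed.

Lemma PhiI_coefs (S : set M) : S 1 -> (forall x y, S x -> S y -> S (x - y)) ->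
  (forall x y, S x -> S y -> S (x * y)) -> (forall x, S x -> S x^-1) ->
  (forall i x, S x -> S (Fr i x)) -> (forall a, lcoefs_in S (phi a)) ->
  forall x, lcoefs_in S (PhiI x).
Proof.
move=> S1 SB SM SV SF hphi x i; rewrite /= /PhiI_subproof; set y := apx _ _.
have [a [b [b0 eb]]] := frac_A y.
have u : phi b \is a GRing.unit by rewrite lau_unitE phi_neq.
have -> : PhiF y = phi a * (phi b)^-1 by rewrite -(PhiFP b0 eb) mulrK.
by apply: (lcoefs_inM S1 SB SM SF) => //; apply: (lcoefs_inV S1 SB SM SV SF).
Qed.

(** * The residue field and its degree *)

Let lam x := PhiI x 0.

Let lamM x y : vge ordinf 0 x -> vge ordinf 0 y -> lam (x * y) = lam x * lam y.
Proof.
move=> hx hy; have ax := PhiI_vge hx; have ay := PhiI_vge hy.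
rewrite mulr0 oppr0 in ax ay.
by have := lcoefM_top ax ay; rewrite addr0 frobz0 => <-; rewrite /lam PhiIM.
Qed.

Let lamB x y : lam (x - y) = lam x - lam y. Proof. by rewrite /lam PhiIB. Qed.

(** On the valuation ring [lam] is a ring morphism with kernel the maximal ideal, so it embeds the
    residue field into M. *)
Let lam_eq0 x : vge ordinf 0 x -> lam x = 0 <-> (0 < ordinf x)%E.
Proof.
have [->|x0] := eqVneq x 0; first by rewrite /lam PhiI0 (dval0 hv) ltey.
have [o eo] := dval_fin hv x0; rewrite /vge eo lee_fin lte_fin => o0.
have [h1 h2] := ldegP (PhiI_neq0 x0); rewrite (PhiI_ldeg eo x0) in h1 h2; split.
  move=> l0; rewrite lt_neqAle o0 andbT; apply: contraNneq h1 => <-.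
  by rewrite mulr0 oppr0 -/(lam x) l0.
by move=> op; apply: h2; nia.
Qed.

(** Phi x commutes with the image of a uniformizer, which has degree -e; comparing leading terms
    puts the residue field inside the field of q^e elements. *)
Let lam_per x : vge ordinf 0 x -> lam x ^+ (q ^ e) = lam x.
Proof.
move=> hx; have [_ _ _ [pi epi]] := hv.
have pi0 : pi != 0.
  by apply/eqP => p0; move: epi; rewrite p0 (dval0 hv).
have [h1 h2] := ldegP (PhiI_neq0 pi0); rewrite (PhiI_ldeg epi pi0) mulr1 in h1 h2.
have ax := PhiI_vge hx; rewrite mulr0 oppr0 in ax.
have := lcoefM_top ax h2; have := lcoefM_top h2 ax.
rewrite addr0 add0r frobz0 PhiI_comm => -> /eqP.
rewrite mulrC (inj_eq (mulIf h1)) => /eqP h3.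
by rewrite -[LHS]/(Fr e%:Z (lam x)) /lam -{1}h3 -frobzD addrN frobz0.
Qed.

Local Notation kK := (FFinf \o kF : {rmorphism k -> Finf}).

Let vge_const c : vge ordinf 0 (kK c).
Proof. by apply: (vge_periodic hv (card_gt1 k)); exact: (card_scalar_exp kK). Qed.

Let vge_comb d (b : 'I_d -> Finf) (c : {ffun 'I_d -> k}) :
  (forall i, vge ordinf 0 (b i)) -> vge ordinf 0 (\sum_i kK (c i) * b i).
Proof.
move=> hb; apply: vge_sum => // i _; rewrite -[0]/(0 + 0 : int).
exact: vgeM.
Qed.

Definition indep d (b : 'I_d -> Finf) := (forall i, vge ordinf 0 (b i)) /\
  forall c : {ffun 'I_d -> k}, (0 < ordinf (\sum_i kK (c i) * b i))%E -> c = [ffun => 0].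

Let comb_inj d (b : 'I_d -> Finf) : indep b ->
  injective (fun c : {ffun 'I_d -> k} => lam (\sum_i kK (c i) * b i)).
Proof.
move=> [hb ib] c c' /= ecc'.
have e1 : \sum_i kK ([ffun i => c i - c' i] i) * b i =
    \sum_i kK (c i) * b i - \sum_i kK (c' i) * b i.
  by rewrite -sumrB; apply: eq_bigr => i _; rewrite ffunE rmorphB mulrBl.
have := ib [ffun i => c i - c' i]; rewrite e1 => /(_ _) h.
have /h/ffunP {}h : (0 < ordinf (\sum_i kK (c i) * b i - \sum_i kK (c' i) * b i))%E.
  apply/lam_eq0; last by rewrite lamB ecc' subrr.
  by apply: vgeB => //; apply: vge_comb.
by apply/ffunP => i; have := h i; rewrite !ffunE => /eqP; rewrite subr_eq0 => /eqP.
Qed.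

Let indep_bound d (b : 'I_d -> Finf) : indep b -> (d <= e)%N.
Proof.
move=> ib; have [hb _] := ib.
have := roots_bound (k := k) (s := [seq lam (\sum_i kK (c i) * b i)
  | c : {ffun 'I_d -> k} <- enum {ffun 'I_d -> k}]) e0.
rewrite map_inj_uniq ?enum_uniq; last exact: comb_inj.
rewrite size_map -cardE card_ffun card_ord leq_exp2l ?card_gt1 //; apply=> //.
by move=> _ /mapP[c _ ->]; apply/lam_per/vge_comb.
Qed.

(** Families independent in the residue field have at most e members by [lam_per], and a longest one
    is a basis. Hence [residue_degree] is not its default value. *)
Lemma residue_basis_ex : exists d (b : 'I_d -> Finf), residue_basis kK ordinf b.
Proof.
have ex : exists d, `[< exists b : 'I_d -> Finf, indep b >].
  exists 0%N; apply/asboolP; exists (fun=> 0); split=> [i|c _]; first exact: vge0.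
  by apply/ffunP => -[].
have ub d : `[< exists b : 'I_d -> Finf, indep b >] -> (d <= e)%N.
  by move=> /asboolP[b /indep_bound].
case: (ex_maxnP ex ub) => d /asboolP[b ib] dmax.
have [hb ib2] := ib; exists d, b; split; first exact: hb.
move=> x hx; have [c hc] : exists c : {ffun 'I_d -> k}, (0 < ordinf (x - \sum_i kK (c i) * b i))%E.
  apply: contrapT => nex.
  have /dmax : `[< exists b : 'I_d.+1 -> Finf, indep b >]; last by rewrite ltnn.
  apply/asboolP; exists (fun i => oapp b x (unlift ord0 i)); split.
    by move=> i; case: (unlift ord0 i) => [j|] //=; apply: hb.
  move=> c; rewrite big_ord_recl unlift_none -[oapp b x None]/x.
  rewrite (eq_bigr (fun i => kK (c (lift ord0 i)) * b i)); last by move=> i _; rewrite liftK.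
  have [c0|c0] := eqVneq (c ord0) 0.
    rewrite c0 rmorph0 mul0r add0r => h.
    have /ib2 : (0 < ordinf (\sum_i kK ([ffun i : 'I_d => c (lift ord0 i)] i) * b i))%E.
      by move: h; congr (_ < ordinf _)%E; apply: eq_bigr => i _; rewrite ffunE.
    move=> /ffunP hc0; apply/ffunP => i; rewrite !ffunE.
    by case: (unliftP ord0 i) => [j ->|->] //; have := hc0 j; rewrite !ffunE.
  move=> h; case: nex; exists [ffun i => - (c (lift ord0 i) / c ord0)].
  have -> : x - \sum_i kK ([ffun i => - (c (lift ord0 i) / c ord0)] i) * b i =
     (kK (c ord0))^-1 * (kK (c ord0) * x + \sum_i kK (c (lift ord0 i)) * b i).
    rewrite mulrDr mulKf ?fmorph_eq0 // mulr_sumr; congr (_ + _).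
    rewrite -sumrN; apply: eq_bigr => i _; rewrite ffunE rmorphN rmorphM fmorphV.
    by rewrite mulNr opprK mulrCA mulrA.
  rewrite (dvalM hv); have -> : ordinf (kK (c ord0))^-1 = 0%E; last by rewrite add0e.
  have k0 : kK (c ord0) != 0 by rewrite fmorph_eq0.
  have [o eo] := dval_fin hv k0; have kV0 := invr_neq0 k0.
  have [o' eo'] := dval_fin hv kV0.
  have o0 : 0 <= o by have := vge_const (c ord0); rewrite /vge eo lee_fin.
  have o'0 : 0 <= o'.
    have := vge_const (c ord0)^-1; rewrite /vge.
    have -> : kK (c ord0)^-1 = (kK (c ord0))^-1 by exact: (fmorphV kK).
    by rewrite eo' lee_fin.
  have := dvalM hv (kK (c ord0)) (kK (c ord0))^-1; rewrite eo eo' mulfV // (dval1 hv).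
  by rewrite -EFinD => -[] h0; congr EFin; lia.
exists c; split=> // c' hc'; apply: (comb_inj ib).
have pos (c1 : {ffun 'I_d -> k}) : (0 < ordinf (x - \sum_i kK (c1 i) * b i))%E -> lam (\sum_i kK (c1 i) * b i) = lam x.
  move=> h; have : lam (x - \sum_i kK (c1 i) * b i) = 0.
    by apply/lam_eq0 => //; apply: vgeB => //; apply: vge_comb.
  by rewrite lamB => /eqP; rewrite subr_eq0 => /eqP.
by rewrite /= !pos.
Qed.

(** [lam] carries the residue field onto q^d elements fixed by the q^d-th and the q^e-th power maps,
    hence by the q^r-th with r = e mod d; for r > 0 there are at most q^r such elements. *)
Lemma residue_dvd d (b : 'I_d -> Finf) : residue_basis kK ordinf b -> (d %| e)%N.
Proof.
move=> [hb hres].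
pose G (c : {ffun 'I_d -> k}) := lam (\sum_i kK (c i) * b i).
have Ginj : injective G.
  apply: comb_inj; split=> // c hc.
  have [] := hres 0 (vge0 hv 0).
  move=> c0 [h0 uq]; rewrite -(uq [ffun => 0]); last first.
    rewrite big1 ?subr0 ?(dval0 hv) ?ltey // => i _.
    by rewrite ffunE rmorph0 mul0r.
  by symmetry; apply: uq; rewrite sub0r (dvalN _ hv).
have Gsur x : vge ordinf 0 x -> exists c, G c = lam x.
  move=> hx; have [c [hc _]] := hres x hx; exists c; rewrite /G.
  have : lam (x - \sum_i kK (c i) * b i) = 0.
    by apply/lam_eq0 => //; apply: vgeB => //; apply: vge_comb.
  by rewrite lamB => /eqP; rewrite subr_eq0 => /eqP.
pose s := [seq G c | c <- enum {ffun 'I_d -> k}].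
have us : uniq s by rewrite map_inj_uniq ?enum_uniq.
have ss : size s = (q ^ d)%N by rewrite size_map -cardE card_ffun card_ord.
have sP y : y \in s -> exists2 x, vge ordinf 0 x & y = lam x.
  by move=> /mapP[c _ ->]; exists (\sum_i kK (c i) * b i) => //; apply: vge_comb.
have Ps x : vge ordinf 0 x -> lam x \in s.
  by move=> /Gsur[c <-]; apply/mapP; exists c; rewrite ?mem_enum.
have s0 : 0 \in s.
  have -> : 0 = lam 0 by rewrite /lam PhiI0.
  exact/Ps/vge0.
have s1 : 1 \in s.
  have -> : 1 = lam 1 by rewrite /lam PhiI1.
  exact/Ps/vge1.
have fermat y : y \in s -> y ^+ (q ^ d) = y.
  move=> ys; rewrite -ss; apply: fermat_seq => // _ _ /sP[x hx ->] /sP[x' hx' ->].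
  by rewrite -lamM //; apply: Ps; rewrite -[0]/(0 + 0 : int); apply: vgeM.
have d0 : (0 < d)%N.
  rewrite lt0n; apply/eqP => dz; move: ss; rewrite dz expn0.
  case: (s) s0 s1 => [|a [|//]] //; rewrite !inE => /eqP <- /eqP h _.
  by move/eqP: h; rewrite oner_eq0.
have fermatM y a : y \in s -> y ^+ (q ^ (a * d)) = y.
  move=> ys; elim: a => [|a IH]; first by rewrite mul0n expn0 expr1.
  by rewrite mulSn expnD exprM fermat.
rewrite /dvdn; apply/eqP/eqP; rewrite -leqn0 leqNgt; apply/negP => r0.
have := roots_bound (k := k) r0 us; rewrite ss => /(_ _).
rewrite leq_exp2l ?card_gt1 // leqNgt ltn_mod d0 => /(_ _)/negP; apply=> // y ys.
have [x hx ey] := sP _ ys; have := lam_per hx; rewrite -ey {1}(divn_eq e d).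
by rewrite expnD exprM fermatM.
Qed.

Lemma extension_props : exists Phi : Finf -> lau,
  [/\ forall x y, Phi (x - y) = Phi x - Phi y, forall x y, Phi (x * y) = Phi x * Phi y,
      Phi 1 = 1 & forall a : A, Phi (FFinf (a : F)) = phi a] /\
  [/\ forall x, ord_tauV (Phi x) = (e%:Z%:E * ordinf x)%E,
      forall N x, vge ordinf N x -> ldle (Phi x) (- (e%:Z * N)),
      forall S : set M, S 1 -> (forall x y, S x -> S y -> S (x - y)) ->
        (forall x y, S x -> S y -> S (x * y)) -> (forall x, S x -> S x^-1) ->
        (forall i x, S x -> S (Fr i x)) -> (forall a, lcoefs_in S (phi a)) ->
        forall x, lcoefs_in S (Phi x) &
      forall Phi' : Finf -> lau, (forall x y, Phi' (x - y) = Phi' x - Phi' y) ->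
        (forall x y, Phi' (x * y) = Phi' x * Phi' y) ->
        (forall a : A, Phi' (FFinf (a : F)) = phi a) ->
        (forall x, ord_tauV (Phi' x) = (e%:Z%:E * ordinf x)%E) -> forall x, Phi' x = Phi x].
Proof.
exists PhiI; split; first by split; [exact: PhiIB|exact: PhiIM|exact: PhiI1|exact: PhiI_A].
by split; [exact: PhiI_ord|exact: PhiI_vge|exact: PhiI_coefs|exact: PhiI_uniq].
Qed.

End Completion.
End Extension.

(** * Fixed field of the Weil group *)

Section Constants.
Variables (k : finFieldType) (E : fieldType) (j : {rmorphism k -> E}).
Local Notation q := #|k|.

(** All powers of x lie in a finite k-space, so two of the x^(q^i) coincide. *)
Lemma algebraic_periodic x : algebraicOver j x -> exists r, x ^+ (q ^ r.+1) = x.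
Proof.
move=> [p p0 px]; pose V := kspan j [seq x ^+ i | i <- iota 0 (size p)].
have xV i : x ^+ i \in V.
  have e := divp_eq 'X^i p; move/(congr1 (fun f : {poly k} => (map_poly j f).[x])): e.
  rewrite rmorphD rmorphM /= map_polyXn hornerXn hornerD hornerM.
  rewrite (rootP px) mulr0 add0r => ->.
  have sz : (size (map_poly j ('X^i %% p)) <= size p)%N.
    by rewrite size_map_poly ltnW // ltn_modp.
  rewrite (horner_coef_wide _ sz) -(big_mkord xpredT (fun l => _`_l * x ^+ l)).
  rewrite big_nat; apply: (big_ind (fun z => z \in V)) => [|a b|l /andP[_ lp]]; [exact: kspan0|exact: kspanD|].
  rewrite coef_map; apply/kspanZ/kspan_mem/map_f.
  by rewrite mem_iota.
have [a [b [ab e]]] := pigeonhole (fun i => xV (q ^ i)%N).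
exists (b - a).-1; rewrite prednK ?subn_gt0 //; apply: (@frob_inj _ _ j a) => /=.
by rewrite -exprM -expnD subnK ?(ltnW ab).
Qed.

Lemma periodic_algebraic x r : x ^+ (q ^ r.+1) = x -> algebraicOver j x.
Proof.
move=> e; have q1 : (1 < q ^ r.+1)%N by rewrite -(exp1n r.+1) ltn_exp2r // card_gt1.
exists ('X^(q ^ r.+1) - 'X).
  by rewrite -size_poly_eq0 size_polyDl ?size_polyXn // size_polyN size_polyX.
by rewrite rootE rmorphB /= map_polyXn map_polyX !hornerE /= e subrr.
Qed.

End Constants.

Lemma constant_field (k : finFieldType) (L : fieldType) (kL : {rmorphism k -> L}) :
  finitely_generated_field L -> exists (s : nat) (K : seq L),
  [/\ (0 < s)%N, uniq K, size K = (#|k| ^ s)%N,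
      forall c, c \in K <-> algebraicOver kL c & forall c, c \in K -> c ^+ (#|k| ^ s) = c].
Proof.
move=> hL; have [V hV] := constants_finite kL hL.
pose V' := [seq c <- V | `[< algebraicOver kL c >]].
have V'P c : c \in V' <-> algebraicOver kL c.
  rewrite mem_filter; split=> [/andP[/asboolP]|h] //; apply/andP; split; first exact/asboolP.
  by have [r /hV] := algebraic_periodic h.
have [s' [us' es]] := kspan_free kL V'.
have KP c : c \in kspan kL s' <-> algebraicOver kL c.
  rewrite -es; split=> [|/V'P]; last exact: kspan_mem.
  move: c; apply: kspan_ind => [|a x z /V'P hx hz]; first exact: algebraic0.
  by apply: algebraic_add => //; apply: algebraic_mul => //; apply: algebraic_id.
have fer c : c \in kspan kL s' -> c ^+ (#|k| ^ size s') = c.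
  rewrite -(size_kspan kL); apply: fermat_seq => //; first exact/KP/algebraic0.
  by move=> a b /KP ha /KP hb; apply/KP/algebraic_mul.
exists (size s'), (kspan kL s'); split=> //; last exact: size_kspan.
rewrite lt0n; apply/negP => /eqP/size0nil e.
have /KP := algebraic1 kL; rewrite e inE oner_eq0; exact.
Qed.

(** * Extension of partial isomorphisms to automorphisms *)

Section Graphs.
Variable M : closedFieldType.
Local Notation MM := (M * M)%type.

(** The graph of an isomorphism between two subrings of M, encoded as a subring of M x M on which
    both projections are injective. *)
Definition graph (G : set MM) := [/\ G 1, forall a b, G a -> G b -> G (a - b),
  forall a b, G a -> G b -> G (a * b) & forall a, G a -> a.1 = 0 <-> a.2 = 0].

Definition swap (G : set MM) : set MM := [set z | G (z.2, z.1)].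

Lemma graph_swap G : graph G -> graph (swap G).
Proof.
move=> [G1 GB GM G0]; split=> [|[a b] [c d] /GB h /h //|[a b] [c d] /GM h /h //|a].
  exact: G1.
by move=> /G0 /= h; tauto.
Qed.

Definition gfrac (G : set MM) : set MM :=
  [set z | exists a b, [/\ G a, G b, b.1 != 0 & z = (a.1 / b.1, a.2 / b.2)]].

Lemma gfrac_graph G : graph G -> graph (gfrac G) /\ G `<=` gfrac G.
Proof.
move=> [G1 GB GM G0]; have nz b : G b -> b.1 != 0 -> b.2 != 0.
  by move=> /G0 h; apply: contra => /eqP/h ->.
split; last first.
  by move=> [a b] h; exists (a, b), 1; split=> //=; rewrite ?oner_neq0 ?divr1.
split.
- by exists 1, 1; split=> //=; rewrite ?oner_neq0 ?divr1.
- move=> _ _ [a [b [ha hb b0 ->]]] [c [d [hc hd d0 ->]]].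
  have b2 := nz _ hb b0; have d2 := nz _ hd d0.
  exists (a * d - c * b), (b * d); split; first by apply: GB; apply: GM.
  + exact: GM.
  + by rewrite mulf_neq0.
  + by congr (_, _) => /=; field; apply/andP.
- move=> _ _ [a [b [ha hb b0 ->]]] [c [d [hc hd d0 ->]]].
  exists (a * c), (b * d); split; [exact: GM|exact: GM|by rewrite mulf_neq0|].
  by congr (_, _) => /=; rewrite mulf_div.
- move=> _ [a [b [ha hb b0 ->]]] /=; have b2 := nz _ hb b0.
  split=> /eqP; rewrite mulf_eq0 invr_eq0 ?(negbTE b0) ?(negbTE b2) orbF => /eqP/(G0 _ ha) ->;
    by rewrite mul0r.
Qed.

Section Adjoin.
Variable G : set MM.
Hypotheses (hG : graph G) (GV : forall a, G a -> G (a.1^-1, a.2^-1)).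

(** A polynomial over M x M with coefficients in G is a polynomial over the source of the
    isomorphism together with its transport to the target. *)
Let pG (p : {poly MM}) := forall i, G p`_i.

Let G0 : G 0. Proof. by case: hG => G1 GB _ _; rewrite -(subrr (1 : MM)); apply: GB. Qed.
Let GB a b : G a -> G b -> G (a - b). Proof. by case: hG => _ h _ _; apply: h. Qed.
Let GN a : G a -> G (- a). Proof. by move=> h; rewrite -sub0r; apply: GB. Qed.
Let GD a b : G a -> G b -> G (a + b).
Proof. by move=> ha hb; rewrite -[b]opprK; apply/GB/GN. Qed.
Let GM a b : G a -> G b -> G (a * b). Proof. by case: hG => _ _ h _; apply: h. Qed.
Let G1 : G 1. Proof. by case: hG. Qed.
Let pGB p r : pG p -> pG r -> pG (p - r). Proof. by move=> hp hr i; rewrite coefB; apply: GB. Qed.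
Let pGD p r : pG p -> pG r -> pG (p + r). Proof. by move=> hp hr i; rewrite coefD; apply: GD. Qed.
Let G_sum I (r : seq I) (P : pred I) (F : I -> MM) :
  (forall x, P x -> G (F x)) -> G (\sum_(x <- r | P x) F x).
Proof. by move=> h; apply: (big_ind G). Qed.
Let pGM p r : pG p -> pG r -> pG (p * r).
Proof. by move=> hp hr i; rewrite coefM; apply: G_sum => l _; apply: GM. Qed.
Let pGC a : G a -> pG a%:P.
Proof. by move=> ha i; rewrite coefC; case: ifP. Qed.
Let pGX i : pG 'X^i. Proof. by move=> l; rewrite coefXn; case: eqP. Qed.

(* stands for the evaluation of either component of a polynomial over G *)
Definition evaluation (E : {poly MM} -> M) := [/\ forall p r, E (p - r) = E p - E r,
  forall p r, E (p * r) = E p * E r &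
  (forall a, G a -> E a%:P = 0 -> a = 0) /\ E 1 = 1].

Definition minimal (E : {poly MM} -> M) (P : {poly MM}) :=
  [/\ pG P, P \is monic, E P = 0 &
      forall r, pG r -> E r = 0 -> (size r < size P)%N -> r = 0].

Lemma G_unit a : G a -> a != 0 -> a.1 != 0 /\ a.2 != 0.
Proof.
move=> ha; case: hG => _ _ _ /(_ a ha) h; case: a ha h => a b /= ha h n0.
split; apply: contraNneq n0 => e; apply/eqP; congr (_, _) => //; first exact/h.
exact/h.
Qed.

Lemma minimal_ex E r : evaluation E -> pG r -> r != 0 -> E r = 0 -> exists P, minimal E P.
Proof.
move=> [EB EM _] hr r0 Er.
have ex : exists n, `[< exists P, [/\ pG P, P != 0, E P = 0 & size P = n] >].
  by exists (size r); apply/asboolP; exists r.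
case: (ex_minnP ex) => n /asboolP[P [hP P0 EP sP]] nmin.
have lG : G (lead_coef P) by apply: hP.
have l0 : lead_coef P != 0 by rewrite lead_coef_eq0.
have [l1 l2] := G_unit lG l0.
pose a : MM := ((lead_coef P).1^-1, (lead_coef P).2^-1).
have al : a * lead_coef P = 1 by rewrite /a; congr (_, _); rewrite /= mulVf.
have n0 : (0 < n)%N by rewrite -sP size_poly_gt0.
have top : (a%:P * P)`_n.-1 = 1 by rewrite coefCM -al /lead_coef sP.
have sz : size (a%:P * P) = n.
  apply/eqP; rewrite eqn_leq; apply/andP; split.
    by apply/leq_sizeP => i ni; rewrite coefCM nth_default ?mulr0 // sP.
  rewrite leqNgt; apply/negP => h; move/eqP: top; rewrite nth_default.
    by rewrite eq_sym oner_eq0.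
  by rewrite -ltnS prednK.
exists (a%:P * P); split.
- by apply: pGM => //; apply/pGC/GV.
- by rewrite monicE lead_coefE sz top.
- by rewrite EM EP mulr0.
- move=> r1 hr1 Er1; rewrite sz => lt; apply: contrapT => /eqP r10.
  have := nmin (size r1); rewrite leqNgt lt => /(_ _)/negP; apply=> //.
  by apply/asboolP; exists r1.
Qed.

Lemma minimal_div E P r : evaluation E -> minimal E P -> pG r -> E r = 0 ->
  exists2 H, pG H & r = H * P.
Proof.
move=> [EB EM _] [hP mP EP mn]; have [n] := ubnP (size r).
elim: n r => // n IH r lt hr Er.
have [sr|sr] := ltnP (size r) (size P).
  by exists 0; [move=> i; rewrite coef0|rewrite mul0r; apply: mn].
have [r0|r0] := eqVneq r 0.
  by exists 0; [move=> i; rewrite coef0|rewrite mul0r].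
pose l := (size r - size P)%N; pose h : {poly MM} := (lead_coef r)%:P * 'X^l.
have hh : pG h by apply: pGM => //; apply: pGC; apply: hr.
have sP0 : (0 < size P)%N by rewrite size_poly_gt0 monic_neq0.
have sr' : (size (r - h * P)%R < size r)%N.
  rewrite -(prednK (leq_trans sP0 sr)) ltnS; apply/leq_sizeP => i ri.
  rewrite coefB /h -mulrA coefCM coefXnM.
  have -> : (i < l)%N = false by rewrite /l; lia.
  have [e|ne] := eqVneq i (size r).-1.
    have -> : (i - l = (size P).-1)%N by rewrite e /l; lia.
    by rewrite -lead_coefE (monicP mP) mulr1 e -lead_coefE subrr.
  have i1 : (size r <= i)%N by lia.
  have i2 : (size P <= i - l)%N by rewrite /l; lia.
  by rewrite (nth_default 0 i1) (nth_default 0 i2) mulr0 subrr.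
have [|||H hH eH] := IH (r - h * P).
- by apply: leq_trans sr' _; rewrite -ltnS.
- by apply: pGB => //; apply: pGM.
- by rewrite EB EM Er EP mulr0 subr0.
exists (h + H); first exact: pGD.
by rewrite mulrDl -eH addrC subrK.
Qed.

Section Root.
Variables (x y : M) (P : {poly MM}).
Let E1 (p : {poly MM}) : M := (p.[(x, y)]).1.
Let E2 (p : {poly MM}) : M := (p.[(x, y)]).2.
Hypotheses (hP : minimal E1 P) (Py : E2 P = 0).

Let e1 : evaluation E1.
Proof.
split=> [p r|p r|]; rewrite /E1 ?hornerD ?hornerN ?hornerM //; split.
  move=> a ha; rewrite hornerC => a0; apply: contrapT => /eqP /(G_unit ha)[].
  by rewrite a0 eqxx.
by rewrite hornerC.
Qed.
Let e2 : evaluation E2.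
Proof.
split=> [p r|p r|]; rewrite /E2 ?hornerD ?hornerN ?hornerM //; split.
  move=> a ha; rewrite hornerC => a0; apply: contrapT => /eqP /(G_unit ha)[_].
  by rewrite a0 eqxx.
by rewrite hornerC.
Qed.

Lemma root_E1 r : pG r -> E1 r = 0 -> E2 r = 0.
Proof.
move=> hr /(minimal_div e1 hP hr)[H hH ->].
by case: e2 => _ -> _; rewrite Py mulr0.
Qed.

(** The minimal polynomial Q of y divides P, say P = H Q. At x either H or Q vanishes, and H is
    excluded by the minimality of P; so Q vanishes at x as well. *)
Lemma root_E2 r : pG r -> E2 r = 0 -> E1 r = 0.
Proof.
have [pP mP EP mn] := hP.
have [Q hQ] := minimal_ex e2 pP (monic_neq0 mP) Py.
have [pQ mQ EQ _] := hQ.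
suff EQ1 : E1 Q = 0.
  move=> hr /(minimal_div e2 hQ hr)[H hH ->].
  by case: e1 => _ -> _; rewrite EQ1 mulr0.
have [H hH eP] := minimal_div e2 hQ pP Py.
have : E1 H * E1 Q = 0 by case: e1 => _ <- _; rewrite -eP.
move/eqP; rewrite mulf_eq0 => /orP[|] /eqP // EH.
have H0 : H != 0 by apply: contraNneq (monic_neq0 mP) => h; rewrite eP h mul0r.
have sQ : (1 < size Q)%N.
  rewrite ltnNge; apply/negP => /size1_polyC eQ.
  have : Q = 1 by move: mQ; rewrite eQ monicE lead_coefC => /eqP ->.
  move=> Q1; move: EQ; rewrite Q1; case: e2 => _ _ [_ ->] /eqP.
  by rewrite oner_eq0.
have : H = 0.
  apply: mn => //; rewrite eP size_Mmonic //.
  by have : (0 < size H)%N; [rewrite size_poly_gt0|lia].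
by move/eqP; rewrite (negbTE H0).
Qed.

Definition adjoin : set MM := [set z | exists2 p, pG p & z = p.[(x, y)]].

Lemma adjoin_graph : [/\ graph adjoin, G `<=` adjoin & adjoin (x, y)].
Proof.
split.
- split.
  + by exists 1; [exact: (pGC G1)|rewrite hornerC].
  + move=> _ _ [p hp ->] [r hr ->]; exists (p - r); first exact: pGB.
    by rewrite hornerD hornerN.
  + move=> _ _ [p hp ->] [r hr ->]; exists (p * r); first exact: pGM.
    by rewrite hornerM.
  + by move=> _ [p hp ->]; split; [exact: root_E1|exact: root_E2].
- by move=> a ha; exists a%:P; [exact: pGC|rewrite hornerC].
- by exists 'X; [exact: (pGX 1)|rewrite hornerX].
Qed.

End Root.

(** The second coordinate is a dummy here: 0 can stand for the image y as long as it is unknown. *)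
Lemma E1_indep x y y' (p : {poly MM}) : (p.[(x, y)]).1 = (p.[(x, y')]).1.
Proof.
elim/poly_ind: p => [|p c IH]; first by rewrite !horner0.
by rewrite !hornerMXaddC /= IH.
Qed.

Lemma minimal_ext E E' P : E =1 E' -> minimal E P -> minimal E' P.
Proof. by move=> e [a b c d]; split=> // [|r hr]; rewrite -e // => h; apply: d. Qed.

(** P is the minimal polynomial of x together with its transport; each root y of the transport
    extends the isomorphism by x -> y. *)
Lemma adjoin_ex x (r : {poly MM}) : pG r -> r != 0 -> (r.[(x, 0)]).1 = 0 ->
  exists P : {poly MM}, [/\ pG P, P \is monic, (1 < size P)%N &
    forall y, (map_poly snd P).[y] = 0 ->
      exists G', [/\ graph G', G `<=` G' & G' (x, y)]].
Proof.
move=> hr r0 Er.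
have ev : evaluation (fun p : {poly MM} => (p.[(x, 0)]).1).
  split=> [p s|p s|]; rewrite ?hornerD ?hornerN ?hornerM //; split.
    move=> a ha; rewrite hornerC => a0; apply: contrapT => /eqP /(G_unit ha)[].
    by rewrite a0 eqxx.
  by rewrite hornerC.
have [P mP] := minimal_ex ev hr r0 Er.
have [pP monP EP mn] := mP; exists P; split=> //.
  rewrite ltnNge; apply/negP => /size1_polyC eP.
  have P1 : P = 1 by move: monP; rewrite eP monicE lead_coefC => /eqP ->.
  by move/eqP: EP; rewrite P1 hornerC oner_eq0.
move=> y Py; exists (adjoin x y); apply: adjoin_graph.
  by apply: minimal_ext mP => p; apply: E1_indep.
by rewrite -Py -[y]/((x, y).2) horner_map.
Qed.

End Adjoin.

Section Extend.
Variables (L : fieldType) (LM : {rmorphism L -> M}).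
Hypothesis hLM : is_algebraic_closure LM.
Variable (G0 : set MM).
Hypotheses (hG0 : graph G0) (GL : forall c, G0 (LM c, LM c)).

Lemma alg_poly (G : set MM) x : graph G -> G0 `<=` G \/ swap G0 `<=` G ->
  exists r : {poly MM}, [/\ forall i, G r`_i, r != 0 & (r.[(x, 0)]).1 = 0].
Proof.
move=> hG sub; have GL' c : G (LM c, LM c) by case: sub => h; apply: h; apply: GL.
have [p p0 px] := hLM x; exists (\poly_(i < size p) (LM p`_i, LM p`_i)); split.
- move=> i; rewrite coef_poly; case: ifP => _; first exact: GL'.
  have := GL' 0; by rewrite rmorph0.
- apply/eqP => /(congr1 (fun f : {poly MM} => f`_(size p).-1)).
  rewrite coef0 coef_poly prednK ?size_poly_gt0 // leqnn => -[] /eqP.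
  by rewrite fmorph_eq0 -lead_coefE lead_coef_eq0 (negbTE p0).
- move/rootP: px; rewrite horner_coef size_map_poly => px.
  rewrite horner_poly (big_morph fst (id1 := 0) (op1 := +%R)) //.
  apply: etrans px.
  apply: eq_bigr => i _ /=; rewrite coef_map; congr (_ * _).
  by elim: (i : nat) => // l IH; rewrite !exprS /= IH.
Qed.

(** A maximal graph above G0 is closed under inverses, total by [adjoin_ex], and onto by the same
    argument for the inverse isomorphism. *)
Lemma aut_extend : exists s : {rmorphism M -> M}, bijective s /\
  forall z, G0 z -> s z.1 = z.2.
Proof.
pose Pz : set (set MM) := [set G | G = set0 \/ (G0 `<=` G /\ graph G)].
have [|G [[->|[sG hG]] Gmax]] := @Zorn_bigcup MM Pz.
- move=> F FP tot.
  have [[G [FG Gn0]]|nex] := pselect (exists G, F G /\ G !=set0); last first.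
    left; rewrite -subset0 => z [G FG Gz]; apply: nex; exists G; split=> //.
    by exists z.
  right; have prop G' : F G' -> G' !=set0 -> G0 `<=` G' /\ graph G'.
    by move=> /FP[->|//] [z].
  have two z w : (\bigcup_(X in F) X) z -> (\bigcup_(X in F) X) w ->
      exists G', [/\ F G', graph G', G' z & G' w].
    move=> [A FA Az] [B FB Bw]; have [AB|BA] := tot _ _ FA FB.
      by exists B; split=> //; [case: (prop B FB (ex_intro _ w Bw))|exact: AB].
    by exists A; split=> //; [case: (prop A FA (ex_intro _ z Az))|exact: BA].
  have [G0G [G1 GB GM Gz]] := prop G FG Gn0.
  split; first by move=> z /G0G h; exists G.
  split.
  + by exists G.
  + by move=> z w hz hw; have [G' [FG' [_ h _ _] ? ?]] := two _ _ hz hw; exists G' => //; apply: h.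
  + by move=> z w hz hw; have [G' [FG' [_ _ h _] ? ?]] := two _ _ hz hw; exists G' => //; apply: h.
  + by move=> z hz; have [G' [FG' [_ _ _ h] ? ?]] := two _ _ hz hz; apply: h.
- exfalso; apply: (Gmax G0); last by right; split.
  split=> // h; have [G1 _ _ _] := hG0; exact: (h _ G1).
have max G' : graph G' -> G `<=` G' -> G' `<=` G.
  move=> hG' GG'; apply: contrapT => n; apply: (Gmax G'); first by split.
  by right; split=> // z /sG /GG'.
have [gf Gf] := gfrac_graph hG.
have Gfr := max _ gf Gf.
have GV a : G a -> G (a.1^-1, a.2^-1).
  move=> ha; have [a0|a0] := eqVneq a.1 0.
    have [_ _ _ /(_ a ha)[/(_ a0) a2 _]] := hG; rewrite a0 a2 !invr0.
    by move: ha; rewrite [a]surjective_pairing a0 a2.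
  apply: Gfr; exists 1, a; split=> //; first by case: hG.
  by rewrite !div1r.
have root_ex (p : {poly MM}) : p \is monic -> (1 < size p)%N -> exists y, (map_poly snd p).[y] = 0.
  move=> mp sp; have [|y /rootP hy] := closed_rootP (map_poly snd p) _; last by exists y.
  have m2 : map_poly snd p \is monic by apply: monic_map.
  suff -> : size (map_poly snd p) = size p by rewrite neq_ltn sp orbT.
  apply/eqP; rewrite eqn_leq size_poly /= leqNgt; apply/negP => h.
  have := coef_map snd p (size p).-1; rewrite nth_default; last by rewrite -ltnS prednK //; apply: ltn_trans sp.
  by rewrite -lead_coefE (monicP mp) => /esym/eqP; rewrite oner_eq0.
have total x : exists y, G (x, y).
  have [r [hr r0 Er]] := alg_poly x hG (or_introl sG).
  have [P [pP mP sP hP]] := adjoin_ex hG GV hr r0 Er.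
  have [y hy] := root_ex P mP sP; have [G' [hG' GG' xy]] := hP y hy.
  by exists y; apply: (max G').
have onto y : exists x, G (x, y).
  have hs := graph_swap hG.
  have [r [hr r0 Er]] := alg_poly y hs (or_intror (fun z => sG (z.2, z.1))).
  have GVs a : swap G a -> swap G (a.1^-1, a.2^-1) by move=> /GV.
  have [P [pP mP sP hP]] := adjoin_ex hs GVs hr r0 Er.
  have [x hx] := root_ex P mP sP; have [G' [hG' GG' xy]] := hP x hx.
  exists x; apply: (max (swap G')); [exact: graph_swap| |exact: xy].
  by move=> [a b] h; apply: GG'.
have [s hs] := choice total.
have fun_ a b c : G (a, b) -> G (a, c) -> b = c.
  move=> hb hc; have [_ GB _ Gz] := hG; have := GB _ _ hb hc.
  by move=> /Gz /= []; rewrite subrr => /(_ erefl) /eqP; rewrite subr_eq0 => /eqP.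
have inj_ a b c : G (a, c) -> G (b, c) -> a = b.
  move=> hb hc; have [_ GB _ Gz] := hG; have := GB _ _ hb hc.
  by move=> /Gz /= [_]; rewrite subrr => /(_ erefl) /eqP; rewrite subr_eq0 => /eqP.
have sB : zmod_morphism s.
  by move=> a b; apply: (fun_ (a - b)) => //; have [_ GB _ _] := hG; apply: (GB (a, s a) (b, s b)).
have sM : monoid_morphism s.
  split=> [|a b]; have [G1 _ GM _] := hG; first exact: (fun_ 1 (s 1) 1 (hs 1) G1).
  by apply: (fun_ (a * b)) => //; apply: (GM (a, s a) (b, s b)).
pose sa := GRing.isZmodMorphism.Build M M s sB.
pose sm := GRing.isMonoidMorphism.Build M M s sM.
pose sr : {rmorphism M -> M} := HB.pack s sa sm.
exists sr; split.
  have [g hg] := choice onto; exists g => a /=.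
    by apply: (inj_ _ _ (s a)).
  by apply: (fun_ (g a)).
by move=> [a b] /= /sG h; apply: (fun_ a).
Qed.

End Extend.

(** Every root of the transported minimal polynomial of x is the image of x under an automorphism
    extending G, so x is its only root and it equals (X - x)^d. With d = p^a d' and d' prime to p,
    its coefficient of degree p^a (d' - 1) is - d' x^(p^a), where d' is invertible. *)
Lemma fixed_power (L : fieldType) (LM : {rmorphism L -> M}) (G : set MM) (p : nat) (x : M) :
  is_algebraic_closure LM -> graph G -> (forall a, G a -> G (a.1^-1, a.2^-1)) ->
  (forall c, G (LM c, LM c)) -> p \in [pchar M] ->
  (forall s : {rmorphism M -> M}, bijective s -> (forall z, G z -> s z.1 = z.2) -> s x = x) ->
  exists a, G (x ^+ (p ^ a), x ^+ (p ^ a)).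
Proof.
move=> hLM hG GV GL pM fix_x.
have [r [hr r0 Er]] := alg_poly hLM GL x hG (or_introl (fun z h => h)).
have [P [pP mP sP hP]] := adjoin_ex hG GV hr r0 Er.
pose P2 := map_poly (snd : MM -> M) P.
have roots y : P2.[y] = 0 -> y = x.
  move=> /hP[G' [hG' GG' xy]].
  have [s [bs hs]] := aut_extend hLM hG' (fun c => GG' _ (GL c)).
  by rewrite -[RHS](fix_x s bs) ?(hs _ xy) // => z /GG' /hs.
have m2 : P2 \is monic by apply: monic_map.
have [rs eP] := closed_field_poly_normal P2.
rewrite (monicP m2) scale1r in eP.
have s2 : size P2 = (size rs).+1 by rewrite eP size_prod_XsubC.
have rsE : rs = nseq (size rs) x.
  apply/all_pred1P/allP => y yrs; apply/eqP/roots/rootP.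
  by rewrite eP root_prod_XsubC.
have d0 : (0 < size rs)%N.
  rewrite -ltnS -s2; apply: (leq_trans sP); rewrite leqNgt; apply/negP => h.
  have := coef_map (snd : {rmorphism MM -> M}) P (size P).-1; rewrite nth_default; last by rewrite -ltnS prednK //; apply: ltn_trans sP.
  by rewrite -lead_coefE (monicP mP) => /esym/eqP; rewrite oner_eq0.
have p_pr := pcharf_prime pM.
have [d' cop ed] := pfactor_coprime p_pr d0.
set a := logn p (size rs) in ed; pose N := (p ^ a)%N; pose c := x ^+ N.
have N0 : (0 < N)%N by rewrite expn_gt0 prime_gt0.
have d'0 : (0 < d')%N by move: d0; rewrite ed muln_gt0 => /andP[].
have powN (u : {poly M}) (v : {poly M}) : (u - v) ^+ N = u ^+ N - v ^+ N.
  have pN : [pchar {poly M}].-nat N.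
    by rewrite (eq_pnat _ (pchar_poly M)) (eq_pnat _ (pcharf_eq pM)) pnatX pnat_id.
  by apply/eqP; rewrite eq_sym subr_eq -(exprDn_pchar _ _ pN) subrK.
have e2 : P2 = (\prod_(z <- nseq d' c) ('X - z%:P)) \Po 'X^N.
  rewrite eP rsE !big_nseq !iter_mulr_1 rmorphXn /= comp_polyB comp_polyX comp_polyC.
  by rewrite ed mulnC exprM powN polyC_exp.
have cf : P2`_(N * d'.-1) = - (c *+ d').
  rewrite e2 coef_comp_poly_Xn // dvdn_mulr // mulKn //.
  have := @coefPn_prod_XsubC M (nseq d' c); rewrite size_nseq => -> //; last by rewrite -lt0n.
  by rewrite big_nseq iter_addr_0.
have [G1 GB GM G0] := hG.
have GZ : G 0 by rewrite -(subrr (1 : MM)); apply: GB.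
have Gn n : G (n%:R, n%:R).
  have -> : ((n%:R, n%:R) : MM) = n%:R by elim: n => // n; rewrite !mulrS => <-.
  elim: n => [|n IH]; first exact: GZ.
  by rewrite mulrS -[X in _ + X]opprK; apply: (GB) => //; rewrite -sub0r; apply: GB.
have d'n : (d'%:R : M) != 0.
  by rewrite -(dvdn_pcharf pM) -prime_coprime.
pose w := P`_(N * d'.-1) * ((- (1 : MM)) * (d'%:R^-1, d'%:R^-1)).
have Gw : G w.
  apply: (GM); first exact: pP.
  apply: GM; last exact: (GV _ (Gn d')).
  by rewrite -sub0r; apply: GB.
have w2 : w.2 = c.
  rewrite /w /=; have := coef_map (snd : {rmorphism MM -> M}) P (N * d'.-1).
  rewrite -/P2 cf => /= <-; rewrite mulN1r mulrNN -mulr_natr mulfK //.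
have [s [bs hs]] := aut_extend hLM hG GL.
have w1 : w.1 = c.
  apply: (fmorph_inj s); rewrite (hs _ Gw) w2 /c rmorphXn /= fix_x //.
by exists a; have := Gw; rewrite [w]surjective_pairing w1 w2.
Qed.

End Graphs.

(** * Frobenius on the constant field extension of L *)

Section Descent.
Variables (k : finFieldType) (L : fieldType) (kL : {rmorphism k -> L}).
Variables (Lbar : closedFieldType) (LLbar : {rmorphism L -> Lbar}).
Hypothesis hLbar : is_algebraic_closure LLbar.
Variables (s : nat) (K : seq L).
Hypotheses (s0 : (0 < s)%N) (uK : uniq K) (sK : size K = (#|k| ^ s)%N)
  (KP : forall c, c \in K <-> algebraicOver kL c)
  (Kfix : forall c, c \in K -> c ^+ (#|k| ^ s) = c).

Local Notation kM := (LLbar \o kL : {rmorphism k -> Lbar}).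
Local Notation Fr := (frobz kM).
Local Notation q := #|k|.
Local Notation Q := (#|k| ^ s)%N.
Local Notation ev P z := ((map_poly LLbar P).[z]).

Definition per (z : Lbar) := exists r, z ^+ (q ^ r.+1) = z.

Lemma perX z n : per z -> per (z ^+ n).
Proof. by move=> [r e]; exists r; rewrite exprAC e. Qed.

Lemma per_mul (z : Lbar) R n : z ^+ (q ^ R) = z -> z ^+ (q ^ (R * n)) = z.
Proof.
move=> e; elim: n => [|n IH]; first by rewrite muln0 expn0 expr1.
by rewrite mulnS expnD exprM e.
Qed.

Lemma fixed_inL c : c ^+ Q = c -> inL LLbar c.
Proof.
move=> ec; apply: contrapT => nc.
have u : uniq (c :: map LLbar K).
  rewrite /= map_inj_uniq ?uK ?andbT; last exact: fmorph_inj.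
  by apply/negP => /mapP[d _ e]; apply: nc; exists d.
have := roots_bound (k := k) s0 u; rewrite /= size_map sK ltnn => h.
suff : false by []; apply: h => x; rewrite inE => /orP[/eqP -> //|/mapP[d dK ->]].
by rewrite -rmorphXn /= Kfix.
Qed.

Lemma periodic_fixed c r : LLbar c ^+ (q ^ r.+1) = LLbar c -> LLbar c ^+ Q = LLbar c.
Proof.
rewrite -!rmorphXn => /fmorph_inj e; congr (LLbar _).
by apply: Kfix; apply/KP; apply: periodic_algebraic e.
Qed.

(** z and z^Q are conjugate over L. The gcd of P with X^(q^(r+1)) - X, made monic, has coefficients
    that lie in L and are algebraic over k, hence are fixed by the Q-th power map; this map
    therefore sends its roots to roots. *)
Lemma ev_min P z : per z -> ev P z = 0 -> ev P (z ^+ Q) = 0.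
Proof.
move=> [r ez] Pz; pose X0 : {poly L} := 'X^(q ^ r.+1) - 'X.
have evX y : ev X0 y = y ^+ (q ^ r.+1) - y.
  by rewrite rmorphB /= map_polyXn map_polyX !hornerE.
have X00 : X0 != 0.
  have q1 : (1 < q ^ r.+1)%N by rewrite -(exp1n r.+1) ltn_exp2r // card_gt1.
  by rewrite -size_poly_eq0 size_polyDl ?size_polyXn // size_polyN size_polyX.
pose g := gcdp P X0; have g0 : g != 0 by rewrite gcdp_eq0 negb_and X00 orbT.
pose g1 := (lead_coef g)^-1 *: g.
have l0 : (lead_coef g)^-1 != 0 by rewrite invr_eq0 lead_coef_eq0.
have mg : map_poly LLbar g1 \is monic.
  by rewrite map_monic monicE /g1 lead_coefZ mulVf // lead_coef_eq0.
have dvd1 : g1 %| X0 by rewrite /g1 dvdpZl // dvdp_gcdr.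
have gz : ev g1 z = 0.
  rewrite /g1 map_polyZ hornerZ; apply/eqP; rewrite mulf_eq0; apply/orP; right.
  by rewrite -rootE gcdp_map root_gcd !rootE Pz evX ez subrr eqxx.
have [rs eg] := closed_field_poly_normal (map_poly LLbar g1).
rewrite (monicP mg) scale1r in eg.
have rsfix y : y \in rs -> Fr r.+1 y = y.
  move=> yrs; have : root (map_poly LLbar X0) y.
    rewrite -dvdp_XsubCl; apply: (@dvdp_trans _ (map_poly LLbar g1)); last by rewrite dvdp_map.
    by rewrite dvdp_XsubCl eg root_prod_XsubC.
  by rewrite rootE evX subr_eq0 => /eqP.
have mfix : map_poly (Fr r.+1) (map_poly LLbar g1) = map_poly LLbar g1.
  rewrite eg rmorph_prod /=; apply: eq_big_seq => y yrs.
  by rewrite rmorphB /= map_polyX map_polyC; congr ('X - _%:P); apply: rsfix.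
have cfix i : Fr r.+1 (map_poly LLbar g1)`_i = (map_poly LLbar g1)`_i.
  by rewrite -[in RHS]mfix [RHS]coef_map.
have cfixQ i : Fr s (map_poly LLbar g1)`_i = (map_poly LLbar g1)`_i.
  by rewrite coef_map; apply: (@periodic_fixed _ r); have := cfix i; rewrite coef_map.
have e1 : ev g1 (z ^+ Q) = 0.
  have -> : map_poly LLbar g1 = map_poly (Fr s) (map_poly LLbar g1).
    by apply/polyP => i; rewrite [RHS]coef_map; apply/esym/cfixQ.
  by rewrite -[z ^+ Q]/(Fr s z) horner_map gz rmorph0.
have : root (map_poly LLbar P) (z ^+ Q).
  rewrite -dvdp_XsubCl; apply: (@dvdp_trans _ (map_poly LLbar g1)); last first.
    by rewrite dvdp_map /g1 dvdpZl // dvdp_gcdl.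
  by rewrite dvdp_XsubCl rootE e1.
by move/rootP.
Qed.

Lemma iterQ (z : Lbar) j : z ^+ (q ^ (s * j.+1)) = (z ^+ (q ^ (s * j))) ^+ Q.
Proof. by rewrite -exprM -expnD mulnS addnC. Qed.

Lemma ev_iter P z j : per z -> ev P z = 0 -> ev P (z ^+ (q ^ (s * j))) = 0.
Proof.
move=> hz Pz; elim: j => [|j IH]; first by rewrite muln0 expn0 expr1.
by rewrite iterQ; apply: ev_min => //; apply: perX.
Qed.

Lemma orbit_back z j : per z -> exists j', z = (z ^+ (q ^ (s * j))) ^+ (q ^ (s * j')).
Proof.
move=> [r e]; exists (j * r)%N; rewrite -exprM -expnD.
have -> : (s * j + s * (j * r) = r.+1 * (s * j))%N by lia.
by rewrite per_mul.
Qed.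

Lemma ev_back P z j : per z -> ev P (z ^+ (q ^ (s * j))) = 0 -> ev P z = 0.
Proof.
move=> hz h; have [j' ->] := orbit_back j hz.
by apply: ev_iter => //; apply: perX.
Qed.

(** z generates the multiplicative group of the field with q^R elements; any two constants can thus
    be written as polynomials in a single one. *)
Lemma prim_ex R : (0 < R)%N -> exists2 z : Lbar, z ^+ (q ^ R) = z &
  forall y : Lbar, y ^+ (q ^ R) = y -> y = 0 \/ exists i, y = z ^+ i.
Proof.
move=> R0; have q1 : (1 < q ^ R)%N by rewrite -(exp1n R) ltn_exp2r // card_gt1.
pose n := (q ^ R).-1; have n0 : (0 < n)%N by rewrite /n; lia.
have nS : n.+1 = (q ^ R)%N by rewrite /n; lia.
have qR0 : ((q ^ R)%:R : Lbar) = 0.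
  have [p p_pr pk] := finPcharP k.
  have pM : p \in [pchar Lbar] by rewrite (fmorph_pchar kM).
  apply/eqP; rewrite -(dvdn_pcharf pM).
  have := pchar_nat_card kM R; rewrite (eq_pnat _ (pcharf_eq pM)) => /p_natP[e ee].
  by rewrite ee; case: e ee => [|e] ee; [move: q1; rewrite ee|rewrite expnS dvdn_mulr].
have nn : (n%:R : Lbar) != 0.
  move: qR0; rewrite -nS -natr1 => /eqP; rewrite addr_eq0 => /eqP ->.
  by rewrite oppr_eq0 oner_neq0.
have sep := separable_Xn_sub_1 nn.
have [rs ers] := closed_field_poly_normal ('X^n - 1 : {poly Lbar}).
have l1 : lead_coef ('X^n - 1 : {poly Lbar}) = 1 by apply/monicP/monicXnsubC.
rewrite l1 scale1r in ers.
have urs : uniq rs by rewrite -separable_prod_XsubC -ers.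
have srs : size rs = n.
  by apply: succn_inj; rewrite -(size_prod_XsubC rs id) -ers size_XnsubC.
have ars : all n.-unity_root rs.
  by apply/allP => y yrs; have -> : n.-unity_root y = root ('X^n - 1) y by []; rewrite ers root_prod_XsubC.
have /hasP[z _ hz] : has n.-primitive_root rs by apply: has_prim_root; rewrite ?srs.
exists z; first by rewrite -nS exprS (prim_expr_order hz) mulr1.
move=> y; have [->|y0] := eqVneq y 0; [by left|move=> ey; right].
have : y ^+ n = 1 by apply: (mulfI y0); rewrite -exprS nS ey mulr1.
by move=> /(prim_rootP hz)[i ->]; exists i.
Qed.

(** The graph of the L-automorphism of L kbar that raises constants to the power Q = q^s, the number
    of constants of L. All its extensions to automorphisms of Lbar lie in the Weil group, in degree
    s. *)
Definition constant_graph : set (Lbar * Lbar) :=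
  [set w | exists P z, per z /\ w = (ev P z, ev P (z ^+ Q))].

Lemma constant_graph2 w w' : constant_graph w -> constant_graph w' ->
  exists P P' z, [/\ per z, w = (ev P z, ev P (z ^+ Q)) & w' = (ev P' z, ev P' (z ^+ Q))].
Proof.
move=> [P [y [[r ey] ->]]] [P' [y' [[r' ey'] ->]]].
have [//|z ez hz] := @prim_ex (r.+1 * r'.+1)%N.
have rep (R : {poly L}) u : u ^+ (q ^ (r.+1 * r'.+1)) = u ->
    exists R', ev R' z = ev R u /\ ev R' (z ^+ Q) = ev R (u ^+ Q).
  move=> /hz[->|[i ->]].
    exists (R.[0])%:P; rewrite map_polyC !hornerC expr0n eqn0Ngt card_exp_gt0 /=.
    by rewrite -horner_map rmorph0.
  exists (R \Po 'X^i); rewrite map_comp_poly /= map_polyXn !horner_comp !hornerXn.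
  by rewrite -exprM mulnC exprM.
have [R [e1 e2]] := rep P y (per_mul _ ey).
have ey2 : y' ^+ (q ^ (r.+1 * r'.+1)) = y' by rewrite mulnC per_mul.
have [R' [e3 e4]] := rep P' y' ey2.
exists R, R', z; rewrite e1 e2 e3 e4; split=> //.
by exists (r.+1 * r'.+1).-1; rewrite prednK.
Qed.

Lemma constant_graph_graph : graph constant_graph.
Proof.
split.
- exists 1, 0; split; first by exists 0%N; rewrite expr0n eqn0Ngt card_exp_gt0.
  by rewrite rmorph1 !hornerC.
- move=> w w' hw hw'; have [P [P' [z [hz -> ->]]]] := constant_graph2 hw hw'.
  by exists (P - P'), z; split=> //; rewrite rmorphB /= !hornerD !hornerN.
- move=> w w' hw hw'; have [P [P' [z [hz -> ->]]]] := constant_graph2 hw hw'.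
  by exists (P * P'), z; split=> //; rewrite rmorphM /= !hornerM.
- move=> _ [P [z [hz ->]]] /=; split; first exact: ev_min.
  by move=> h; apply: (@ev_back P z 1); rewrite ?muln1.
Qed.

(** m has the conjugates z, z^Q, z^(Q^2), ... as roots; its coefficients are fixed by the Q-th power
    map, hence in L by [fixed_inL]. *)
Lemma orbit_poly z : per z -> exists (m : {poly L}) (O : seq Lbar), [/\ uniq O, z \in O,
  map_poly LLbar m = \prod_(y <- O) ('X - y%:P) &
  forall y, y \in O -> exists j, y = z ^+ (q ^ (s * j))].
Proof.
move=> [r ez]; pose O := undup [seq z ^+ (q ^ (s * j)) | j <- iota 0 r.+1].
have OP y : y \in O -> exists2 j, (j < r.+1)%N & y = z ^+ (q ^ (s * j)).
  by rewrite mem_undup => /mapP[j]; rewrite mem_iota => /andP[_ jr] ->; exists j.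
have inO j : (j < r.+1)%N -> z ^+ (q ^ (s * j)) \in O.
  by move=> jr; rewrite mem_undup; apply/mapP; exists j; rewrite ?mem_iota.
have zO : z \in O by have := @inO 0%N isT; rewrite muln0 expn0 expr1.
have uO : uniq O := undup_uniq _.
pose mO := \prod_(y <- O) ('X - y%:P).
have mfix : map_poly (Fr s) mO = mO.
  rewrite /mO rmorph_prod /=.
  transitivity (\prod_(y <- map (Fr s) O) ('X - y%:P)).
    by rewrite big_map; apply: eq_bigr => y _; rewrite rmorphB /= map_polyX map_polyC.
  apply: perm_big; have um : uniq (map (Fr s) O) by rewrite map_inj_uniq //; apply: fmorph_inj.
  have sub : {subset map (Fr s) O <= O}.
    move=> _ /mapP[y /OP[j jr ->] ->]; rewrite [Fr s _]/= -iterQ.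
    have [jr'|] := ltnP j.+1 r.+1; first exact: inO.
    move=> rj; have -> : j.+1 = r.+1 by lia.
    by rewrite mulnC per_mul.
  have [|_ e] := uniq_min_size um sub; first by rewrite size_map.
  exact: uniq_perm.
have mL i : exists c, mO`_i = LLbar c.
  by apply: fixed_inL; rewrite -{2}mfix coef_map.
have [c hc] := choice mL.
exists (\poly_(i < size mO) c i), O; split=> //; last by move=> y /OP[j _ ->]; exists j.
apply/polyP => i; rewrite coef_map coef_poly -/mO; case: ltnP => [_|h]; first by rewrite hc.
by rewrite (nth_default 0 h); apply: rmorph0.
Qed.

(** If P does not vanish at z it vanishes at no conjugate of z, so it is invertible modulo the orbit
    polynomial. *)
Lemma constant_graphV w : constant_graph w -> constant_graph (w.1^-1, w.2^-1).
Proof.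
move=> [P [z [hz ->]]] /=.
have [P0|P0] := eqVneq (ev P z) 0.
  have P1 := ev_min hz P0; exists P, z; split=> //.
  by rewrite P0 P1 invr0.
have [m [O [uO zO em hO]]] := orbit_poly hz.
have cop : coprimep P m.
  rewrite -(coprimep_map LLbar) /coprimep; apply: contraT => /closed_rootP[y].
  rewrite root_gcd em root_prod_XsubC => /andP[/rootP Py /hO[j ej]].
  by move: P0; rewrite (@ev_back P z j) ?eqxx // -ej.
have [[U V] /= eUV] := Bezout_eq1_coprimepP _ _ cop.
have mz : ev m z = 0 by apply/rootP; rewrite em root_prod_XsubC.
have mz' := ev_min hz mz.
have inv y : ev m y = 0 -> (ev P y)^-1 = ev U y.
  move=> my; have : ev U y * ev P y = 1.
    have := congr1 (fun p : {poly L} => ev p y) eUV.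
    by rewrite rmorphD !rmorphM rmorph1 /= hornerD !hornerM my mulr0 addr0 hornerC.
  move=> e; have y0 : ev P y != 0.
    by apply/eqP => h; move/eqP: e; rewrite h mulr0 eq_sym oner_eq0.
  by apply: (mulIf y0); rewrite e mulVf.
by exists U, z; split=> //; rewrite !inv.
Qed.

Lemma constant_graph_id c : constant_graph (LLbar c, LLbar c).
Proof.
exists c%:P, 0; split; first by exists 0%N; rewrite expr0n eqn0Ngt card_exp_gt0.
by rewrite map_polyC !hornerC.
Qed.

Lemma constant_graph_per z : per z -> constant_graph (z, z ^+ Q).
Proof. by move=> hz; exists 'X, z; split=> //; rewrite map_polyX !hornerX. Qed.

Lemma constant_graph_Weil (g : {rmorphism Lbar -> Lbar}) : bijective g ->
  (forall z, constant_graph z -> g z.1 = z.2) -> Weil kL LLbar g.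
Proof.
move=> bg hg; split; first by split=> // c; apply: (hg (_, _) (constant_graph_id c)).
exists s%:Z => c /(algebraic_periodic (j := kM)) hc.
exact: (hg (_, _) (constant_graph_per hc)).
Qed.

(** [fixed_power] gives y = x^(p^a) = P(z) = P(z^Q). Then P takes the value y on the whole orbit of
    z, and its remainder modulo the orbit polynomial, of degree less than the size of the orbit, is
    the constant y; so y is in L. *)
Lemma Weil_fixed_power x : (forall g, Weil kL LLbar g -> g x = x) -> inP k LLbar x.
Proof.
move=> fx; have [p p_pr pk] := finPcharP k.
have pM : p \in [pchar Lbar] by rewrite (fmorph_pchar kM).
have pL : p \in [pchar L] by rewrite (fmorph_pchar kL).
have [g bg hg|a] := fixed_power hLbar constant_graph_graph constant_graphV constant_graph_id pM (x := x).
  by apply: fx; apply: constant_graph_Weil.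
set y := x ^+ (p ^ a) => -[P [z [hz [ey ey']]]].
apply: (perf_inP kL); exists p, a; split=> //; rewrite -/y.
have [g [bg hg]] := aut_extend hLbar constant_graph_graph constant_graph_id.
have gy : g y = y by apply: (hg (y, y)); exists P, z; rewrite -ey -ey'.
have gL c : g (LLbar c) = LLbar c by apply: (hg (_, _) (constant_graph_id c)).
have gev u : g (ev P u) = ev P (g u).
  rewrite -horner_map /= -map_poly_comp /=; congr (_.[_]).
  by apply: eq_map_poly => c /=; rewrite gL.
have evj j : ev P (z ^+ (q ^ (s * j))) = y.
  elim: j => [|j IH]; first by rewrite muln0 expn0 expr1.
  have e : g (z ^+ (q ^ (s * j))) = z ^+ (q ^ (s * j)) ^+ Q.
    by apply: (hg (_, _)); apply/constant_graph_per/perX.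
  by rewrite iterQ -e -gev IH.
have [m [O [uO zO em hO]]] := orbit_poly hz.
have m0 : m != 0.
  rewrite -(map_poly_eq0 LLbar) em monic_neq0 //; exact: monic_prod_XsubC.
pose A := P %% m; have evA u : u \in O -> ev A u = y.
  move=> uO'; have [j ej] := hO u uO'; rewrite -(evj j) -ej.
  have mu : ev m u = 0 by apply/rootP; rewrite em root_prod_XsubC.
  by rewrite [in RHS](divp_eq P m) rmorphD rmorphM /= hornerD hornerM mu mulr0 add0r.
have sA : (size A <= size O)%N.
  by rewrite -ltnS -(size_prod_XsubC O id) -em size_map_poly ltn_modp.
have e0 : map_poly LLbar A - y%:P = 0.
  apply/eqP; apply: contraT => n0.
  have := max_poly_roots n0 (rs := O) _ uO; rewrite ltnNge => /(_ _)/negP[].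
    by apply/allP => u uO'; rewrite rootE !hornerE evA // subrr.
  apply: leq_trans (size_polyD _ _) _; rewrite geq_max size_map_poly sA size_polyN size_polyC.
  by case: O zO {uO em hO evA sA} => // ? ? _; case: (y != 0).
exists A`_0; move/eqP: e0; rewrite subr_eq0 => /eqP/(congr1 (fun p : {poly Lbar} => p`_0)).
by rewrite coef_map coefC.
Qed.

End Descent.

Lemma Weil_fixed_inP (k : finFieldType) (L : fieldType) (kL : {rmorphism k -> L})
    (Lbar : closedFieldType) (LLbar : {rmorphism L -> Lbar}) (x : Lbar) :
  finitely_generated_field L -> is_algebraic_closure LLbar ->
  (forall g, Weil kL LLbar g -> g x = x) -> inP k LLbar x.
Proof.
move=> hL hLbar; have [s [K [s0 uK sK KP Kfix]]] := constant_field kL hL.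
exact: (@Weil_fixed_power k L kL Lbar LLbar hLbar s K s0 uK sK KP Kfix).
Qed.

(** * The representation rho *)

Section Separable.
Variables (L : fieldType) (M : closedFieldType) (LM : {rmorphism L -> M}).

(** The L-span as the intersection of all L-subspaces containing S: the definition is its own
    induction principle. *)
Definition lspan (S : set M) : set M := [set x | forall W : set M, W 0 ->
  (forall a b, W a -> W b -> W (a + b)) -> (forall l a, W a -> W (LM l * a)) ->
  S `<=` W -> W x].

Lemma lspan0 S : lspan S 0. Proof. by move=> W. Qed.
Lemma lspanD S a b : lspan S a -> lspan S b -> lspan S (a + b).
Proof. by move=> ha hb W W0 WD WZ WS; apply: (WD); [apply: ha|apply: hb]. Qed.
Lemma lspanZ S l a : lspan S a -> lspan S (LM l * a).
Proof. by move=> ha W W0 WD WZ WS; apply: (WZ); apply: ha. Qed.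
Lemma lspan_mem S a : S a -> lspan S a.
Proof. by move=> ha W W0 WD WZ WS; apply: WS. Qed.
Lemma lspan_ind S T : S `<=` lspan T -> lspan S `<=` lspan T.
Proof.
by move=> ST x hx; apply: (hx (lspan T)) => // ? ?; [apply: lspanD|apply: lspanZ].
Qed.
Lemma lspan_sum S I (r : seq I) (P : pred I) (F : I -> M) :
  (forall i, P i -> lspan S (F i)) -> lspan S (\sum_(i <- r | P i) F i).
Proof. by move=> h; apply: (big_ind (lspan S)) => // ? ?; apply: lspanD. Qed.

Lemma lspanM S T U x y : (forall a b, S a -> T b -> lspan U (a * b)) ->
  lspan S x -> lspan T y -> lspan U (x * y).
Proof.
move=> h hx hy; apply: (hx (fun x => lspan U (x * y))).
- by rewrite mul0r; apply: lspan0.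
- by move=> a b ha hb; rewrite mulrDl; apply: lspanD.
- by move=> l a ha; rewrite -mulrA; apply: lspanZ.
- move=> a Sa; apply: (hy (fun y => lspan U (a * y))).
  + by rewrite mulr0; apply: lspan0.
  + by move=> b b' hb hb'; rewrite mulrDr; apply: lspanD.
  + by move=> l b hb; rewrite mulrCA; apply: lspanZ.
  + by move=> b Tb; apply: h.
Qed.

Local Notation spanseq s := (lspan [set y | y \in (s : seq M)]).

Lemma spanseq_coord (s : seq M) x : spanseq s x ->
  exists c : nat -> L, x = \sum_(i < size s) LM (c i) * s`_i.
Proof.
move=> hx; apply: (hx (fun x => exists c : nat -> L, x = \sum_(i < size s) LM (c i) * s`_i)) =>
  [|_ _ [c ->] [c' ->]|l _ [c ->]|y ys].
- by exists (fun=> 0); rewrite big1 // => i _; rewrite rmorph0 mul0r.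
- exists (fun i => c i + c' i); rewrite -big_split /=.
  by apply: eq_bigr => i _; rewrite rmorphD mulrDl.
- exists (fun i => l * c i); rewrite mulr_sumr.
  by apply: eq_bigr => i _; rewrite rmorphM mulrA.
- have lt : (index y s < size s)%N by rewrite index_mem.
  exists (fun i => (i == index y s)%:R); rewrite (bigD1 (Ordinal lt)) //= eqxx rmorph1 mul1r nth_index //.
  rewrite big1 ?addr0 // => i ne; have -> : (i == index y s :> nat) = false by apply/negbTE.
  by rewrite rmorph0 mul0r.
Qed.

Definition lin_indep (s : seq M) := forall c : nat -> L,
  \sum_(i < size s) LM (c i) * s`_i = 0 -> forall i, (i < size s)%N -> c i = 0.

Lemma basis_ex s : exists s', lin_indep s' /\ forall x, spanseq s x <-> spanseq s' x.
Proof.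
elim: s => [|y s [s' [is' es]]]; first by exists [::]; split=> // c _ [].
have [ys|ys] := pselect (spanseq s' y).
  exists s'; split=> // x; split; apply: lspan_ind => z /=.
    by rewrite inE => /orP[/eqP -> //|zs]; apply/es; apply: lspan_mem.
  move=> zs; have /es : spanseq s' z by apply: lspan_mem.
  by apply: lspan_ind => w /= ws; apply: lspan_mem; rewrite /= inE ws orbT.
exists (y :: s'); split.
  move=> c; rewrite /= big_ord_recl /= => e.
  have c0 : c 0%N = 0.
    apply: contrapT => /eqP c0; apply: ys.
    have -> : y = LM (- (c 0%N)^-1) * \sum_(i < size s') LM (c i.+1) * s'`_i.
      move/eqP: e; rewrite addr_eq0 => /eqP e; apply: (mulfI (x := LM (c 0%N))).
        by rewrite fmorph_eq0.
      by rewrite e mulrA -rmorphM mulrN mulfV // rmorphN1 mulN1r.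
    apply: lspanZ; apply: lspan_sum => i _; apply: lspanZ; apply: lspan_mem.
    exact: mem_nth.
  move: e; rewrite c0 rmorph0 mul0r add0r => /(is' (fun i => c i.+1)) h [|i] //.
  exact: h.
move=> x; split; apply: lspan_ind => z /=; rewrite inE => /orP[/eqP ->|zs].
- by apply: lspan_mem; rewrite /= inE eqxx.
- have /es : spanseq s z by apply: lspan_mem.
  by apply: lspan_ind => w /= ws; apply: lspan_mem; rewrite /= inE ws orbT.
- by apply: lspan_mem; rewrite /= inE eqxx.
- have /es : spanseq s' z by apply: lspan_mem.
  by apply: lspan_ind => w /= ws; apply: lspan_mem; rewrite /= inE ws orbT.
Qed.

Definition lcomb m (v : 'I_m -> M) (w : 'rV[L]_m) : M := \sum_i LM (w 0 i) * v i.

Lemma lcombM m n (A : 'M[L]_(m, n)) (v : 'I_n -> M) w :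
  lcomb v (w *m A) = lcomb (fun j => lcomb v (row j A)) w.
Proof.
rewrite /lcomb; under eq_bigr => i _ do rewrite mxE rmorph_sum mulr_suml /=.
rewrite exchange_big /=; apply: eq_bigr => j _; rewrite mulr_sumr.
by apply: eq_bigr => i _; rewrite mxE rmorphM mulrA.
Qed.

Variables (p : nat) (pL : p \in [pchar L]).

Let pM : p \in [pchar M]. Proof. by rewrite (fmorph_pchar LM). Qed.
Let expD (a b : M) : (a + b) ^+ p = a ^+ p + b ^+ p.
Proof. exact: (rmorphD (pFrobenius_aut pM)). Qed.
Let exp_sum I (r : seq I) (P : pred I) (F : I -> M) :
  (\sum_(i <- r | P i) F i) ^+ p = \sum_(i <- r | P i) F i ^+ p.
Proof.
apply: (big_morph (fun x => x ^+ p)); first exact: expD.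
by rewrite expr0n eqn0Ngt (prime_gt0 (pcharf_prime pM)).
Qed.

(** P(X^p) - X has derivative -1. *)
Lemma sep_of_root (P : {poly L}) x : (map_poly LM P).[x ^+ p] = x -> in_sep LM x.
Proof.
move=> e; exists ((P \Po 'X^p) - 'X).
  rewrite separable_poly.unlock derivB deriv_comp derivX derivXn.
  rewrite -mulr_natr -polyC_natr (pcharf0 pL) polyC0 !mulr0 sub0r.
  have -> : (-1 : {poly L}) = (-1) *: 1 by rewrite scaleN1r.
  by rewrite coprimepZr ?oppr_eq0 ?oner_neq0 // coprimep1.
rewrite rootE rmorphB /= map_comp_poly map_polyXn map_polyX hornerD hornerN hornerX.
by rewrite horner_comp hornerXn e subrr.
Qed.

Section Basis.
Variable s : seq M.
Hypotheses (s_indep : lin_indep s) (s1 : spanseq s 1)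
  (sM : forall a b, spanseq s a -> spanseq s b -> spanseq s (a * b))
  (sp : forall y, y \in s -> lspan [set y | exists2 z, z \in s & y = z ^+ p] y).
Let n := size s.
Let v (i : 'I_n) := s`_i.
Let S := lcomb v.

Lemma basis_coord x : spanseq s x -> exists w, S w = x.
Proof.
by move=> /spanseq_coord[c ->]; exists (\row_i c i); apply: eq_bigr => i _; rewrite mxE.
Qed.

Lemma basis_inj w : S w = 0 -> w = 0.
Proof.
move=> e; apply/rowP => i; rewrite [RHS]mxE.
pose c (j : nat) := if insub j is Some j' then w 0 (j' : 'I_n) else 0.
have cE (j : 'I_n) : c j = w 0 j by rewrite /c valK.
rewrite -cE; apply: s_indep => //; rewrite -[RHS]e.
by apply: eq_bigr => j _; rewrite cE.
Qed.

Lemma frob_unit : exists2 N : 'M[L]_n, N \in unitmx &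
  forall w, lcomb (fun i => v i ^+ p) w = S (w *m N).
Proof.
have sv i : spanseq s (v i) by apply: lspan_mem; apply: mem_nth.
have sX x m : spanseq s x -> spanseq s (x ^+ m).
  by move=> hx; elim: m => // m IH; rewrite exprS; apply: sM.
have [r hr] := choice (fun i => basis_coord (sX _ p (sv i))).
have /choice[T hT] : forall i, exists T : 'rV[L]_n, lcomb (fun i => v i ^+ p) T = v i.
  move=> i; pose s' := [seq z ^+ p | z <- s].
  have /spanseq_coord[c ec] : spanseq s' (v i).
    have := sp (mem_nth 0 (ltn_ord i)); apply: lspan_ind => _ [z zs ->].
    by apply: lspan_mem; apply: map_f.
  move: ec; rewrite size_map -/n => ec; exists (\row_j c j); rewrite ec.
  by apply: eq_bigr => j _; rewrite mxE (nth_map 0).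
pose N := \matrix_i r i.
have hN w : lcomb (fun i => v i ^+ p) w = S (w *m N).
  by rewrite /S lcombM; apply: eq_bigr => i _; rewrite rowK; congr (_ * _); rewrite -[LHS]hr.
exists N => //; pose T' := \matrix_i T i.
have : T' *m N = 1%:M.
  apply/row_matrixP => i; rewrite row_mul rowK; apply/eqP; rewrite -subr_eq0; apply/eqP.
  apply: basis_inj; rewrite /S /lcomb.
  under eq_bigr => j _ do rewrite mxE [X in _ + X]mxE rmorphB mulrBl.
  rewrite big_split /= sumrN; apply/eqP; rewrite subr_eq0; apply/eqP.
  rewrite -[LHS]/(S (T i *m N)) -hN hT (bigD1 i) //= !mxE eqxx rmorph1 mul1r big1 ?addr0 // => j ji.
  by rewrite !mxE eq_sym (negbTE ji) rmorph0 mul0r.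
by case/mulmx1_unit.
Qed.

(** Let e be the degree of x over L. As N in [frob_unit] is invertible, p-th powers of independent
    elements stay independent. So 1, x^p, ..., x^(p(e-1)) is another basis of L[x], x is a
    polynomial in x^p, and [sep_of_root] applies. *)
Lemma basis_sep x : algebraicOver LM x -> spanseq s x -> in_sep LM x.
Proof.
move=> [P0 P00 /rootP P0x] sx.
have ex : exists m, `[< exists P : {poly L}, [/\ P != 0, (map_poly LM P).[x] = 0 & size P = m] >].
  by exists (size P0); apply/asboolP; exists P0.
case: (ex_minnP ex) => m /asboolP[P [Pn Px sP]] mmin.
pose e := m.-1; have m0 : (0 < m)%N by rewrite -sP size_poly_gt0.
have small (R : {poly L}) : (size R <= e)%N -> (map_poly LM R).[x] = 0 -> R = 0.
  move=> sR Rx; apply: contrapT => /eqP R0.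
  have := mmin (size R); rewrite leqNgt => /(_ _)/negP; apply; last by rewrite /e in sR; lia.
  by apply/asboolP; exists R.
pose pw (j : 'I_e) := x ^+ j.
have lc_poly w : lcomb pw w = (map_poly LM (\poly_(j < e) (if insub j is Some j' then w 0 (j' : 'I_e) else 0))).[x].
  rewrite (horner_coef_wide (n := e)); last by rewrite size_map_poly size_poly.
  by apply: eq_bigr => j _; rewrite coef_map coef_poly ltn_ord valK.
have pw_inj w : lcomb pw w = 0 -> w = 0.
  rewrite lc_poly => /(small _ (size_poly _ _)) h; apply/rowP => j; rewrite [RHS]mxE.
  by move/(congr1 (fun R : {poly L} => R`_j)): h; rewrite coef_poly ltn_ord valK coef0.
have red i : exists w, lcomb pw w = x ^+ i.
  pose R := 'X^i %% P.
  have sR : (size R <= e)%N by have := ltn_modp 'X^i P; rewrite Pn sP -/R => h; rewrite /e; lia.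
  exists (\row_j R`_j).
  have -> : x ^+ i = (map_poly LM R).[x].
    have := congr1 (fun R : {poly L} => (map_poly LM R).[x]) (divp_eq 'X^i P).
    by rewrite rmorphD rmorphM /= map_polyXn hornerXn hornerD hornerM Px mulr0 add0r.
  rewrite (horner_coef_wide (n := e)) ?size_map_poly //.
  by apply: eq_bigr => j _; rewrite mxE coef_map.
have sX i : spanseq s (x ^+ i) by elim: i => // i IH; rewrite exprS; apply: sM.
have [c hc] := choice (fun j : 'I_e => basis_coord (sX j)).
have [N Nu hN] := frob_unit.
pose C := \matrix_j c j.
have Cfree : row_free C.
  rewrite -kermx_eq0; apply/eqP/row_matrixP => i; rewrite row0; apply: pw_inj.
  transitivity (S (row i (kermx C) *m C)).
    by rewrite /S lcombM; apply: eq_bigr => j _; rewrite rowK; congr (_ * _); rewrite -[LHS]hc.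
  by rewrite -row_mul mulmx_ker row0 /S /lcomb big1 // => j _; rewrite mxE rmorph0 mul0r.
pose CF := map_mx (pFrobenius_aut pL) C.
have CFfree : row_free (CF *m N).
  by rewrite /row_free mxrankMfree ?row_free_unit // mxrank_map.
have SF w : S (map_mx (pFrobenius_aut pL) w *m N) = S w ^+ p.
  rewrite -hN [in RHS]/S /lcomb exp_sum; apply: eq_bigr => i _.
  by rewrite mxE pFrobenius_autE rmorphXn -exprMn.
have frob_inj w : lcomb (fun j => pw j ^+ p) w = 0 -> w = 0.
  move=> h; apply: (row_free_inj CFfree); rewrite mul0mx; apply: basis_inj.
  rewrite -[RHS]h /S lcombM; apply: eq_bigr => j _; congr (_ * _).
  rewrite row_mul -map_row rowK; exact: etrans (SF _) (congr1 (fun z => z ^+ p) (hc j)).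
have [D0 hD0] := choice (fun j : 'I_e => red (p * j)%N).
pose D := \matrix_j D0 j.
have hD w : lcomb pw (w *m D) = lcomb (fun j => pw j ^+ p) w.
  by rewrite lcombM; apply: eq_bigr => j _; rewrite rowK hD0 /pw -exprM mulnC.
have Du : D \in unitmx.
  rewrite -row_free_unit -kermx_eq0; apply/eqP/row_matrixP => i; rewrite row0; apply: frob_inj.
  by rewrite -hD -row_mul mulmx_ker row0 /lcomb big1 // => j _; rewrite mxE rmorph0 mul0r.
have [a ha] := red 1%N; rewrite expr1 in ha.
pose b := a *m invmx D.
apply: (@sep_of_root (\poly_(j < e) (if insub j is Some j' then b 0 (j' : 'I_e) else 0))).
rewrite -[RHS]ha -[in RHS](mulmxKV Du a) hD (horner_coef_wide (n := e)).
  apply: eq_bigr => j _; rewrite coef_map coef_poly ltn_ord valK /pw; congr (_ * _).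
  by rewrite -!exprM mulnC.
by rewrite size_map_poly size_poly.
Qed.

End Basis.

(** Finite-dimensional L-algebras V with V = L V^p. Their elements are separable, and the property
    survives the adjunction of solutions of D u^(p^(a+1)) - u = c with c in V, which is the equation
    for the coefficients of [twist]. *)
Definition sep_alg (V : set M) := exists s, [/\ forall x, V x <-> spanseq s x, V 1,
  forall a b, V a -> V b -> V (a * b) &
  forall x, V x -> lspan [set y | exists2 z, V z & y = z ^+ p] x].

Lemma sep_alg_sep V x : algebraicOver LM x -> sep_alg V -> V x -> in_sep LM x.
Proof.
move=> ax [s0 [Vs0 V1 VM Vp]] Vx.
have [s [s_ind ess]] := basis_ex s0.
have Vs y : V y <-> spanseq s y by rewrite Vs0.
apply: (@basis_sep s s_ind) => //; last exact/Vs.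
- exact/Vs.
- by move=> a b /Vs ha /Vs hb; apply/Vs/VM.
- move=> y ys; have /Vs/Vp : spanseq s y by apply: lspan_mem.
  apply: lspan_ind => _ [z /Vs hz ->].
  apply: (hz (fun z => lspan _ (z ^+ p))).
  + by rewrite expr0n eqn0Ngt (prime_gt0 (pcharf_prime pM)); apply: lspan0.
  + by move=> a b ha hb; rewrite expD; apply: lspanD.
  + by move=> l a ha; rewrite exprMn -rmorphXn; apply: lspanZ.
  + by move=> a sa; apply: lspan_mem; exists a.
Qed.

Lemma sep_alg_base : sep_alg (lspan [set y | y \in [:: 1]]).
Proof.
exists [:: 1]; split=> //; first by apply: lspan_mem; rewrite /= inE.
  move=> a b; apply: lspanM => x y /=; rewrite !inE => /eqP -> /eqP ->.
  by apply: lspan_mem; rewrite /= mulr1 inE.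
move=> x; apply: lspan_ind => y /=; rewrite inE => /eqP ->.
apply: lspan_mem; exists 1; rewrite ?expr1n //.
by apply: lspan_mem; rewrite /= inE.
Qed.

Lemma sep_algL V l : sep_alg V -> V (LM l).
Proof. by move=> [s [Vs /Vs V1 _ _]]; apply/Vs; rewrite -[LM l]mulr1; apply: lspanZ. Qed.
Lemma sep_algD V a b : sep_alg V -> V a -> V b -> V (a + b).
Proof. by move=> [s [Vs _ _ _]] /Vs ha /Vs hb; apply/Vs; apply: lspanD. Qed.
Lemma sep_algM V a b : sep_alg V -> V a -> V b -> V (a * b).
Proof. by move=> [s [_ _ h _]]; apply: h. Qed.

(** Solved for u^Q, the equation bounds the powers of u in a spanning family; solved for u, it puts
    u in the span of the p-th powers. *)
Lemma sep_alg_adjoin V u c D a : sep_alg V -> V c -> D != 0 ->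
  LM D * u ^+ (p ^ a.+1) - u = c -> exists V', [/\ sep_alg V', V `<=` V' & V' u].
Proof.
move=> sV Vc D0 eu; have [s [Vs V1 VM Vp]] := sV.
set Q := (p ^ a.+1)%N in eu.
have p_pr := pcharf_prime pL.
have Q1 : (1 < Q)%N by rewrite -(exp1n a.+1) ltn_exp2r // prime_gt1.
pose s' := [seq b * u ^+ j | b <- s, j <- iota 0 Q].
have uQ : u ^+ Q = LM D^-1 * (u + c).
  by rewrite -eu addrC subrK mulrA -rmorphM mulVf // rmorph1 mul1r.
have gen m v : V v -> spanseq s' (v * u ^+ m).
  elim/ltn_ind: m v => m IH v Vv.
  have [mQ|Qm] := ltnP m Q.
    move/Vs: Vv => Vv; apply: (Vv (fun v => spanseq s' (v * u ^+ m))).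
    + by rewrite mul0r; apply: lspan0.
    + by move=> x y hx hy; rewrite mulrDl; apply: lspanD.
    + by move=> l x hx; rewrite -mulrA; apply: lspanZ.
    + move=> b bs; apply: lspan_mem; apply/allpairsP; exists (b, m); split=> //.
      by rewrite mem_iota.
  have -> : v * u ^+ m = LM D^-1 * (v * u ^+ (m - Q).+1 + v * c * u ^+ (m - Q)).
    by rewrite -{1}(subnK Qm) exprD uQ exprS; ring.
  apply: lspanZ; apply: lspanD; apply: IH => //; try lia.
  exact: VM.
have V'1 : spanseq s' 1 by have := gen 0%N 1 V1; rewrite mulr1.
have VV' : V `<=` spanseq s' by move=> v /(gen 0%N); rewrite mulr1.
have V'u : spanseq s' u by have := gen 1%N 1 V1; rewrite mul1r.
have sV' y : y \in s -> V y by move=> ys; apply/Vs; apply: lspan_mem.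
have V'M x y : spanseq s' x -> spanseq s' y -> spanseq s' (x * y).
  apply: lspanM => _ _ /allpairsP[[b j] /= [bs _ ->]] /allpairsP[[b' j'] /= [bs' _ ->]].
  by rewrite mulrACA -exprD; apply: gen; apply: VM; apply: sV'.
exists (spanseq s'); split=> //; exists s'; split=> //.
pose P := lspan [set y | exists2 z, spanseq s' z & y = z ^+ p].
have PM x y : P x -> P y -> P (x * y).
  apply: lspanM => _ _ [z hz ->] [z' hz' ->]; apply: lspan_mem.
  by exists (z * z'); [exact: V'M|rewrite exprMn].
have VP : V `<=` P.
  move=> v /Vp; apply: lspan_ind => _ [z Vz ->]; apply: lspan_mem.
  by exists z => //; apply: VV'.
have Pu : P u.
  have V'X m : spanseq s' (u ^+ m) by elim: m => // m IH; rewrite exprS; apply: V'M.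
  have -> : u = LM D * u ^+ Q + LM (-1) * c by rewrite -eu rmorphN1 mulN1r; ring.
  apply: lspanD; apply: lspanZ; last exact: VP.
  by apply: lspan_mem; exists (u ^+ (p ^ a)); rewrite // -exprM -expnSr.
have PX m : P (u ^+ m) by elim: m => [|m IH]; [exact: VP|rewrite exprS; apply: PM].
suff h : spanseq s' `<=` P by [].
apply: lspan_ind => _ /allpairsP[[b j] /= [bs _ ->]].
by apply: (PM) => //; apply: VP; apply: sV'.
Qed.

End Separable.

(** * A series conjugating phi_t to a power of tau *)

Section Twist.
Variables (k : finFieldType) (L : fieldType) (kL : {rmorphism k -> L}).
Variables (Lbar : closedFieldType) (LLbar : {rmorphism L -> Lbar}).

Local Notation kM := (LLbar \o kL : {rmorphism k -> Lbar}).
Local Notation lau := (laurent kM).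
Local Notation Fr := (frobz kM).
Local Notation q := #|k|.

Variables (n' : nat) (P : nat -> L).
Local Notation N := n'.+1.
Hypothesis Pn : P N != 0.

(** For c = 0, the case of the leading coefficient, a nonzero root is taken so that [twist] does not
    vanish. *)
Lemma twist_root_ex (c : Lbar) :
  exists x, LLbar (P N) * x ^+ (q ^ N) - x = c /\ (c = 0 -> x != 0).
Proof.
have q1 : (1 < q ^ N)%N by rewrite -(exp1n N) ltn_exp2r // card_gt1.
have D0 : LLbar (P N) != 0 by rewrite fmorph_eq0.
have [->|c0] := eqVneq c 0.
  pose n := (q ^ N).-1; have n0 : (0 < n)%N by rewrite /n; lia.
  have [|x] := closed_rootP ('X^n - (LLbar (P N))^-1%:P) _.
    by rewrite size_XnsubC // eqSS -lt0n.
  rewrite rootE !hornerE subr_eq0 => /eqP ex; exists x; split.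
    have -> : (q ^ N)%N = n.+1 by rewrite /n; lia.
    by rewrite exprSr ex mulrA mulfV // mul1r subrr.
  move=> _; apply/eqP => x0; move/eqP: ex.
  by rewrite x0 expr0n eqn0Ngt n0 /= eq_sym invr_eq0 (negbTE D0).
have sz : size (LLbar (P N) *: 'X^(q ^ N) : {poly Lbar}) = (q ^ N).+1.
  by rewrite size_scale // size_polyXn.
have [|x] := closed_rootP (LLbar (P N) *: 'X^(q ^ N) - ('X + c%:P)) _.
  rewrite size_polyDl sz; first by rewrite eqSS; lia.
  by rewrite size_polyN size_XaddC; lia.
rewrite rootE !hornerE subr_eq0 => /eqP ex; exists x; split; last by move/eqP: c0.
by rewrite ex addrC addKr.
Qed.

(** Minus the contribution of the earlier coefficients to degree N - size l in phi_t u = u tau^N;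
    entry j of l is the coefficient of u in degree -j. *)
Definition twist_cst (l : seq Lbar) : Lbar := - \sum_(m < N) LLbar (P m) *
  (if (N - m <= size l)%N then l`_(size l - (N - m)) else 0) ^+ (q ^ m).

Definition twist_next (l : seq Lbar) : Lbar := projT1 (cid (twist_root_ex (twist_cst l))).

Fixpoint twist_seq n : seq Lbar :=
  if n is m.+1 then rcons (twist_seq m) (twist_next (twist_seq m)) else [::].

Definition twist_coef n := twist_next (twist_seq n).

Lemma size_twist_seq n : size (twist_seq n) = n.
Proof. by elim: n => //= n IH; rewrite size_rcons IH. Qed.

Lemma nth_twist_seq n j : (j < n)%N -> (twist_seq n)`_j = twist_coef j.
Proof.
elim: n => // n IH; rewrite ltnS leq_eqVlt /= nth_rcons size_twist_seq => /orP[/eqP ->|jn].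
  by rewrite ltnn eqxx.
by rewrite jn IH.
Qed.

Lemma twist_coefE n : LLbar (P N) * twist_coef n ^+ (q ^ N) - twist_coef n =
  - \sum_(m < N) LLbar (P m) *
    (if (N - m <= n)%N then twist_coef (n - (N - m)) else 0) ^+ (q ^ m).
Proof.
rewrite /twist_coef {1 2}/twist_next; case: cid => x /= [-> _].
rewrite /twist_cst size_twist_seq; congr (- _); apply: eq_bigr => m _.
by case: ifP => // h; rewrite nth_twist_seq //; have := ltn_ord m; lia.
Qed.

Lemma twist_coef0 : twist_coef 0 != 0.
Proof.
rewrite /twist_coef /twist_next; case: cid => x /= [_]; apply.
rewrite /twist_cst /= big1 ?oppr0 // => m _.
have -> : (N - m <= 0)%N = false by have := ltn_ord m; lia.
by rewrite zero_cardX mulr0.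
Qed.

Fact twist_subproof : exists N : int, forall i, N < i ->
  (if i <= 0 then twist_coef `|i| else 0) = 0.
Proof. by exists 0 => i; rewrite ltNge => /negbTE ->. Qed.
Definition twist : lau := Laurent kM twist_subproof.

Lemma twistE (i : int) : twist i = if i <= 0 then twist_coef `|i| else 0.
Proof. by []. Qed.

Lemma twist_neq0 : twist != 0.
Proof.
apply: contraNneq twist_coef0 => /(congr1 (fun f : lau => f 0)).
by rewrite twistE lcoef0 /= => ->.
Qed.

Lemma twist_eq (f : lau) : lpoly f N -> (forall m : nat, f m%:Z = LLbar (P m)) ->
  f * twist = twist * lmonomial kM 1 N%:Z.
Proof.
move=> hf hP; apply: lauP => j; rewrite (lcoefM_polyl _ _ hf) lcoefM_monr rmorph1 mulr1.
rewrite big_ord_recr /=.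
have [jN|Nj] := ltP 0 (j - N%:Z).
  rewrite zero_cardX mulr0 addr0 big1 // => m _.
  have -> : (j - m%:Z <= 0) = false by apply/negbTE; have := ltn_ord m; lia.
  by rewrite zero_cardX mulr0.
set n := `|j - N%:Z|%N; have ej : j = N%:Z - n%:Z by rewrite /n; lia.
have := twist_coefE n; rewrite -hP => /eqP; rewrite subr_eq => /eqP ->.
rewrite addrA -[RHS]add0r; congr (_ + _); apply/eqP; rewrite subr_eq0; apply/eqP.
apply: eq_bigr => m _; rewrite hP; congr (_ * _ ^+ _).
have := ltn_ord m => mN; case: (leqP (N - m) n) => h.
  have -> : (j - m%:Z <= 0) by lia.
  by congr twist_coef; lia.
by have -> : (j - m%:Z <= 0) = false by apply/negbTE; lia.
Qed.

Lemma twist_sep i : is_algebraic_closure LLbar -> in_sep LLbar (twist i).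
Proof.
move=> hLbar; rewrite twistE; case: ifP => _; last first.
  exists 'X; last by rewrite map_polyX rootX.
  by rewrite separable_poly.unlock derivX coprimep1.
have [p p_pr pk] := finPcharP k.
have pL : p \in [pchar L] by rewrite (fmorph_pchar kL).
have qp : exists e, q = (p ^ e.+1)%N.
  have := card_gt1 k; rewrite (card_pprimeChar pk).
  by case: (logn p _) => [|e] //; exists e.
have [e qe] := qp.
suff [V [sV hV]] : exists V, sep_alg LLbar p V /\ forall j, (j <= `|i|)%N -> V (twist_coef j).
  by apply: (sep_alg_sep pL (hLbar _) sV); apply: hV.
move: `|i|%N => n.
have step n1 V : sep_alg LLbar p V -> (forall j, (j < n1)%N -> V (twist_coef j)) ->
    exists V', sep_alg LLbar p V' /\ forall j, (j <= n1)%N -> V' (twist_coef j).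
  move=> sV hV; have Vc : V (- \sum_(m < N) LLbar (P m) *
    (if (N - m <= n1)%N then twist_coef (n1 - (N - m)) else 0) ^+ (q ^ m)).
    have VL l : V (LLbar l) := sep_algL l sV.
    rewrite -mulN1r -(rmorphN1 LLbar); apply: (sep_algM sV (VL _)).
    have V0 : V 0 by rewrite -(rmorph0 LLbar); apply: VL.
    apply: big_ind => // [x y|m _]; first exact: (sep_algD sV).
    apply: (sep_algM sV (VL _)).
    have VX x l : V x -> V (x ^+ l).
      move=> Vx; elim: l => [|l IH]; first by rewrite expr0 -(rmorph1 LLbar); apply: VL.
      by rewrite exprS; apply: (sep_algM sV).
    by apply: VX; case: ifP => // h; apply: hV; have := ltn_ord m; lia.
  have qN : (q ^ N = p ^ (e + e.+1 * n').+1)%N by rewrite qe -expnM; congr (_ ^ _)%N; lia.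
  have := twist_coefE n1; rewrite {1}qN => eq1.
  have [V' [sV' VV' V'u]] := sep_alg_adjoin pL sV Vc Pn eq1.
  exists V'; split=> // j; rewrite leq_eqVlt => /orP[/eqP -> //|/hV].
  exact: VV'.
elim: n => [|n [V [sV hV]]]; last by apply: (step _ V).
by apply: (step _ _ (sep_alg_base _ _)).
Qed.

End Twist.

Lemma conj_comm (R : unitRingType) (u a b : R) : u \is a GRing.unit -> a * b = b * a ->
  (u^-1 * a * u) * (u^-1 * b * u) = (u^-1 * b * u) * (u^-1 * a * u).
Proof. by move=> uu ab; rewrite !mulrA !(mulrK uu) -!(mulrA u^-1) ab. Qed.

(** * Commutation with rho as invariance of coefficients *)

Section Rho.
Variables (k : finFieldType) (F : fieldType) (ord : F -> \bar int).
Variables (L : fieldType) (kL : {rmorphism k -> L}).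
Variables (Lbar : closedFieldType) (LLbar : {rmorphism L -> Lbar}).
Hypothesis hLbar : is_algebraic_closure LLbar.

Local Notation kM := (LLbar \o kL : {rmorphism k -> Lbar}).
Local Notation lau := (laurent kM).
Local Notation Fr := (frobz kM).
Local Notation q := #|k|.
Local Notation kbar := (in_kbar kL LLbar).

Variables (phi : {rmorphism ringA ord -> lau}) (t : ringA ord).
Hypotheses (hphi : forall a, twisted_poly (phi a)) (t_deg : 0 < ldeg (phi t)).

Lemma kbar_frob i x : kbar x -> kbar (Fr i x).
Proof.
move=> /(algebraic_periodic (j := kM))[r e]; apply: (@periodic_algebraic _ _ kM _ r).
have -> : Fr i x ^+ (q ^ r.+1) = Fr r.+1%:Z (Fr i x) by [].
by rewrite -frobzD addrC frobzD; congr (Fr i _).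
Qed.

Lemma phi_t_neq0 : phi t != 0.
Proof.
apply: contraTneq t_deg => ->; rewrite /ldeg xgetPN // => d [].
by rewrite lcoef0 eqxx.
Qed.

Lemma phi_shape : exists n' (P : nat -> L), [/\ lpoly (phi t) n'.+1,
  forall m : nat, phi t m%:Z = LLbar (P m), P n'.+1 != 0 & ldeg (phi t) = n'.+1%:Z].
Proof.
have [tp tc] := hphi t; have [P hP] := choice (fun m : nat => tc m%:Z).
have [d1 hd] := ldegP phi_t_neq0.
have [n' en] : exists n' : nat, ldeg (phi t) = n'.+1%:Z.
  by exists (`|ldeg (phi t)|.-1)%N; move: t_deg; lia.
exists n', P; split=> //; last first.
  by move: d1; rewrite en hP fmorph_eq0.
by move=> i [/tp //|]; rewrite -en => /hd.
Qed.

(** u^-1 phi_a u commutes with u^-1 phi_t u = tau^N, so its coefficients are fixed by the q^N-th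
    power map. *)
Lemma admissible_ex : exists u, rho_admissible phi u.
Proof.
have [n' [P [hf hP Pn _]]] := phi_shape.
pose u := @twist k L kL Lbar LLbar n' P Pn.
have u0 : u != 0 by apply: twist_neq0.
have uu : u \is a GRing.unit by rewrite lau_unitE.
have eu : phi t * u = u * lmonomial kM 1 n'.+1%:Z  by apply: twist_eq.
exists u; split=> //; first by move=> i; apply: twist_sep.
move=> a i; set g := u^-1 * phi a * u.
have com : g * lmonomial kM 1 n'.+1%:Z = lmonomial kM 1 n'.+1%:Z * g.
  have -> : lmonomial kM 1 n'.+1%:Z = u^-1 * phi t * u by rewrite -mulrA eu mulKr.
  by apply: conj_comm => //; rewrite -!rmorphM [a * t]mulrC.
move/(congr1 (fun h : lau => h (i + n'.+1%:Z))): com.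
rewrite lcoefM_monr lcoefM_monl addrK rmorph1 mulr1 mul1r => e.
exact: (@periodic_algebraic _ _ kM _ n' (esym e)).
Qed.

Section Choice.
Variable u : lau.
Hypothesis hu : rho_admissible phi u.

Let uu : u \is a GRing.unit. Proof. by case: hu. Qed.
Let u0 : u != 0. Proof. by rewrite -lau_unitE. Qed.

(** By descending degree: commutation with u^-1 phi_t u makes each coefficient a root of a nonzero
    polynomial over kbar ([comm_top]). *)
Lemma conj_kbar B : D_phi phi B -> forall i, kbar ((u^-1 * B * u) i).
Proof.
move=> hB; set g := u^-1 * B * u; pose b := u^-1 * phi t * u.
have bk i : kbar (b i) by case: hu => _ _; apply.
have com : g * b = b * g by apply: conj_comm => //; apply: hB.
have uV0 : u^-1 != 0 by rewrite -lau_unitE unitrV.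
have [b0 degb] : b != 0 /\ ldeg b = ldeg (phi t).
  have [h1 d1] := ldegM uV0 phi_t_neq0; have [h2 d2] := ldegM h1 u0.
  by split=> //; rewrite /b d2 d1 ldegV //; lia.
have [bN hb] := ldegP b0; rewrite degb in bN hb.
have [n' [_ [_ _ _ en]]] := phi_shape; rewrite en in bN hb.
have S1 : kbar 1 := algebraic1 _.
have SB x y : kbar x -> kbar y -> kbar (x - y) by apply: algebraic_sub.
have SM x y : kbar x -> kbar y -> kbar (x * y) by apply: algebraic_mul.
apply: (@lcoef_ind _ _ _ g) => [i ->|i IH]; first exact: algebraic0.
have := comm_top i com hb; set r := (X in _ = X).
have rk : kbar r.
  have tk : lcoefs_in kbar (ltrunc i g) by apply: lcoefs_in_trunc.
  by apply: lcoefs_inB => //; apply: lcoefs_inM => //; apply: kbar_frob.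
set c := Fr i _; have ck : kbar c by apply: kbar_frob.
move=> e; pose R : {poly Lbar} := b n'.+1%:Z *: 'X^(q ^ n'.+1) - c *: 'X + r%:P.
have q1 : (1 < q ^ n'.+1)%N by rewrite -(exp1n n'.+1) ltn_exp2r // card_gt1.
have Rc j : kbar R`_j.
  rewrite /R coefD coefB !coefZ coefXn coefX coefC.
  have kb (z : bool) : kbar z%:R by case: z; [exact: algebraic1|exact: algebraic0].
  apply: algebraic_add; first by apply: SB; apply: SM.
  by case: ifP => // _; apply: algebraic0.
have R0 : R != 0.
  apply/eqP => /(congr1 (fun p : {poly Lbar} => p`_(q ^ n'.+1))).
  rewrite /R coefD coefB !coefZ coefXn coefX coefC eqxx mulr1 coef0.
  have -> : (q ^ n'.+1 == 1)%N = false by lia.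
  have -> : (q ^ n'.+1 == 0)%N = false by lia.
  by rewrite mulr0 subr0 addr0 => /eqP; rewrite (negbTE bN).
apply/integral_algebraic; apply: (integral_root R0) => [|x xR].
  rewrite rootE /R !hornerD hornerN !hornerZ hornerXn hornerX hornerC -e; apply/eqP.
  by rewrite -[g i ^+ _]/(Fr n'.+1%:Z (g i)); ring.
by have [j _ <-] := nthP 0 xR; apply/integral_algebraic; apply: Rc.
Qed.

Lemma rho_fixed B (s : {rmorphism Lbar -> Lbar}) d : D_phi phi B -> acts_with_degree kL LLbar s d ->
  B * (lmap s u * tau kM ^ d * u^-1) = lmap s u * tau kM ^ d * u^-1 * B <-> lmap s B = B.
Proof.
move=> hB hs; have kB := conj_kbar hB; set g := u^-1 * B * u in kB.
have su0 := lmap_neq0 s u0; have suu : lmap s u \is a GRing.unit by rewrite lau_unitE.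
have tu : tau kM ^ d \is a GRing.unit 
  by rewrite lau_unitE tau_exp; apply/eqP => /(congr1 (fun f : lau => f d)) /= /eqP; rewrite eqxx oner_eq0.
have eg : lmap s g = tau kM ^ d * g * (tau kM ^ d)^-1.
  by apply: lauP => i; rewrite tau_conj lmapE hs.
have EB : B = u * g * u^-1 by rewrite /g !mulrA mulrV // mul1r mulrK.
clearbody g.
have eB : lmap s B * lmap s u = lmap s u * tau kM ^ d * u^-1 * B * u * (tau kM ^ d)^-1.
  rewrite EB (lmapM s (u * g) u^-1) (lmapM s u g) (lmapV s u0) (mulrVK suu) eg.
  by rewrite !mulrA (mulrVK uu) (mulrVK uu).
split=> [e|e].
  by apply: (mulIr suu); rewrite eB -e !mulrA (mulrVK uu) (mulrK tu).
by rewrite e in eB; rewrite !mulrA eB (mulrVK tu) (mulrK uu).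
Qed.

End Choice.

Lemma rho_centralizer B : centralizer_in (D_phi phi) (rho_inf phi @` Weil kL LLbar) B <->
  D_phi phi B /\ forall s, Weil kL LLbar s -> lmap s B = B.
Proof.
pose u := xget 1 (rho_admissible phi).
have hu : rho_admissible phi u by apply: xgetPex; apply: admissible_ex.
have wd s : Weil kL LLbar s -> acts_with_degree kL LLbar s (Weil_deg kL LLbar s).
  by move=> [_ ex]; apply: (xgetPex 0 ex).
split=> -[hB h]; split=> // s hs.
  by apply/(rho_fixed hu hB (wd s hs)); apply: h; exists s.
move: hs => [s' hs' <-]; exact/(rho_fixed hu hB (wd s' hs'))/h.
Qed.

End Rho.

Section Fixed.
Variables (k : finFieldType) (L : fieldType) (kL : {rmorphism k -> L}).
Variables (Lbar : closedFieldType) (LLbar : {rmorphism L -> Lbar}).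

Lemma inP_fixed x (s : {rmorphism Lbar -> Lbar}) : inP k LLbar x -> Weil kL LLbar s -> s x = x.
Proof.
move=> [m [c e]] [[_ hs] _]; apply: (qexp_inj (LLbar \o kL : {rmorphism k -> Lbar}) (n := m)) => /=.
by rewrite -rmorphXn /= e hs.
Qed.

Lemma lmap_fixed (B : laurent (LLbar \o kL : {rmorphism k -> Lbar})) :
  finitely_generated_field L -> is_algebraic_closure LLbar ->
  (forall s, Weil kL LLbar s -> lmap s B = B) <-> (forall i, inP k LLbar (B i)).
Proof.
move=> hL hLbar; split=> [h i|h s hs].
  apply: (Weil_fixed_inP hL hLbar) => s hs.
  by have := congr1 (fun f : laurent _ => f i) (h s hs); rewrite lmapE.
by apply: lauP => i; rewrite lmapE; apply: inP_fixed.
Qed.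

End Fixed.

(** * The centralizer *)

(** Finite generation of F as a field reduces commutation with phi(A) to finitely many conditions in
    [D_phi_close]. *)
Lemma function_field_gens (k : finFieldType) (F : fieldType) (kF : {rmorphism k -> F}) :
  global_function_field kF -> exists s : seq F, forall Z : set F, Z 1 ->
  (forall x y, Z x -> Z y -> Z (x - y)) -> (forall x y, Z x -> Z y -> Z (x * y)) ->
  (forall x, Z x -> Z x^-1) -> (forall x, x \in s -> Z x) -> forall x, Z x.
Proof.
move=> [[t0 _ [m [b hb]]] _].
exists (t0 :: [seq kF c | c <- enum k] ++ [seq b i | i <- enum 'I_m]) => Z Z1 ZB ZM ZV Zs x.
have Z0 : Z 0 by rewrite -(subrr 1); apply: ZB.
have ZN z : Z z -> Z (- z) by move=> hz; rewrite -sub0r; apply: ZB.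
have ZD y z : Z y -> Z z -> Z (y + z).
  by move=> hy /ZN hz; rewrite -[z]opprK; apply: (ZB).
have Zsum I (r : seq I) (P : pred I) (G : I -> F) :
    (forall i, P i -> Z (G i)) -> Z (\sum_(i <- r | P i) G i) by move=> h; apply: (big_ind Z).
have Zt : Z t0 by apply: Zs; rewrite inE eqxx.
have Zk c : Z (kF c) by apply: Zs; rewrite inE mem_cat map_f ?orbT // mem_enum.
have Zb i : Z (b i).
  by apply: Zs; rewrite inE mem_cat [X in _ || (_ || X)]map_f ?orbT // mem_enum.
have Zp (p : {poly k}) : Z (map_poly kF p).[t0].
  rewrite horner_coef; apply: Zsum => i _; apply: (ZM); first by rewrite coef_map; apply: Zk.
  by elim: (i : nat) => [|l IH]; [rewrite expr0|rewrite exprS; apply: (ZM)].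
have [c [hc ->]] := hb x; apply: Zsum => i _; apply: (ZM) => //.
by have [p [r [_ ->]]] := hc i; apply: (ZM); [|apply: (ZV)]; apply: Zp.
Qed.

Section Endomorphisms.
Variables (k : finFieldType) (F : fieldType) (kF : {rmorphism k -> F}).
Hypothesis hF : global_function_field kF.
Variable ord : F -> \bar int.
Variables (Finf : fieldType) (FFinf : {rmorphism F -> Finf}) (ordinf : Finf -> \bar int).
Hypothesis hFinf : is_completion ord FFinf ordinf.
Variables (L : fieldType) (hL : finitely_generated_field L) (kL : {rmorphism k -> L}).
Variables (Lbar : closedFieldType) (LLbar : {rmorphism L -> Lbar}).
Local Notation kM := (LLbar \o kL : {rmorphism k -> Lbar}).
Local Notation lau := (laurent kM).
Local Notation Fr := (frobz kM).
Local Notation q := #|k|.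
Local Notation A := (ringA ord).
Local Notation inP := (inP k LLbar).
Variable phi : {rmorphism A -> lau}.
Hypothesis hphi : forall a, twisted_poly (phi a).
Hypothesis hgen : generic_characteristic phi.

Lemma generic_inj a : phi a = 0 -> a = 0.
Proof. by move=> e; apply: hgen; rewrite e rmorph0. Qed.

Lemma twisted_polyM_neg (f g : lau) i : twisted_poly f -> twisted_poly g -> i < 0 -> (f * g) i = 0.
Proof.
move=> [hf _] [hg _] i0; rewrite lcoefM; apply: fsbig1 => j _.
have [j0|j0] := ltP j 0; first by rewrite hf ?mul0r.
by rewrite hg ?rmorph0 ?mulr0 //; lia.
Qed.

Lemma twisted_polyM0 (f g : lau) : twisted_poly f -> twisted_poly g -> (f * g) 0 = f 0 * g 0.
Proof.
move=> [hf _] [hg _]; rewrite lcoefM (@zsum1 _ _ 0); first by rewrite subr0 frobz0.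
move=> i i0; have [j0|j0] := ltP i 0; first by rewrite hf ?mul0r.
by rewrite hg ?rmorph0 ?mulr0 //; move/eqP: i0; lia.
Qed.

Lemma phi_exp0 a m : phi (a ^+ m) 0 = phi a 0 ^+ m.
Proof.
elim: m => [|m IH]; first by rewrite !expr0 rmorph1.
by rewrite !exprS rmorphM twisted_polyM0 // IH.
Qed.

Variable t : A.
Hypothesis t_deg : 0 < ldeg (phi t).

Lemma window_phi f B : D_phi phi f -> (forall i, inP (f i)) -> exists i j g,
  [/\ (i < j)%N, twisted_poly g, g * phi t = phi t * g &
      ldle (f * (phi t ^+ j - phi t ^+ i) - g) (- B%:Z)].
Proof.
move=> fD fP; have [n' [P [hf hP Pn _]]] := phi_shape hphi t_deg.
(* In generic characteristic a periodic theta would give t^(q^(r+1)) = t in A. *)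
have nper r : P 0%N ^+ (q ^ r.+1) <> P 0%N.
  move=> e; have q1 : (1 < q ^ r.+1)%N by rewrite -(exp1n r.+1) ltn_exp2r // card_gt1.
  have /eqP := t_nper generic_inj t_deg q1; apply; apply: hgen.
  by rewrite phi_exp0 -[0 in LHS]/(0%N%:Z) -[0 in RHS]/(0%N%:Z) hP -rmorphXn e.
have [r|m [T [pT T_nroot]]] := not_inf_divisible kL hL (x := P 0%N); first exact/eqP/nper.
have T_nper r : T ^+ (q ^ r.+1) != T.
  by apply/eqP => e; apply: (nper r); rewrite pT exprAC e.
have [|i [j [g [ij gt gc hg]]]] := window_finite hf hP Pn hL pT T_nroot T_nper (f := f) B.
  by split.
by exists i, j, g.
Qed.

Variables (e : nat) (Phi : Finf -> lau).
Hypotheses (e0 : (0 < e)%N) (PhiB : forall x y, Phi (x - y) = Phi x - Phi y)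
  (PhiM : forall x y, Phi (x * y) = Phi x * Phi y) (Phi1 : Phi 1 = 1)
  (PhiA : forall a : A, Phi (FFinf (a : F)) = phi a)
  (Phi_vge : forall N x, vge ordinf N x -> ldle (Phi x) (- (e%:Z * N)))
  (Phi_inP : forall x i, inP (Phi x i))
  (Phi_ord : forall x, ord_tauV (Phi x) = (e%:Z%:E * ordinf x)%E).

Lemma Phi0 : Phi 0 = 0. Proof. by rewrite -(subrr 0) PhiB subrr. Qed.
Lemma PhiD x y : Phi (x + y) = Phi x + Phi y.
Proof.
have -> : x + y = x - (0 - y) by rewrite sub0r opprK.
by rewrite !PhiB Phi0 sub0r opprK.
Qed.
Lemma Phi_sum I (r : seq I) (P : pred I) (G : I -> Finf) :
  Phi (\sum_(i <- r | P i) G i) = \sum_(i <- r | P i) Phi (G i).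
Proof. exact: (big_morph Phi PhiD Phi0). Qed.
Lemma PhiC x y : Phi x * Phi y = Phi y * Phi x.
Proof. by rewrite -!PhiM mulrC. Qed.
Lemma PhiV x : x != 0 -> Phi x * Phi x^-1 = 1.
Proof. by move=> x0; rewrite -PhiM mulfV. Qed.
Lemma Phi_neq0 x : x != 0 -> Phi x != 0.
Proof.
move=> /PhiV h; apply/eqP => e1; move: h; rewrite e1 mul0r => /esym/eqP.
by rewrite oner_eq0.
Qed.
Lemma Phi_commV x (g : lau) : g * Phi x = Phi x * g -> g * Phi x^-1 = Phi x^-1 * g.
Proof.
move=> h; have [->|x0] := eqVneq x 0; first by rewrite invr0 Phi0 mul0r mulr0.
have u : Phi x \is a GRing.unit by rewrite lau_unitE Phi_neq0.
have -> : Phi x^-1 = (Phi x)^-1 by apply: (mulrI u); rewrite PhiV // mulrV.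
exact: lau_commV.
Qed.

Lemma ldle_abs (f : lau) : ldle f `|ldeg f|%N%:Z.
Proof.
have [->|f0] := eqVneq f 0; first exact: ldle0.
by have [_ h] := ldegP f0; apply: (ldle_trans h); lia.
Qed.

(** The commutator of g with phi_a is a twisted polynomial, and it equals that of phi_a with f - g;
    so it vanishes once f - g has degree below - deg phi_a. B0 ensures this for numerators and
    denominators of a finite set of generators of F. *)
Lemma D_phi_close : exists B0 : nat, forall g, twisted_poly g ->
  (exists2 f, D_phi phi f & ldle (f - g) (- B0%:Z)) -> D_phi phi g.
Proof.
have [s hs] := function_field_gens hF.
have /choice[nd hnd] : forall x : F, exists ab : A * A,
    ab.2 != 0 /\ x * (ab.2 : F) = (ab.1 : F).
  by move=> x; have [a [b h]] := frac_A hF generic_inj t_deg x; exists (a, b).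
pose w x := (`|ldeg (phi (nd x).1)| + `|ldeg (phi (nd x).2)|)%N.
exists (\sum_(x <- s) w x).+1 => g gt [f fD fg].
have comm (a : A) : (`|ldeg (phi a)| <= \sum_(x <- s) w x)%N -> g * phi a = phi a * g.
  move=> le; apply/eqP; rewrite -subr_eq0; apply/eqP/lauP => i; rewrite lcoef0.
  have [i0|i0] := ltP i 0.
    by rewrite lcoefB !twisted_polyM_neg // subrr.
  have -> : g * phi a - phi a * g = phi a * (f - g) - (f - g) * phi a.
    by rewrite mulrBr mulrBl fD opprB [RHS]addrC addrA subrK.
  have h1 := ldleM (ldle_abs (f := phi a)) fg; have h2 := ldleM fg (ldle_abs (f := phi a)).
  by rewrite lcoefB h1 ?h2 ?subrr //; lia.
have wle x : x \in s -> (w x <= \sum_(x <- s) w x)%N.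
  by move=> xs; rewrite (big_rem x) //= leq_addr.
have all_ x : g * Phi (FFinf x) = Phi (FFinf x) * g.
  move: x; apply: hs.
  - by rewrite rmorph1 Phi1 mulr1 mul1r.
  - by move=> x y hx hy; rewrite rmorphB PhiB mulrBl mulrBr hx hy.
  - by move=> x y hx hy; rewrite rmorphM PhiM mulrA hx -mulrA hy mulrA.
  - by move=> x hx; rewrite fmorphV; apply: Phi_commV.
  - move=> x /wle; rewrite /w => le; have [b0 exab] := hnd x.
    have ca := comm (nd x).1 (leq_trans (leq_addr _ _) le).
    have cb := comm (nd x).2 (leq_trans (leq_addl _ _) le).
    have u : phi (nd x).2 \is a GRing.unit by rewrite lau_unitE (phi_neq generic_inj).
    have ex : Phi (FFinf x) * phi (nd x).2 = phi (nd x).1.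
      by rewrite -!PhiA -PhiM -rmorphM exab.
    apply: (mulIr u); rewrite -mulrA ex ca -[in RHS]mulrA cb mulrA ex.
    by [].
by move=> a; have := all_ (a : F); rewrite PhiA.
Qed.

(** The image of the tensor product, written with [Phi]; the identification of [phi_inf] with [Phi]
    is made in the final theorem. *)
Definition End_span : set lau := [set f | exists (m : nat) (c : 'I_m -> lau) (x : 'I_m -> Finf),
  (forall i, End_phi phi (c i)) /\ f = \sum_i c i * Phi (x i)].

Lemma End_span0 : End_span 0.
Proof. by exists 0%N, (fun=> 0), (fun=> 0); split=> [[]|] //; rewrite big_ord0. Qed.

Lemma End_spanD f g : End_span f -> End_span g -> End_span (f + g).
Proof.
move=> [m [c [x [hc ->]]]] [m' [c' [x' [hc' ->]]]].
exists (m + m')%N, (fun i => match fintype.split i with inl j => c j | inr j => c' j end),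
  (fun i => match fintype.split i with inl j => x j | inr j => x' j end); split.
  by move=> i; case: (fintype.split i).
rewrite big_split_ord /=; congr (_ + _); apply: eq_bigr => i _.
  by rewrite (unsplitK (inl i)).
by rewrite (unsplitK (inr i)).
Qed.

Lemma End_span_sum I (r : seq I) (P : pred I) (G : I -> lau) :
  (forall i, P i -> End_span (G i)) -> End_span (\sum_(i <- r | P i) G i).
Proof. by move=> h; apply: (big_ind End_span) => //; [exact: End_span0|exact: End_spanD]. Qed.

Lemma End_spanM f y : End_span f -> End_span (f * Phi y).
Proof.
move=> [m [c [x [hc ->]]]]; exists m, c, (fun i => x i * y); split=> //.
by rewrite mulr_suml; apply: eq_bigr => i _; rewrite PhiM mulrA.
Qed.

Let good f := D_phi phi f /\ forall i, inP (f i).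

Lemma goodB f g : good f -> good g -> good (f - g).
Proof.
move=> [fD fP] [gD gP]; split=> [a|i]; first by rewrite mulrBl mulrBr fD gD.
by rewrite lcoefB; apply: (inPB kL).
Qed.
Lemma goodM f g : good f -> good g -> good (f * g).
Proof.
move=> [fD fP] [gD gP]; split=> [a|]; first by rewrite -mulrA gD mulrA fD mulrA.
apply: (lcoefs_inM (S := inP)) => //; first exact: inP1.
- by move=> x y; apply: (inPB kL).
- by move=> x y; apply: inPM.
- by move=> i x; apply: inPF.
Qed.
Lemma good_Phi x : good (Phi x).
Proof. by split=> [a|i]; [rewrite -PhiA PhiC|apply: Phi_inP]. Qed.

Lemma End_span_good f : End_span f -> good f.
Proof.
move=> [m [c [x [hc ->]]]]; apply: (big_ind good) => [|g h hg hh|i _].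
- by rewrite -(subrr 1) -Phi1; apply: goodB; apply: good_Phi.
- have h0 : good 0 by rewrite -(subrr 1) -Phi1; apply: goodB; apply: good_Phi.
  by rewrite -[h]opprK -[- h]sub0r; do 2!apply: goodB => //.
- apply: goodM; last exact: good_Phi.
  have [[_ hL'] hD] := hc i; split=> // j; have [l ->] := hL' j.
  by apply: inP_L; exists l.
Qed.

(** An endomorphism g approximates f phi_a for a = t^j - t^i. As phi_a has positive degree, dividing
    by it only improves the approximation. *)
Lemma End_span_dense f (K : nat) : good f -> exists2 g, End_span g & ldle (f - g) (- K%:Z).
Proof.
move=> [fD fP]; have [B0 hB0] := D_phi_close.
have [i [j [g [ij gt gc hg]]]] := window_phi (B0 + K)%N fD fP.
pose a : A := t ^+ j - t ^+ i.
have ea : phi a = phi t ^+ j - phi t ^+ i by rewrite rmorphB !rmorphXn.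
rewrite -ea in hg.
have gD : D_phi phi g.
  apply: hB0 => //; exists (f * phi a); last by apply: (ldle_trans hg); lia.
  by move=> b; rewrite -mulrA -rmorphM [a * b]mulrC rmorphM mulrA fD mulrA.
have pt0 : phi t != 0 by apply: phi_t_neq0.
have [pj dj] := ldegX t_deg j pt0; have [pi di] := ldegX t_deg i pt0.
have [pj1 hj] := ldegP pj; have [pi1 hi] := ldegP pi.
have lt_ij : ldeg (phi t ^+ i) < ldeg (phi t ^+ j) by rewrite dj di; move: t_deg ij; nia.
have da : phi a (ldeg (phi t ^+ j)) != 0 by rewrite ea lcoefB hi // subr0.
have a0 : phi a != 0 by apply: contraNneq da => ->; rewrite lcoef0.
have dega : ldeg (phi a) = ldeg (phi t ^+ j).
  apply: ldeg_uniq => //; rewrite ea; apply: ldleB => //; apply: (ldle_trans hi); exact: ltW.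
have u : phi a \is a GRing.unit by rewrite lau_unitE.
have x0 : FFinf (a : F) != 0.
  by apply: contraNneq a0 => x0; rewrite -PhiA x0 Phi0.
have eV : Phi (FFinf (a : F))^-1 = (phi a)^-1.
  by apply: (mulrI u); rewrite mulrV // -PhiA PhiV.
exists (g * Phi (FFinf (a : F))^-1).
  exists 1%N, (fun=> g), (fun=> (FFinf (a : F))^-1); split; first by split.
  by rewrite big_ord1.
have -> : f - g * Phi (FFinf (a : F))^-1 = (f * phi a - g) * (phi a)^-1.
  by rewrite eV mulrBl mulrK.
have hV : ldle (phi a)^-1 (- ldeg (phi t ^+ j)).
  have V0 : (phi a)^-1 != 0 by rewrite -lau_unitE unitrV.
  by have [_ h] := ldegP V0; rewrite ldegV // dega in h.
apply: (ldle_trans (ldleM hg hV)); rewrite dj; move: t_deg; nia.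
Qed.

(** Each further coefficient is a root of a nonzero polynomial determined by the previous ones,
    hence takes finitely many values. *)
Lemma windows n : exists l : seq lau, forall f, f * phi t = phi t * f -> ldle f 0 ->
  ltrunc (- n%:Z) f \in l.
Proof.
elim: n => [|n [l hl]].
  exists [:: 0] => f _ f0; rewrite inE; apply/eqP/ltrunc_small; exact: f0.
have pt0 : phi t != 0 by apply: phi_t_neq0.
have [tN ht] := ldegP pt0; have [n' [_ [_ _ _ en]]] := phi_shape hphi t_deg.
rewrite en in tN ht; set N := n'.+1%:Z in tN ht.
pose i : int := - n%:Z.
have /choice[R hR] : forall g : lau, exists r : seq Lbar, forall c,
    c * Fr i (phi t N) - phi t N * Fr N c = (phi t * g - g * phi t) (i + N) -> c \in r.
  move=> g; pose d := (phi t * g - g * phi t) (i + N).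
  pose Q : {poly Lbar} := phi t N *: 'X^(q ^ n'.+1) - Fr i (phi t N) *: 'X + d%:P.
  have q1 : (1 < q ^ n'.+1)%N by rewrite -(exp1n n'.+1) ltn_exp2r // card_gt1.
  have Q0 : Q != 0.
    apply/eqP => /(congr1 (fun p : {poly Lbar} => p`_(q ^ n'.+1))).
    rewrite /Q coefD coefB !coefZ coefXn coefX coefC eqxx mulr1 coef0.
    have -> : (q ^ n'.+1 == 1)%N = false by lia.
    have -> : (q ^ n'.+1 == 0)%N = false by lia.
    by rewrite mulr0 subr0 addr0 => /eqP; rewrite (negbTE tN).
  have [rs eQ] := closed_field_poly_normal Q; exists rs => c ec.
  have : root Q c.
    rewrite rootE /Q !hornerD hornerN !hornerZ hornerXn hornerX hornerC /d -ec; apply/eqP.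
    by rewrite -[c ^+ _]/(Fr N c); ring.
  by rewrite eQ rootZ ?lead_coef_eq0 // root_prod_XsubC.
exists [seq g + lmonomial kM c i | g <- l, c <- R g] => f fc f0.
have -> : ltrunc (- n.+1%:Z) f = ltrunc i f + lmonomial kM (f i) i.
  apply: lauP => j; rewrite lcoefD !ltruncE /=.
  have -> : (j == i) = (- n.+1%:Z < j) && ~~ (i < j) by rewrite /i; lia.
  case: ltP => [h1|h1]; case: ltP => [h2|h2] /=; rewrite ?addr0 ?add0r //.
    by congr (f _); rewrite /i in h2 *; lia.
  by rewrite /i in h2; lia.
apply/allpairsPdep; exists (ltrunc i f), (f i); split=> //; first exact: hl.
by apply: hR; apply: comm_top.
Qed.

(** These are the digits of the expansion. By density, each truncation of an element of the
    centralizer is also one of an element of [End_span], and by [windows] there are finitely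
    many. *)
Lemma End_span_reps : exists ds : seq lau, (forall d, d \in ds -> End_span d /\ ldle d 0) /\
  forall f, good f -> ldle f 0 -> exists2 d, d \in ds & ldle (f - d) (- ldeg (phi t)).
Proof.
have [n' [_ [_ _ _ en]]] := phi_shape hphi t_deg; rewrite en.
have [l hl] := windows n'.+1.
have [ds [ds1 ds2]] : exists ds : seq lau, (forall d, d \in ds -> End_span d /\ ldle d 0) /\
    forall g, End_span g -> ldle g 0 -> ltrunc (- n'.+1%:Z) g \in l ->
    exists2 d, d \in ds & ltrunc (- n'.+1%:Z) d = ltrunc (- n'.+1%:Z) g.
  elim: l {hl} => [|c l [ds [ds1 ds2]]]; first by exists [::].
  have [[g [gS g0 gc]]|nex] := pselect (exists g, [/\ End_span g, ldle g 0 & ltrunc (- n'.+1%:Z) g = c]).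
    exists (g :: ds); split=> [d|h hS h0].
      by rewrite inE => /orP[/eqP ->|/ds1].
    rewrite inE => /orP[/eqP hc|hc]; first by exists g; rewrite ?mem_head // gc hc.
    by have [d dd ed] := ds2 h hS h0 hc; exists d; rewrite ?inE ?dd ?orbT.
  exists ds; split=> // h hS h0; rewrite inE => /orP[/eqP hc|]; last exact: ds2.
  by case: nex; exists h.
exists ds; split=> // f fg f0; have [g gS hg] := End_span_dense n'.+1 fg.
have g0 : ldle g 0.
  by move=> i i0; have := hg i; rewrite lcoefB f0 // sub0r => /(_ _)/eqP; rewrite oppr_eq0 => h; apply/eqP/h; lia.
have etr : ltrunc (- n'.+1%:Z) g = ltrunc (- n'.+1%:Z) f.
  apply: lauP => i; rewrite !ltruncE; case: ifP => // h.
  by apply/eqP; rewrite eq_sym -subr_eq0 -lcoefB hg.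
have gc : g * phi t = phi t * g by have [gD _] := End_span_good gS; apply: gD.
have [d dd ed] := ds2 g gS g0 (hl g gc g0); exists d => // i hi.
have := congr1 (fun h : lau => h i) (etrans ed etr); rewrite !ltruncE hi => e1.
by rewrite lcoefB e1 subrr.
Qed.

Let T := (FFinf (t : F))^-1.

Lemma T_facts : exists o : nat, [/\ (0 < o)%N, ldeg (phi t) = (e * o)%N%:Z,
  FFinf (t : F) != 0 & forall m : nat, vge ordinf (o * m)%N%:Z (T ^+ m)].
Proof.
have hv : discrete_valuation ordinf by case: hFinf.
have pt0 : phi t != 0 by apply: phi_t_neq0.
have t0 : FFinf (t : F) != 0.
  by apply: contraNneq pt0 => x0; rewrite -PhiA x0 Phi0.
have [o eo] := dval_fin hv t0.
have := Phi_ord (FFinf (t : F)); rewrite PhiA /ord_tauV (negbTE pt0) eo => -[edeg].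
have o0 : o < 0.
  rewrite ltNge; apply/negP => o0; have : 0 <= e%:Z * o by apply: mulr_ge0.
  by rewrite -edeg oppr_ge0 leNgt t_deg.
have eo1 : `|o|%N%:Z = - o by lia.
exists `|o|%N; split=> //; [lia|by rewrite PoszM eo1 mulrN -edeg opprK|move=> m].
have eT : ordinf T = (- o)%:E.
  have T0 : T != 0 by rewrite invr_eq0.
  have [o' eo'] := dval_fin hv T0; rewrite eo'.
  have := dvalM hv T (FFinf (t : F)); rewrite mulVf // (dval1 hv) eo eo' => -[] h.
  by congr EFin; lia.
rewrite /vge (dvalX hv m eT) lee_fin; nia.
Qed.

(** c marks the positions at which one digit occurs in the expansion; the series converges because T
    = 1/t has positive valuation. *)
Lemma partial_cvg (c : nat -> bool) : exists x, forall K : nat, exists n0, forall n, (n0 <= n)%N ->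
  vge ordinf K%:Z (\sum_(m < n) (if c m then T ^+ m else 0) - x).
Proof.
have hv : discrete_valuation ordinf by case: hFinf.
have [o [o0 _ _ hT]] := T_facts.
pose u n := \sum_(m < n) (if c m then T ^+ m else 0).
have dif m n : (m <= n)%N -> vge ordinf m%:Z (u n - u m).
  move=> mn; rewrite /u -!(big_mkord xpredT (fun m => if c m then T ^+ m else 0)).
  rewrite (big_cat_nat (leq0n m) mn) //= addrAC subrr add0r big_nat; apply: (vge_sum hv) => l /andP[ml _].
  by case: ifP => _; [apply: vge_le (hT l); nia|apply: vge0].
have [|x hx] := (let: And4 _ _ _ h := hFinf in h) u.
  move=> N; exists `|N|%N => m n hm hn; rewrite -/(vge ordinf N (u m - u n)).
  have h1 := dif _ _ hm; have h2 := dif _ _ hn.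
  have -> : u m - u n = (u m - u `|N|%N) - (u n - u `|N|%N) by ring.
  apply: (vge_le (b := `|N|%N%:Z)); first by lia.
  exact: vgeB.
by exists x => K; apply: hx.
Qed.

Lemma small_End_span f : good f -> ldle f 0 -> End_span f.
Proof.
move=> fg f0; have [ds [ds1 ds2]] := End_span_reps.
have [o [o0 eN t0 hT]] := T_facts.
have hv : discrete_valuation ordinf by case: hFinf.
have /choice[idx hidx] : forall g, exists i, good g -> ldle g 0 ->
    (i < size ds)%N /\ ldle (g - ds`_i) (- ldeg (phi t)).
  move=> g; have [[gg g0]|ng] := pselect (good g /\ ldle g 0); last first.
    by exists 0%N => gg g0; case: ng.
  have [d dd hd] := ds2 g gg g0; exists (index d ds) => _ _.
  by rewrite index_mem nth_index.
(* The remainder after n digits, rescaled to degree at most 0. *)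
pose fs n := iter n (fun g => (g - ds`_(idx g)) * phi t) f.
have fsP n : good (fs n) /\ ldle (fs n) 0.
  elim: n => [|n [gg g0]]; first by split.
  have [lt hd] := hidx _ gg g0; have [dS _] := ds1 _ (mem_nth 0 lt).
  rewrite /fs iterS -/(fs n); split.
    apply: goodM; first by apply: goodB => //; apply: End_span_good.
    by rewrite -PhiA; apply: good_Phi.
  have [_ ht] := ldegP (phi_t_neq0 t_deg).
  by have := ldleM hd ht; rewrite addNr.
have iP n : (idx (fs n) < size ds)%N by have [gg g0] := fsP n; have [] := hidx _ gg g0.
have TP n : phi t * Phi (T ^+ n.+1) = Phi (T ^+ n).
  by rewrite -PhiA -PhiM exprS mulrA mulfV // mul1r.
have sumE n : f = \sum_(m < n) ds`_(idx (fs m)) * Phi (T ^+ m) + fs n * Phi (T ^+ n).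
  elim: n => [|n IH]; first by rewrite big_ord0 add0r expr0 Phi1 mulr1.
  rewrite {1}IH big_ord_recr /= -addrA; congr (_ + _).
  by rewrite -mulrA TP mulrBl addrC subrK.
have /choice[x hx] := fun j => partial_cvg (fun m => idx (fs m) == j).
pose u j n := \sum_(m < n) (if idx (fs m) == j then T ^+ m else 0).
(* Grouping the terms by digit leaves finitely many summands, as membership in [End_span]
   demands. *)
have regroup n : \sum_(m < n) ds`_(idx (fs m)) * Phi (T ^+ m) =
    \sum_(j < size ds) ds`_j * Phi (u j n).
  under [RHS]eq_bigr => j _ do rewrite /u Phi_sum mulr_sumr.
  rewrite exchange_big /=; apply: eq_bigr => m _.
  rewrite (bigD1 (Ordinal (iP m))) //= eqxx big1 ?addr0 // => j ne.
  have -> : (idx (fs m) == j) = false by apply/negbTE; rewrite eq_sym; apply: ne.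
  by rewrite Phi0 mulr0.
suff -> : f = \sum_(j < size ds) ds`_j * Phi (x j).
  apply: End_span_sum => j _; apply: End_spanM.
  by have [] := ds1 _ (mem_nth 0 (ltn_ord j)).
apply: lau_small => K.
have /choice[n0 hn0] := fun j => hx j K.
pose n := (K + \sum_(j < size ds) n0 j)%N.
rewrite {1}(sumE n) regroup addrAC -sumrB; apply: ldleD; last first.
  have [_ g0] := fsP n; have hn := Phi_vge (hT n).
  by apply: (ldle_trans (ldleM g0 hn)); rewrite /n; move: e0 o0; nia.
apply: ldle_sum => j _; rewrite -mulrBr -PhiB.
have nj : (n0 j <= n)%N by rewrite /n (bigD1 j) //=; lia.
have [_ d0] := ds1 _ (mem_nth 0 (ltn_ord j)).
by apply: (ldle_trans (ldleM d0 (Phi_vge (hn0 j n nj)))); move: e0; nia.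
Qed.

Lemma good_End_span f : good f -> End_span f.
Proof.
move=> fg; have [a ha] := ldle_ex f; have [o [o0 eN t0 hT]] := T_facts.
pose m := `|a|%N.
have -> : f = f * Phi (T ^+ m) * Phi (FFinf (t : F) ^+ m).
  by rewrite -mulrA -PhiM /T exprVn mulVf ?expf_neq0 // Phi1 mulr1.
apply: End_spanM; apply: small_End_span; first by apply: goodM => //; apply: good_Phi.
by apply: (ldle_trans (ldleM ha (Phi_vge (hT m)))); rewrite /m; move: e0 o0; nia.
Qed.

End Endomorphisms.

Lemma nonconstant_ex (k : finFieldType) (F : fieldType) (ord : F -> \bar int)
    (L : fieldType) (kL : {rmorphism k -> L})
    (Lbar : closedFieldType) (LLbar : {rmorphism L -> Lbar})
    (phi : {rmorphism ringA ord -> laurent (LLbar \o kL)}) :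
  drinfeld_module phi -> exists t, 0 < ldeg (phi t).
Proof.
move=> [hp nc]; apply: contrapT => h; apply: nc => a.
have [p0 pc] := hp a; have [c ec] := pc 0; exists c; apply: lauP => i /=.
case: (ltgtP i 0) => [/p0 //|i0|->]; last exact: ec.
have [->|a0] := eqVneq (phi a) 0; first by rewrite lcoef0.
have [_ hd] := ldegP a0; apply: hd; apply: le_lt_trans i0.
by rewrite leNgt; apply/negP => ha; apply: h; exists a.
Qed.

Theorem theorem4p1
  (k : finFieldType) (F : fieldType) (kF : {rmorphism k -> F})
  (hF : global_function_field kF)
  (ord : F -> \bar int) (hord : discrete_valuation ord)
  (Finf : fieldType) (FFinf : {rmorphism F -> Finf}) (ordinf : Finf -> \bar int)
  (hFinf : is_completion ord FFinf ordinf)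
  (L : fieldType) (hL : finitely_generated_field L) (kL : {rmorphism k -> L})
  (Lbar : closedFieldType) (LLbar : {rmorphism L -> Lbar})
  (hLbar : is_algebraic_closure LLbar)
  (phi : {rmorphism ringA ord -> laurent (LLbar \o kL)})
  (hphi : drinfeld_module phi) (hgen : generic_characteristic phi) :
  centralizer_in (D_phi phi) (rho_inf phi @` Weil kL LLbar) =
  End_phi_tensor_image kF FFinf ordinf phi.
Proof.
have [hp _] := hphi; have [t t_deg] := nonconstant_ex hphi.
have inj := generic_inj hgen.
have [e [e0 hdeg]] := ord_deg hF inj t_deg.
have [Phi [[PB PM P1 PA] [Pord Pvge Pcoefs Puniq]]] :=
  extension_props hF hord hFinf inj t_deg e0 hdeg.
have PinP x i : inP k LLbar (Phi x i).
  apply: (Pcoefs (inP k LLbar)) => [|u v|u v|u|j u|a j]; first exact: inP1.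
  - exact: (inPB kL).
  - exact: inPM.
  - exact: inPV.
  - exact: inPF.
  - by have [_ /(_ j)[c ->]] := hp a; apply: inP_L; exists c.
(* [is_extension] normalizes valuations by rank times residue degree, so e has to be this product.
   The residue degree d divides e, e / d satisfies [has_rank], and the nonzero value ord t forces
   the chosen [rank] to give the same product. *)
have rk : (rank kF FFinf ordinf phi)%:Z * (d_inf kF FFinf ordinf)%:Z = e%:Z.
  have rb : exists b : 'I_(d_inf kF FFinf ordinf) -> Finf,
      residue_basis (FFinf \o kF : {rmorphism k -> Finf}) ordinf b.
    exact: (xgetPex 0%N (residue_basis_ex hF hord hFinf inj t_deg e0 hdeg)).
  have [b hb] := rb.
  have dvd := residue_dvd hF hord hFinf inj t_deg e0 hdeg hb.
  have ldegE (a : ringA ord) o : a != 0 -> ord a = o%:E -> ldeg (phi a) = - (e%:Z * o).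
    by move=> a0 eo; rewrite -(PhiF_A inj); apply: hdeg => //; apply: A_neq0.
  have hr : has_rank kF FFinf ordinf phi (e %/ d_inf kF FFinf ordinf).
    move=> a a0; have [o eo] := dval_fin hord (A_neq0 a0).
    by rewrite (ldegE _ _ a0 eo) eo -PoszM divnK.
  have hr' : has_rank kF FFinf ordinf phi (rank kF FFinf ordinf phi).
    exact: (xgetPex 0%N (ex_intro _ _ hr)).
  have t0 := t_neq0 t_deg; have [o eo] := dval_fin hord (A_neq0 t0).
  have := hr' t t0; rewrite (ldegE _ _ t0 eo) eo => -[] /oppr_inj h.
  have o0 : o != 0.
    by apply: contraTneq t_deg => o0; rewrite (ldegE _ _ t0 eo) o0 mulr0 oppr0.
  by apply: (mulIf o0); rewrite -h.
(* [phi_inf] chooses an extension separately for each x; uniqueness identifies every choice with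
   [Phi]. *)
have phiE x : phi_inf kF FFinf ordinf phi x = Phi x.
  have ext : is_extension kF FFinf ordinf phi Phi.
    by split=> // [y i|y]; [apply: (inP_perf kL)|rewrite rk].
  have ex : exists y, exists2 Phi', is_extension kF FFinf ordinf phi Phi' & y = Phi' x.
    by exists (Phi x), Phi.
  have [Phi' [PB' [_ PM'] _ PA' Pord'] e1] := xgetPex 0 ex.
  rewrite /phi_inf e1; apply: Puniq => //.
  by move=> y; rewrite Pord' rk.
apply/seteqP; split=> f.
  move=> /(rho_centralizer hLbar hp t_deg f)[fD fs].
  have fP := (lmap_fixed f hL hLbar).1 fs.
  have [m [c [x [hc ->]]]] : End_span phi Phi f.
    exact: (good_End_span hF hFinf hL hp hgen t_deg e0 PB PM P1 PA Pvge PinP Pord (conj fD fP)).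
  by exists m, c, x; split=> //; apply: eq_bigr => i _; rewrite phiE.
move=> [m [c [x [hc ->]]]]; apply/(rho_centralizer hLbar hp t_deg).
have fS : End_span phi Phi (\sum_i c i * phi_inf kF FFinf ordinf phi (x i)).
  by exists m, c, x; split=> //; apply: eq_bigr => i _; rewrite phiE.
have [fD fP] := End_span_good (FFinf := FFinf) PM P1 PA PinP fS.
by split=> // s hs; apply: (lmap_fixed _ hL hLbar).2.
Qed.
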